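(* Let $\{X_t,t\geq0\}$ be an irreducible continuous-time Markov chain on a countable state space $I$, with honest, standard transition function, regular $Q$-matrix $(q_{xy})$ and almost surely infinite first flying time, reversible with respect to a measure $\{m_x\}_{x\in I}$ (all as described in the context). For $\lambda>0$ and $x\in I$, let $C_{x\leftrightarrow\Delta}(\lambda)$ be the effective conductance between $x$ and $\Delta$ in the associated grounded electric network $(I_\Delta,E_\Delta,C_\Delta)$ with parameter $\lambda$, defined in the context. Let $w:[0,\infty)\to[0,\infty)$ satisfy Condition (C): $w$ is non-negative and increasing on $[0,\infty)$, and for some $t_0>0$ it is twice differentiable on $[t_0,\infty)$ with $w''(t)<0$ for $t\in[t_0,\infty)$ and $\lim_{t\to\infty}w'(t)=0$. Then for $x\in I$ the following two assertions are equivalent: (1) $E^x(w(\tau_x))<\infty$. (2) $\displaystyle\int^\infty t\,|w''(t)|\,C_{x\leftrightarrow\Delta}(1/t)\,dt<\infty$.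
   Context: $\{X_t,t\ge0\}$ is an irreducible continuous-time Markov chain on a countable state space $I$ with transition function $P_{xy}(t)=P(X_t=y\mid X_0=x)$, which is honest ($\sum_{y\in I}P_{xy}(t)=1$) and standard ($\lim_{t\downarrow0}P_{xy}(t)=\delta_{xy}$). Its $Q$-matrix $q_{xy}=\lim_{t\downarrow 0}(P_{xy}(t)-\delta_{xy})/t$ is regular: $0\le q_{xy}<\infty$ for $x\ne y$, $0<q_x:=-q_{xx}<\infty$, $\sum_{y\in I}q_{xy}=0$. With $\eta_1<\eta_2<\cdots$ the successive jump times, the first flying time $\lim_n\eta_n$ is almost surely infinite (non-explosion). $E^x$ is expectation for the process started at $x$. The chain is reversible: there is a (nonzero, hence strictly positive) measure $\{m_x\}_{x\in I}$ with $m_xP_{xy}(t)=m_yP_{yx}(t)$ for all $x,y\in I$, $t\ge0$, equivalently $m_xq_{xy}=m_yq_{yx}$. The first returning time of $x$ is $\tau_x=\inf\{t>\eta_1: X_t=x\}$ (with $\inf\emptyset=\infty$ and $w(\infty):=\lim_{t\to\infty}w(t)\in[0,\infty]$). Network: for $x\ne y$ in $I$ put conductance $c_{xy}=m_xq_{xy}$ on the pair $xy$ (an edge when $q_{xy}>0$), and $c_x=\sum_{y\ne x}c_{xy}$ $(=m_xq_x)$. For $\lambda>0$ add a new vertex $\Delta\notin I$, joined to every $x\in I$ by an edge of conductance $c_{x\Delta}=\frac{\lambda}{q_x}c_x$ $(=\lambda m_x)$. This gives $(I_\Delta,E_\Delta,C_\Delta)$. The energy of $f:I\to\mathbb R$ (extended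 by $f(\Delta)=0$) is $$\mathbf e(f)=\frac12\sum_{x,y\in I,\,x\neq y}(f(x)-f(y))^2c_{xy}+\sum_{x\in I}f(x)^2\,\frac{\lambda}{q_x}c_x ,$$ and the effective conductance between $a\in I$ and $\Delta$ is, by Dirichlet's principle, $C_{a\leftrightarrow\Delta}(\lambda)=\inf\{\mathbf e(f): f:I\to\mathbb R,\ f(a)=1\}$. $\int^\infty f(t)\,dt<\infty$ means that $\int_k^\infty f(t)\,dt<\infty$ for some (equivalently every) sufficiently large lower limit $k\ge t_0$. *)

(* Defs.v *)
From HB Require Import structures.
From mathcomp Require Import all_boot all_order all_algebra.
From mathcomp Require Import all_classical all_reals all_analysis.

Set Implicit Arguments.
Unset Strict Implicit.
Unset Printing Implicit Defensive.

Import Order.TTheory GRing.Theory Num.Theory.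
Import numFieldNormedType.Exports.

Local Open Scope classical_set_scope.
Local Open Scope ring_scope.

Section TransitionFunction.
Context {R : realType} {I : countType}.

(* [P t x y] is P_xy(t); only the values at t >= 0 matter. *)
Record honest_standard_transition_function (P : R -> I -> I -> R) : Prop := {
  transition_ge0 : forall (t : R) x y, 0 <= t -> 0 <= P t x y;
  transition0 : forall x y, P 0 x y = (x == y)%:R;
  chapman_kolmogorov : forall (s t : R) x y, 0 <= s -> 0 <= t ->
    (P (s + t) x y)%:E = (\esum_(z in [set: I]) (P s x z * P t z y)%:E)%E;
  transition_honest : forall (t : R) x, 0 <= t ->
    (\esum_(y in [set: I]) (P t x y)%:E = 1)%E;
  transition_standard : forall x y,
    P t x y @[t --> 0^'+] --> ((x == y)%:R : R)
}.

Definition irreducible_transition (P : R -> I -> I -> R) : Prop :=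
  forall x y, exists2 t : R, 0 < t & 0 < P t x y.

Definition is_Qmatrix (P : R -> I -> I -> R) (q : I -> I -> R) : Prop :=
  forall x y, (P t x y - (x == y)%:R) / t @[t --> 0^'+] --> q x y.

(* [esum] is only meaningful for nonnegative families, so the condition
   \sum_y q_xy = 0 is written with its single negative term moved to the
   right-hand side. *)
Record regular_Qmatrix (q : I -> I -> R) : Prop := {
  Qmatrix_offdiag_ge0 : forall x y, x != y -> 0 <= q x y;
  Qmatrix_diag_lt0 : forall x, 0 < - q x x;
  Qmatrix_row_sum : forall x,
    (\esum_(y in [set y | y != x]) (q x y)%:E = (- q x x)%:E)%E
}.

Record reversible_wrt (P : R -> I -> I -> R) (m : I -> R) : Prop := {
  reversible_measure_ge0 : forall x, 0 <= m x;
  reversible_measure_neq0 : exists x, m x != 0;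
  detailed_balance : forall (t : R) x y, 0 <= t -> m x * P t x y = m y * P t y x
}.

End TransitionFunction.

Section Process.
Context {R : realType} {I : countType} {d : measure_display}
  {T : measurableType d}.

(* [Pr x] is the law of the process started at [x]. The paths are right
   continuous for the discrete topology of [I], which is what makes the jump
   times below meaningful. *)
Record markov_chain (P : R -> I -> I -> R) (Pr : I -> probability T R)
    (X : R -> T -> I) : Prop := {
  chain_measurable : forall (t : R) y, 0 <= t -> measurable (X t @^-1` [set y]);
  chain_right_continuous : forall om (t : R), 0 <= t ->
    \forall s \near t^'+, X s om = X t om;
  chain_start : forall x, Pr x (X 0 @^-1` [set x]) = 1%E;
  chain_markov : forall x n (t : nat -> R) (y : nat -> I),
    0 <= t 0%N -> {homo t : i j / (i < j)%N >-> i < j} ->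
    (Pr x (\bigcap_(i in `I_n.+2) (X (t i) @^-1` [set y i])) =
     Pr x (\bigcap_(i in `I_n.+1) (X (t i) @^-1` [set y i])) *
     (P (t n.+1 - t n) (y n) (y n.+1))%:E)%E
}.

(* If [jump_time X n om = +oo], then the next set is empty and
   [jump_time X n.+1 om = +oo]. *)
Fixpoint jump_time (X : R -> T -> I) (n : nat) (om : T) : \bar R :=
  if n is n'.+1 then
    let e := jump_time X n' om in
    ereal_inf [set t%:E | t in [set t : R | (e < t%:E)%E /\
                                            X t om <> X (fine e) om]]
  else 0%E.

Definition non_explosive (Pr : I -> probability T R) (X : R -> T -> I) : Prop :=
  forall x, {ae Pr x, forall om, jump_time X n om @[n --> \oo] --> +oo%E}.

Definition return_time (X : R -> T -> I) (x : I) (om : T) : \bar R :=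
  ereal_inf [set t%:E | t in [set t : R | (jump_time X 1 om < t%:E)%E /\
                                          X t om = x]].

End Process.

Section Weight.
Context {R : realType}.

(* As [t0] is an arbitrary large constant, the derivatives are only required
   in the interior of [t0, +oo[, which avoids one-sided derivatives at [t0]. *)
Record condition_C (w : R -> R) (t0 : R) : Prop := {
  weight_ge0 : forall t : R, 0 <= t -> 0 <= w t;
  weight_nondecreasing : forall s t : R, 0 <= s -> s <= t -> w s <= w t;
  weight_t0_gt0 : 0 < t0;
  weight_derivable : forall t, t0 < t -> derivable w t 1;
  weight_derivable2 : forall t, t0 < t -> derivable (w^`())%classic t 1;
  weight_derive2_lt0 : forall t, t0 < t -> (w^`(2))%classic t < 0;
  weight_derive_cvg0 : (w^`())%classic t @[t --> +oo] --> (0 : R)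
}.

(* The value at -oo is irrelevant: return times are nonnegative. *)
Definition extend_weight (w : R -> R) (u : \bar R) : \bar R :=
  match u with
  | r%:E => (w r)%:E
  | +oo%E => lim ((w t)%:E @[t --> +oo%R])
  | -oo%E => 0%E
  end.

End Weight.

Section Network.
Context {R : realType} {I : countType}.
Variables (q : I -> I -> R) (m : I -> R).

Definition conductance (x y : I) : R := m x * q x y.

Definition vertex_conductance (x : I) : \bar R :=
  (\esum_(y in [set y | y != x]) (conductance x y)%:E)%E.

Definition ground_conductance (lambda : R) (x : I) : \bar R :=
  ((lambda / - q x x)%:E * vertex_conductance x)%E.

(* Energy of the extension of [f] by 0 at the added vertex. *)
Definition energy (lambda : R) (f : I -> R) : \bar R :=
  ((2^-1)%:E * (\esum_(xy in [set xy : I * I | xy.1 != xy.2])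
      ((f xy.1 - f xy.2) ^+ 2 * conductance xy.1 xy.2)%:E) +
   \esum_(x in [set: I]) ((f x ^+ 2)%:E * ground_conductance lambda x))%E.

Definition effective_conductance (lambda : R) (a : I) : \bar R :=
  ereal_inf [set energy lambda f | f in [set f : I -> R | f a = 1]].

End Network.

(* Main.v *)
(** Put [C(lam) = effective_conductance q m lam x], [q_x = - q x x] and
    [phi(lam) = E^x exp(- lam tau_x)]. The key identity is
      [C(lam) = m_x * (lam + q_x) * (1 - phi(lam))].
    On the network side, the functions [H_n] ([jump_green]) solve
    [(lam + q_y) H_(n+1)(y) = \sum_(z <> y) H_n(z) q_zy]; their partial sums,
    transposed by reversibility, are almost harmonic test functions in
    Dirichlet's principle and give [C(lam) = m_x / \sum_n H_n(x)] once the mass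
    carried by [H_n] tends to 0. On the probability side, [\sum_n H_n(x)] is the
    [lam]-resolvent at [(x, x)]. It is reached through the skeletons
    [X (k * 2^-N)], which are discrete-time chains: their generating functions
    obey an exact recursion in the number of observed changes of state and an
    exact renewal equation at the first return, non-explosion prevents any loss
    of mass, and letting [N] tend to infinity gives
    [(lam + q_x) * (1 - phi(lam)) * \sum_n H_n(x) = 1].
    Since [t * (1 - exp(- s / t))] lies between [min(s, t) / 2] and [min(s, t)],
    [t * C(1 / t)] is comparable to [E^x min(tau_x, t)], and by Tonelli the
    integral of [|w''(t)| * t * C(1 / t)] over [[k, +oo[] is comparable to the
    expectation of [\int_k^oo |w''(t)| min(s, t) dt] at [s = tau_x], which differs
    from [w(s)] by a bounded amount. *)

Require Import Defs.
From mathcomp Require Import all_boot all_order all_algebra finmap.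
From mathcomp Require Import all_classical all_reals all_analysis.
From mathcomp Require Import measurable_realfun ring lra.

Import Order.TTheory GRing.Theory Num.Theory.
Import numFieldNormedType.Exports.

Local Open Scope classical_set_scope.
Local Open Scope ring_scope.
Set Implicit Arguments.
Unset Strict Implicit.
Unset Printing Implicit Defensive.

(** * Unconditional sums in the extended reals *)

(** The Markov property is available at deterministic times only, and no description of the paths by
    holding times and an embedded jump chain is assumed. The strong Markov property at the return
    time and the link between [q] and the jumps are therefore derived on grids, where return times
    take countably many values. The price is that infinite sums over states must pass to the limit
    of vanishing mesh. Only the Fatou direction is direct: each [jump_green n z] is at most the
    limiting discounted time. Equality is forced by accounting: both sides have total mass 1 / lam,
    on the side of [jump_green] because [jump_mass] tends to 0, and this is where non-explosion
    enters. In the network, energies and bilinear sums may be infinite, so identities are stated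
    without subtraction; stopping the Green function after n jumps yields bounded test functions
    with finite pairings, after which terms may be cancelled. In the weight part, w'' exists but
    need not be continuous, so the fundamental theorem of calculus is proved for nonnegative
    derivatives. *)

Section ExtendedSums.
Context {R : realType}.
Local Open Scope ereal_scope.

Let ge0_esumZl_EFin (J : choiceType) (D : set J) (a : J -> \bar R) (c : R) :
  (0 <= c)%R -> (forall j, D j -> 0 <= a j) ->
  \esum_(j in D) (c%:E * a j) = c%:E * \esum_(j in D) a j.
Proof.
move=> c0 a0; have := c0; rewrite le_eqVlt => /orP[/eqP <-|cgt0].
  by rewrite mul0e esum1// => j _; rewrite mul0e.
have leZ (b : J -> \bar R) (e : R) : (0 < e)%R -> (forall j, D j -> 0 <= b j) ->
    \esum_(j in D) (e%:E * b j) <= e%:E * \esum_(j in D) b j.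
  move=> e0 b0; apply: ge_ereal_sup => /= _ [X [finX XD]] <-.
  rewrite fsbig_finite//= big_seq -ge0_sume_distrr => [|j]; last first.
    by rewrite in_fset_set// inE => /XD/b0.
  rewrite lee_pmul2l// -big_seq -fsbig_finite//=.
  by apply: ereal_sup_ubound; exists X.
apply/eqP; rewrite eq_le leZ//=.
(* The reverse inequality is the same bound for the family [c * a j] and the factor [c^-1]. *)
rewrite -lee_pdivlMl// (le_trans _ (leZ (fun j => c%:E * a j) c^-1%R _ _))//.
- by apply: le_esum => j Dj; rewrite muleA -EFinM mulVf ?gt_eqF// mul1e.
- by rewrite invr_gt0.
- by move=> j Dj; rewrite mule_ge0// ?a0// lee_fin.
Qed.

Lemma le_esum1 (J : choiceType) (D : set J) (a : J -> \bar R) (j : J) :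
  (forall j, D j -> 0 <= a j) -> D j -> a j <= \esum_(i in D) a i.
Proof.
move=> a0 Dj; rewrite -[leLHS](esum_set1 (a0 _ Dj)) (esum_mkcond D) esum_mkcond.
apply: le_esum => i _; case: ifPn => [/set_mem /= ->|_]; first by rewrite mem_set.
by case: ifPn => // /set_mem/a0.
Qed.

(** For [c = +oo] either some term is positive and both sides are [+oo], or all terms vanish and the
    convention [+oo * 0 = 0] gives 0 on both sides. *)
Lemma ge0_esumZl (J : choiceType) (D : set J) (a : J -> \bar R) (c : \bar R) :
  0 <= c -> (forall j, D j -> 0 <= a j) ->
  \esum_(j in D) (c * a j) = c * \esum_(j in D) a j.
Proof.
case: c => [c c0 a0|_ a0|//]; first exact: ge0_esumZl_EFin.
have [[j [Dj aj]]|na] := pselect (exists j, D j /\ 0 < a j).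
  rewrite [RHS]gt0_mulye ?(lt_le_trans aj)// ?le_esum1//.
  apply/eqP; rewrite -leye_eq (le_trans _ (le_esum1 _ Dj))// ?gt0_mulye// => i Di.
  by rewrite mule_ge0// a0.
have {}a0 j : D j -> a j = 0.
  move=> Dj; apply/eqP; rewrite eq_le a0// andbT leNgt; apply/negP => aj.
  by apply: na; exists j.
by rewrite !esum1 ?mule0// => j /a0 ->; rewrite mule0.
Qed.

Lemma ge0_esumZr (J : choiceType) (D : set J) (a : J -> \bar R) (c : \bar R) :
  0 <= c -> (forall j, D j -> 0 <= a j) ->
  \esum_(j in D) (a j * c) = (\esum_(j in D) a j) * c.
Proof.
move=> c0 a0; rewrite muleC -ge0_esumZl//.
by apply: eq_esum => j _; rewrite muleC.
Qed.

Lemma esum_delta (J : choiceType) (a : J -> \bar R) (i : J) :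
  (forall j, j != i -> a j = 0) -> 0 <= a i ->
  \esum_(j in [set: J]) a j = a i.
Proof.
move=> a0 ai; rewrite -[RHS](@esum_set1 _ _ i a)// [RHS]esum_mkcond.
apply: eq_esum => j _; case: ifPn => //.
by rewrite notin_setE /= => /eqP/a0.
Qed.

Lemma esum_splitD1 (J : choiceType) (a : J -> \bar R) (i : J) :
  (forall j, 0 <= a j) ->
  \esum_(j in [set: J]) a j = a i + \esum_(j in [set j | j != i]) a j.
Proof.
move=> a0; rewrite (esumID [set i]) ?setTI// esum_set1//.
by congr (_ + _); congr esum; apply/seteqP; split => j /= /eqP.
Qed.

(** Tonelli with a constraint linking the indices: [r] is [z != y] in the network sums and [j <= k]
    in the renewal convolution. *)
Lemma esum_exchange (J K : choiceType) (a : J -> K -> \bar R)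
    (r : J -> K -> bool) : (forall j k, 0 <= a j k) ->
  \esum_(j in [set: J]) \esum_(k in [set k | r j k]) a j k =
  \esum_(k in [set: K]) \esum_(j in [set j | r j k]) a j k.
Proof.
move=> a0; rewrite !esum_esum//.
rewrite (reindex_esum ([set: K] `*`` (fun k => [set j | r j k])) _
  (fun x => (x.2, x.1)))//; split=> //=.
  by move=> [i1 i2] [j1 j2] /= _ _ [] -> ->.
by move=> [j k] [_ /= rjk]; exists (k, j).
Qed.

Lemma esum_exchange_in (J K : choiceType) (A : set J) (B : set K)
    (a : J -> K -> \bar R) : (forall j k, 0 <= a j k) ->
  \esum_(j in A) \esum_(k in B) a j k = \esum_(k in B) \esum_(j in A) a j k.
Proof.
move=> a0; rewrite !esum_esum//.
rewrite (reindex_esum (B `*`` (fun=> A)) _ (fun x => (x.2, x.1)))//; split=> //=.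
- by move=> [k j] [].
- by move=> [i1 i2] [j1 j2] /= _ _ [] -> ->.
- by move=> [j k] [/= Aj Bk]; exists (k, j).
Qed.

Lemma esum_offdiag (J : choiceType) (a : J -> J -> \bar R) :
  (forall j k, 0 <= a j k) ->
  \esum_(jk in [set jk : J * J | jk.1 != jk.2]) a jk.1 jk.2 =
  \esum_(j in [set: J]) \esum_(k in [set k | k != j]) a j k.
Proof.
move=> a0; rewrite esum_esum//; congr esum.
by apply/seteqP; split => -[j k] /=; [move=> ?; split=> //|move=> []];
  rewrite eq_sym.
Qed.

Lemma esum_offdiagC (J : choiceType) (a : J -> J -> \bar R) :
  (forall j k, 0 <= a j k) ->
  \esum_(jk in [set jk : J * J | jk.1 != jk.2]) a jk.1 jk.2 =
  \esum_(jk in [set jk : J * J | jk.1 != jk.2]) a jk.2 jk.1.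
Proof.
move=> a0; rewrite esum_offdiag// (@esum_offdiag _ (fun j k => a k j))//.
rewrite (@esum_exchange _ _ a (fun j k => k != j))//.
by apply: eq_esum => j _; congr esum; apply/seteqP; split => k /=; rewrite eq_sym.
Qed.

Lemma lee_esum_lim (J : choiceType) (D : set J) (a : J -> \bar R) (c : \bar R) :
  (forall X : {fset J}, [set` X] `<=` D -> \sum_(j <- X) a j <= c) ->
  \esum_(j in D) a j <= c.
Proof.
move=> h; apply: ge_ereal_sup => /= _ [X [finX XD]] <-.
rewrite fsbig_finite//=; apply: h => j /=.
by rewrite in_fset_set// inE => /XD.
Qed.

Lemma lee_sum_esum (J : choiceType) (D : set J) (a : J -> \bar R) (X : {fset J}) :
  [set` X] `<=` D -> \sum_(j <- X) a j <= \esum_(j in D) a j.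
Proof.
move=> XD; apply: ereal_sup_ubound; exists [set` X]; first by split.
by rewrite fsbig_finite//= set_fsetK.
Qed.

Lemma esumD_EFin (J : choiceType) (D : set J) (a b : J -> R) :
  (forall j, D j -> 0 <= a j)%R -> (forall j, D j -> 0 <= b j)%R ->
  \esum_(j in D) (a j)%:E + \esum_(j in D) (b j)%:E =
  \esum_(j in D) (a j + b j)%:E.
Proof.
by move=> a0 b0; rewrite -esumD//; move=> j Dj; rewrite lee_fin ?a0 ?b0.
Qed.

Lemma esumZl_EFin (J : choiceType) (D : set J) (a : J -> R) (c : R) :
  (0 <= c)%R -> (forall j, D j -> 0 <= a j)%R ->
  c%:E * (\esum_(j in D) (a j)%:E) = \esum_(j in D) (c * a j)%:E.
Proof. by move=> c0 a0; rewrite -ge0_esumZl// => j /a0; rewrite lee_fin. Qed.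

Lemma esum_nat_recl (a : nat -> \bar R) : (forall n, 0 <= a n) ->
  \esum_(n in [set: nat]) a n = a 0%N + \esum_(n in [set: nat]) a n.+1.
Proof.
move=> a0; rewrite (esum_splitD1 0%N)//; congr (_ + _).
rewrite (reindex_esum [set: nat] _ succn)//; split => //=.
- by move=> m n _ _ [].
- by move=> [//|n] _; exists n.
Qed.

Lemma esum_geometric (r : R) : (0 < r < 1)%R ->
  \esum_(k in [set: nat]) (r ^+ k)%:E = ((1 - r)^-1)%:E :> \bar R.
Proof.
move=> /andP[r0 r1]; have nr1 : (`|r| < 1)%R by rewrite gtr0_norm.
rewrite -nneseries_esumT => [|k]; last by rewrite lee_fin exprn_ge0// ltW.
apply/cvg_lim => //.
rewrite (_ : (fun _ => _) = EFin \o series (geometric 1 r)); last first.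
  apply/funext => k; rewrite /series /= sumEFin; congr EFin.
  by apply: eq_bigr => i _; rewrite mul1r.
apply: cvg_EFin; first exact: nearW.
by have := @cvg_geometric_series _ 1 r nr1; rewrite mul1r; apply: cvg_trans.
Qed.

End ExtendedSums.

(** * Dirichlet's principle in the grounded network *)

Section GroundedNetwork.
Context {R : realType} {I : countType}.
Variables (q : I -> I -> R) (m : I -> R) (x : I) (lam : R).
Hypothesis hreg : regular_Qmatrix q.
Hypothesis m_gt0 : forall y, 0 < m y.
Hypothesis mq_sym : forall y z, m y * q y z = m z * q z y.
Hypothesis lam_gt0 : 0 < lam.
Local Open Scope ereal_scope.

(* [jump_green n y] is the [lam]-discounted expected time spent at [y] between
   the n-th and the (n+1)-st jump of the chain started at [x]. *)
Fixpoint jump_green (n : nat) (y : I) : \bar R :=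
  if n is n'.+1 then
    ((lam - q y y)^-1)%:E *
      \esum_(z in [set z | z != y]) (jump_green n' z * (q z y)%:E)
  else ((x == y)%:R / (lam - q y y))%:E.

(** This is E^x exp(- lam eta_n), with eta_n the n-th jump time: a stay at y, once begun, has
    discounted mean length 1 / (lam + q_y), and the factor undoes it. *)
Definition jump_mass (n : nat) : \bar R :=
  \esum_(y in [set: I]) ((lam - q y y)%:E * jump_green n y).

Definition green_sum (n : nat) (y : I) : \bar R := \sum_(i < n) jump_green i y.

Let k_gt0 y : (0 < lam - q y y)%R.
Proof. by rewrite addr_gt0// Qmatrix_diag_lt0. Qed.

Let k_ge0 y : (0 <= lam - q y y)%R. Proof. exact: ltW. Qed.

Let q_ge0 y z : y != z -> (0 <= q y z)%R. Proof. exact: Qmatrix_offdiag_ge0. Qed.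

Let c_ge0 y z : y != z -> (0 <= m y * q y z)%R.
Proof. by move=> yz; rewrite mulr_ge0// ?q_ge0// ltW. Qed.

Lemma jump_green_ge0 n y : 0 <= jump_green n y.
Proof.
elim: n y => [|n IH] y /=; first by rewrite lee_fin divr_ge0.
rewrite mule_ge0//; first by rewrite lee_fin invr_ge0.
apply: esum_ge0 => z /= zy; rewrite mule_ge0//.
by rewrite lee_fin q_ge0.
Qed.

Lemma jump_greenS n y : (lam - q y y)%:E * jump_green n.+1 y =
  \esum_(z in [set z | z != y]) (jump_green n z * (q z y)%:E).
Proof. by rewrite /= muleA -EFinM divff ?gt_eqF// mul1e. Qed.

Lemma jump_mass_ge0 n : 0 <= jump_mass n.
Proof.
by apply: esum_ge0 => y _; rewrite mule_ge0 ?jump_green_ge0// lee_fin.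
Qed.

Lemma jump_mass0 : jump_mass 0 = 1.
Proof.
rewrite /jump_mass (@esum_delta _ _ _ x)/=.
- by rewrite eqxx -EFinM mul1r divff ?gt_eqF.
- by move=> y yx; rewrite eq_sym (negbTE yx) mul0r mule0.
- by rewrite eqxx -EFinM mul1r divff ?gt_eqF.
Qed.

Let esum_row y : \esum_(z in [set z | z != y]) (q y z)%:E = (- q y y)%:E.
Proof. exact: Qmatrix_row_sum. Qed.

(** Split lam + q_y. The part q_y is redistributed over the other states by the row-sum identity and
    becomes the next mass; the part lam is lost by killing. *)
Lemma jump_mass_killed n :
  jump_mass n = jump_mass n.+1 + lam%:E * \esum_(y in [set: I]) jump_green n y.
Proof.
have -> : jump_mass n.+1 =
    \esum_(y in [set: I]) ((- q y y)%:E * jump_green n y).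
  rewrite /jump_mass; under eq_esum do rewrite jump_greenS.
  (* [esum_exchange] asks for nonnegativity at all pairs, but [q y y < 0]; the diagonal, which lies
     outside the index set, is therefore replaced by 0. *)
  transitivity (\esum_(y in [set: I]) \esum_(z in [set z | z != y])
      (if z == y then 0 else jump_green n z * (q z y)%:E)).
    by apply: eq_esum => y _; apply: eq_esum => z /= /negbTE ->.
  rewrite (@esum_exchange _ _ _ (fun y z => if z == y then 0 else
      jump_green n z * (q z y)%:E) (fun y z => z != y)); last first.
    move=> y z; case: ifPn => // zy; rewrite mule_ge0 ?jump_green_ge0//.
    by rewrite lee_fin q_ge0.
  apply: eq_esum => z _; rewrite muleC -esum_row.
  rewrite -ge0_esumZl ?jump_green_ge0//; last first.
    by move=> z' zz'; rewrite lee_fin q_ge0// eq_sym.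
  have -> : [set j | z != j] = [set j | j != z].
    by apply/seteqP; split => j /=; rewrite eq_sym.
  by apply: eq_esum => y /= yz; rewrite eq_sym (negbTE yz).
rewrite -ge0_esumZl ?lee_fin ?ltW//; last by move=> *; exact: jump_green_ge0.
rewrite -esumD; last 2 first.
- by move=> y _; rewrite mule_ge0 ?jump_green_ge0// lee_fin ltW ?Qmatrix_diag_lt0.
- by move=> y _; rewrite mule_ge0 ?jump_green_ge0// lee_fin ltW.
apply: eq_esum => y _; rewrite -ge0_muleDl ?lee_fin ?ltW ?Qmatrix_diag_lt0//.
by rewrite -EFinD addrC.
Qed.

Lemma green_sum_ge0 n y : 0 <= green_sum n y.
Proof. by apply: sume_ge0 => i _; exact: jump_green_ge0. Qed.

Lemma green_sumS n y : green_sum n.+1 y = green_sum n y + jump_green n y.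
Proof. by rewrite /green_sum big_ord_recr. Qed.

Lemma jump_mass_le1 n : jump_mass n <= 1.
Proof.
elim: n => [|n]; first by rewrite jump_mass0.
apply: le_trans; rewrite (jump_mass_killed n) leeDl// mule_ge0//.
  by rewrite lee_fin ltW.
by apply: esum_ge0 => y _; exact: jump_green_ge0.
Qed.

Lemma jump_green_le n y : jump_green n y <= ((lam - q y y)^-1)%:E.
Proof.
rewrite -[leRHS]mule1 -lee_pdivrMl ?invr_gt0// invrK.
apply: le_trans (jump_mass_le1 n).
rewrite /jump_mass (@le_esum1 _ _ _ (fun y => (lam - q y y)%:E * jump_green n y))//.
by move=> z _; rewrite mule_ge0 ?jump_green_ge0// lee_fin.
Qed.

Lemma jump_green_fin_num n y : jump_green n y \is a fin_num.
Proof.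
by rewrite ge0_fin_numE ?jump_green_ge0// (le_lt_trans (jump_green_le n y)) ?ltry.
Qed.

Lemma green_sum_fin_num n y : green_sum n y \is a fin_num.
Proof. by apply/sum_fin_numP => i _ _; exact: jump_green_fin_num. Qed.

(** Telescoped [jump_greenS]: the partial sum solves the resolvent equation with source at [x], up
    to the single defect term [jump_green n z]. *)
Lemma green_sum_balance n z :
  (lam - q z z)%:E * (green_sum n z + jump_green n z) =
  (x == z)%:R%:E + \esum_(y in [set y | y != z]) (green_sum n y * (q y z)%:E).
Proof.
rewrite -green_sumS.
elim: n => [|n IH].
  rewrite /green_sum big_ord_recl big_ord0 adde0/= esum1 ?adde0 => [|y _].
    by rewrite -EFinM mulrC divfK ?gt_eqF.
  by rewrite big_ord0 mul0e.
rewrite green_sumS ge0_muleDr ?green_sum_ge0 ?jump_green_ge0//.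
rewrite IH jump_greenS -addeA -esumD.
- congr (_ + _); apply: eq_esum => y yz.
  by rewrite green_sumS ge0_muleDl ?green_sum_ge0 ?jump_green_ge0.
- by move=> y yz; rewrite mule_ge0 ?green_sum_ge0// lee_fin q_ge0.
- by move=> y yz; rewrite mule_ge0 ?jump_green_ge0// lee_fin q_ge0.
Qed.

(* Column version of [green_sum], by reversibility; the test function of
   Dirichlet's principle. *)
Definition green_test n y : R := m x / m y * fine (green_sum n y).

Lemma green_test_ge0 n y : (0 <= green_test n y)%R.
Proof. by rewrite /green_test mulr_ge0 ?fine_ge0 ?green_sum_ge0// divr_ge0// ltW. Qed.

Lemma green_testE n y : (m y * green_test n y)%:E = (m x)%:E * green_sum n y.
Proof.
rewrite -[green_sum n y]fineK ?green_sum_fin_num// -EFinM; congr EFin.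
by rewrite /green_test mulrA mulrCA divff ?mulr1 ?gt_eqF.
Qed.

(** Weak form of [green_sum_balance], tested against [f] and weighted by [m x]. With e(f, g) the
    bilinear energy form it reads e(f, g) = m_x f(x) - m_x (defect), but all terms stay on the side
    where they are nonnegative, so that it also holds for infinite sums. *)
Lemma green_test_pairing n (f : I -> R) : (forall y, 0 <= f y)%R ->
  (\esum_(y in [set: I]) (m y * (lam - q y y) * (f y * green_test n y))%:E +
   (m x)%:E * (\esum_(y in [set: I]) ((f y * (lam - q y y))%:E * jump_green n y)) =
   (m x * f x)%:E +
   \esum_(yz in [set yz : (I * I)%type | yz.1 != yz.2])
     (m yz.1 * q yz.1 yz.2 * (green_test n yz.1 * f yz.2))%:E)%E.
Proof.
move=> f0.
have fk0 y : 0 <= (f y * (lam - q y y))%:E by rewrite lee_fin mulr_ge0.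
have mx0 : 0 <= (m x)%:E by rewrite lee_fin ltW.
pose b y z : \bar R := if y == z then 0 else
  (m x)%:E * ((f z)%:E * (green_sum n y * (q y z)%:E)).
have b0 y z : 0 <= b y z.
  rewrite /b; case: eqVneq => // yz.
  by rewrite !mule_ge0 ?lee_fin ?f0 ?q_ge0 ?green_sum_ge0.
have -> : \esum_(yz in [set yz : (I * I)%type | yz.1 != yz.2])
     (m yz.1 * q yz.1 yz.2 * (green_test n yz.1 * f yz.2))%:E =
   \esum_(yz in [set yz : (I * I)%type | yz.1 != yz.2]) b yz.1 yz.2.
  apply: eq_esum => -[y z] /= yz; rewrite /b (negbTE yz).
  transitivity ((m y * green_test n y)%:E * (q y z * f z)%:E).
    by rewrite -EFinM; congr EFin; ring.
  by rewrite green_testE -muleA; congr (_ * _); rewrite EFinM muleA muleC.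
rewrite esum_offdiagC// (@esum_offdiag _ _ (fun y z => b z y))//.
have -> : \esum_(y in [set: I]) \esum_(z in [set z | z != y]) b z y =
    (m x)%:E * \esum_(y in [set: I]) ((f y)%:E *
      \esum_(z in [set z | z != y]) (green_sum n z * (q z y)%:E)).
  rewrite -ge0_esumZl//; last first.
    move=> y _; rewrite mule_ge0 ?lee_fin ?f0// esum_ge0// => z zy.
    by rewrite mule_ge0 ?green_sum_ge0// lee_fin q_ge0.
  apply: eq_esum => y _; rewrite muleA -ge0_esumZl.
  - by apply: eq_esum => z /= zy; rewrite /b (negbTE zy) muleA.
  - by rewrite mule_ge0// lee_fin f0.
  - by move=> z zy; rewrite mule_ge0 ?green_sum_ge0// lee_fin q_ge0.
have -> : (m x * f x)%:E =
    (m x)%:E * \esum_(y in [set: I]) ((f y)%:E * (x == y)%:R%:E).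
  rewrite (@esum_delta _ _ _ x) ?eqxx ?mule1 ?lee_fin//.
  by move=> y; rewrite eq_sym => /negbTE ->; rewrite mule0.
have -> : \esum_(y in [set: I]) (m y * (lam - q y y) * (f y * green_test n y))%:E =
    (m x)%:E * \esum_(y in [set: I]) ((f y * (lam - q y y))%:E * green_sum n y).
  rewrite -ge0_esumZl//; last by move=> y _; rewrite mule_ge0// green_sum_ge0.
  apply: eq_esum => y _; rewrite muleCA -green_testE -EFinM; congr EFin; ring.
have sq0 y : 0 <= \esum_(z in [set z | z != y]) (green_sum n z * (q z y)%:E).
  apply: esum_ge0 => z zy.
  by rewrite mule_ge0 ?green_sum_ge0// lee_fin q_ge0.
have fB0 y : 0 <= (f y)%:E *
    \esum_(z in [set z | z != y]) (green_sum n z * (q z y)%:E).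
  by rewrite mule_ge0 ?lee_fin.
have fG0 y : 0 <= (f y * (lam - q y y))%:E * green_sum n y.
  by rewrite mule_ge0// green_sum_ge0.
have fH0 y : 0 <= (f y * (lam - q y y))%:E * jump_green n y.
  by rewrite mule_ge0// jump_green_ge0.
have fD0 y : 0 <= (f y)%:E * (x == y)%:R%:E by rewrite mule_ge0 ?lee_fin.
rewrite -!ge0_muleDr ?esum_ge0//; congr (_ * _); rewrite -!esumD//.
apply: eq_esum => y _.
rewrite -!ge0_muleDr ?green_sum_ge0 ?jump_green_ge0 ?lee_fin//.
by rewrite EFinM -muleA green_sum_balance.
Qed.

(** Induction along the recursion: the bound is preserved because reversibility turns the sum of
    [m z * q z y] over z into [m y * q_y], which is at most [m y * (lam + q_y)]. It makes the test
    functions bounded. *)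
Lemma jump_green_reversible_le n y :
  (m x)%:E * jump_green n y <= (m y / (lam - q x x))%:E.
Proof.
elim: n y => [|n IH] y.
  rewrite /= -EFinM lee_fin; case: eqVneq => [<-|_]; first by rewrite mul1r.
  by rewrite mul0r mulr0 divr_ge0// ltW.
rewrite -(@lee_pmul2l _ (lam - q y y)%:E) ?lte_fin// muleCA jump_greenS.
rewrite -ge0_esumZl; last 2 first.
- by rewrite lee_fin ltW.
- by move=> z zy; rewrite mule_ge0 ?jump_green_ge0// lee_fin q_ge0.
apply: (@le_trans _ _ (\esum_(z in [set z | z != y])
    ((m y / (lam - q x x))%:E * (q y z)%:E))).
  apply: le_esum => z zy.
  have -> : (m y / (lam - q x x))%:E * (q y z)%:E =
      (m z / (lam - q x x))%:E * (q z y)%:E.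
    by rewrite -!EFinM mulrAC mq_sym mulrAC.
  by rewrite muleA lee_wpmul2r// lee_fin q_ge0.
rewrite ge0_esumZl; last 2 first.
- by rewrite lee_fin divr_ge0// ltW.
- by move=> z zy; rewrite lee_fin q_ge0// eq_sym.
rewrite esum_row -!EFinM lee_fin mulrC; apply: ler_wpM2r.
  by rewrite divr_ge0// ltW.
by rewrite lerDr ltW.
Qed.

Lemma green_test_le n y : (green_test n y <= n%:R / (lam - q x x))%R.
Proof.
rewrite -(ler_pM2l (m_gt0 y)) -lee_fin green_testE /green_sum.
rewrite ge0_sume_distrr => [|i _]; last exact: jump_green_ge0.
apply: (@le_trans _ _ (\sum_(i < n) (m y / (lam - q x x))%:E)).
  by apply: lee_sum => i _; exact: jump_green_reversible_le.
rewrite sumEFin lee_fin sumr_const card_ord -mulr_natr.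
by rewrite le_eqVlt; apply/orP; left; apply/eqP; ring.
Qed.

(** Gives the finiteness that allows cancelling the sums of [green_test_pairing]: each of the n
    jumps contributes a mass at most 1. *)
Lemma green_test_pairing_le n (f : I -> R) (c : R) :
  (forall y, 0 <= f y <= c)%R ->
  \esum_(y in [set: I]) (m y * (lam - q y y) * (f y * green_test n y))%:E <=
  (c * m x * n%:R)%:E.
Proof.
move=> fc.
have c0 : (0 <= c)%R by have /andP[/le_trans h /h] := fc x.
apply: (@le_trans _ _ (\esum_(y in [set: I])
    \sum_(i < n) ((c * m x)%:E * ((lam - q y y)%:E * jump_green i y)))).
  apply: le_esum => y _; rewrite -ge0_sume_distrr; last first.
    by move=> i _; rewrite mule_ge0 ?jump_green_ge0// lee_fin.
  rewrite -ge0_sume_distrr => [|i _]; last exact: jump_green_ge0.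
  rewrite -/(green_sum n y) (EFinM c) -muleA [X in _ <= _ * X]muleCA -green_testE.
  rewrite -!EFinM lee_fin; have /andP[f0 f1] := fc y.
  have -> : (m y * (lam - q y y) * (f y * green_test n y) =
             f y * ((lam - q y y) * (m y * green_test n y)))%R by ring.
  by rewrite ler_wpM2r// mulr_ge0// mulr_ge0 ?green_test_ge0// ltW.
rewrite esum_sum; last first.
  move=> y i _ _; rewrite !mule_ge0 ?jump_green_ge0// lee_fin//.
  by rewrite mulr_ge0// ltW.
apply: (@le_trans _ _ (\sum_(i < n) (c * m x)%:E)).
  apply: lee_sum => i _; rewrite ge0_esumZl; last 2 first.
  - by rewrite lee_fin mulr_ge0// ltW.
  - by move=> y _; rewrite mule_ge0 ?jump_green_ge0// lee_fin.
  by rewrite -[leRHS]mule1 lee_wpmul2l ?jump_mass_le1// lee_fin mulr_ge0// ltW.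
by rewrite sumEFin sumr_const card_ord mulr_natr.
Qed.

Local Notation offdiag := [set yz : (I * I)%type | yz.1 != yz.2].

Let esum_offdiag_degree (u : I -> R) : (forall y, 0 <= u y)%R ->
  \esum_(yz in offdiag) (m yz.1 * q yz.1 yz.2 * u yz.1)%:E =
  \esum_(y in [set: I]) (m y * - q y y * u y)%:E.
Proof.
move=> u0; pose a y z : \bar R := if y == z then 0 else (m y * q y z * u y)%:E.
have a0 y z : 0 <= a y z.
  by rewrite /a; case: eqVneq => // yz; rewrite lee_fin mulr_ge0// c_ge0.
transitivity (\esum_(yz in offdiag) a yz.1 yz.2).
  by apply: eq_esum => -[y z] /= yz; rewrite /a (negbTE yz).
rewrite esum_offdiag//; apply: eq_esum => y _.
transitivity (\esum_(z in [set z | z != y]) ((m y * u y)%:E * (q y z)%:E)).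
  apply: eq_esum => z /= zy.
  by rewrite /a eq_sym (negbTE zy) -EFinM; congr EFin; ring.
rewrite ge0_esumZl; last 2 first.
- by rewrite lee_fin mulr_ge0// ltW.
- by move=> z zy; rewrite lee_fin q_ge0// eq_sym.
by rewrite esum_row -EFinM; congr EFin; ring.
Qed.

Let esum_offdiag_swap (u : I -> I -> R) : (forall y z, 0 <= u y z)%R ->
  \esum_(yz in offdiag) (m yz.1 * q yz.1 yz.2 * u yz.1 yz.2)%:E =
  \esum_(yz in offdiag) (m yz.1 * q yz.1 yz.2 * u yz.2 yz.1)%:E.
Proof.
move=> u0; pose a y z : \bar R := if y == z then 0 else (m y * q y z * u y z)%:E.
have a0 y z : 0 <= a y z.
  by rewrite /a; case: eqVneq => // yz; rewrite lee_fin mulr_ge0// c_ge0.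
transitivity (\esum_(yz in offdiag) a yz.1 yz.2).
  by apply: eq_esum => -[y z] /= yz; rewrite /a (negbTE yz).
rewrite esum_offdiagC//; apply: eq_esum => -[y z] /= yz.
by rewrite /a eq_sym (negbTE yz) mq_sym.
Qed.

Let esum_offdiag_sym (u : I -> I -> R) : (forall y z, 0 <= u y z)%R ->
  \esum_(yz in offdiag) (m yz.1 * q yz.1 yz.2 * u yz.1 yz.2)%:E =
  \esum_(yz in offdiag)
    (2^-1 * (m yz.1 * q yz.1 yz.2 * (u yz.1 yz.2 + u yz.2 yz.1)))%:E.
Proof.
move=> u0; have cu0 (yz : (I * I)%type) : yz.1 != yz.2 ->
    (0 <= m yz.1 * q yz.1 yz.2 * u yz.1 yz.2)%R.
  by move=> yz12; rewrite mulr_ge0// c_ge0.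
have cu0' (yz : (I * I)%type) : yz.1 != yz.2 ->
    (0 <= m yz.1 * q yz.1 yz.2 * u yz.2 yz.1)%R.
  by move=> yz12; rewrite mulr_ge0// c_ge0.
transitivity (\esum_(yz in offdiag)
     (2^-1 * (m yz.1 * q yz.1 yz.2 * u yz.1 yz.2))%:E +
   \esum_(yz in offdiag) (2^-1 * (m yz.1 * q yz.1 yz.2 * u yz.2 yz.1))%:E).
  rewrite -!esumZl_EFin//; rewrite -esum_offdiag_swap// esumZl_EFin//.
  rewrite esumD_EFin; last 2 first.
  - by move=> yz /cu0 ?; rewrite mulr_ge0.
  - by move=> yz /cu0 ?; rewrite mulr_ge0.
  by apply: eq_esum => yz _; congr EFin; lra.
rewrite esumD_EFin; last 2 first.
- by move=> yz /cu0 ?; rewrite mulr_ge0.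
- by move=> yz /cu0' ?; rewrite mulr_ge0.
by apply: eq_esum => yz _; congr EFin; lra.
Qed.

(** Brings a sum over vertices to the shape of [energyE], pairs plus ground edges, so that quadratic
    forms can be compared term by term. *)
Let esum_degree_split (u : I -> R) : (forall y, 0 <= u y)%R ->
  \esum_(y in [set: I]) (m y * (lam - q y y) * u y)%:E =
  \esum_(yz in offdiag)
     (2^-1 * (m yz.1 * q yz.1 yz.2 * (u yz.1 + u yz.2)))%:E +
  \esum_(y in [set: I]) (lam * m y * u y)%:E.
Proof.
move=> u0; rewrite -(@esum_offdiag_sym (fun y _ => u y))// esum_offdiag_degree//.
rewrite esumD_EFin; last 2 first.
- by move=> y _; rewrite !mulr_ge0// ltW// Qmatrix_diag_lt0.
- by move=> y _; rewrite !mulr_ge0// ltW.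
by apply: eq_esum => y _; congr EFin; ring.
Qed.

Lemma energyE (f : I -> R) : energy q m lam f =
  \esum_(yz in offdiag)
     (2^-1 * (m yz.1 * q yz.1 yz.2 * (f yz.1 - f yz.2) ^+ 2))%:E +
  \esum_(y in [set: I]) (lam * m y * f y ^+ 2)%:E.
Proof.
rewrite /energy; congr (_ + _).
  rewrite esumZl_EFin//; last first.
    by move=> [y z] /= yz; rewrite mulr_ge0 ?sqr_ge0// c_ge0.
  by apply: eq_esum => -[y z] _ /=; congr EFin; rewrite /conductance; ring.
apply: eq_esum => y _; rewrite /ground_conductance /vertex_conductance.
have -> : \esum_(z in [set z | z != y]) (conductance q m y z)%:E =
    (m y * - q y y)%:E.
  rewrite EFinM -esum_row -ge0_esumZl//; first by rewrite lee_fin ltW.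
  by move=> z zy; rewrite lee_fin q_ge0// eq_sym.
rewrite -!EFinM; congr EFin.
have : (- q y y != 0)%R by rewrite gt_eqF// Qmatrix_diag_lt0.
by move=> ?; field; rewrite -oppr_eq0.
Qed.

Let energy_ge0 h : 0 <= energy q m lam h.
Proof.
rewrite energyE adde_ge0// esum_ge0// => [[y z] /= yz|y _].
  by rewrite lee_fin mulr_ge0// mulr_ge0 ?sqr_ge0// c_ge0.
by rewrite lee_fin mulr_ge0 ?sqr_ge0// mulr_ge0// ltW.
Qed.

(** Pair [green_test] with itself. Expanding the squares gives energy + B = N, while the pairing
    gives N + (defect) = m_x g(x) + B; the finite B cancels and the nonnegative defect is
    dropped. *)
Lemma energy_green_test n :
  energy q m lam (green_test n) <= (m x * green_test n x)%:E.
Proof.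
set g := green_test n; have g0 y : (0 <= g y)%R by exact: green_test_ge0.
have := green_test_pairing n g0; rewrite -/g.
set B := \esum_(yz in offdiag) _; set N := \esum_(y in [set: I]) _.
set H := (\esum_(y in [set: I]) ((g y * (lam - q y y))%:E * _)) => NB.
have B0 : 0 <= B.
  by apply: esum_ge0 => -[y z] /= yz; rewrite lee_fin mulr_ge0 ?c_ge0// mulr_ge0.
have N0 : 0 <= N.
  apply: esum_ge0 => y _; rewrite lee_fin.
  by apply: mulr_ge0; apply: mulr_ge0 => //; exact: ltW.
have Nfin : N \is a fin_num.
  rewrite ge0_fin_numE// (le_lt_trans (@green_test_pairing_le n g
    (n%:R / (lam - q x x)) _)) ?ltry// => y.
  by rewrite g0 green_test_le.
have H0 : 0 <= (m x)%:E * H.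
  apply: mule_ge0; first by rewrite lee_fin ltW.
  apply: esum_ge0 => y _.
  by apply: mule_ge0; [rewrite lee_fin mulr_ge0|exact: jump_green_ge0].
have eBN : energy q m lam g + B = N.
  rewrite energyE /N (@esum_degree_split (fun y => g y * g y)%R); last first.
    by move=> y; rewrite mulr_ge0.
  rewrite addeAC; congr (_ + _).
  rewrite /B (@esum_offdiag_sym (fun y z => g y * g z)%R); last first.
    by move=> y z; rewrite mulr_ge0.
  rewrite esumD_EFin; last 2 first.
  - by move=> [y z] /= yz; rewrite mulr_ge0// mulr_ge0 ?sqr_ge0// c_ge0.
  - move=> [y z] /= yz; rewrite mulr_ge0// mulr_ge0 ?c_ge0//.
    by rewrite addr_ge0// mulr_ge0.
  by apply: eq_esum => -[y z] _ /=; congr EFin; ring.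
have Bfin : B \is a fin_num.
  rewrite ge0_fin_numE// (@le_lt_trans _ _ N) ?ltey_eq ?Nfin// -eBN leeDr//.
by rewrite -(leeD2rE _ _ Bfin) eBN -NB leeDl.
Qed.

(** This is e(f - c g) >= 0 for g = [green_test n], without subtraction: 2 c e(f, g) <= e(f) + c^2
    e(g), where e(g) <= m_x g(x) and, since 0 <= f <= 1, the defect in e(f, g) is at most m_x
    [jump_mass n]. *)
Lemma energy_green_test_ge n (f : I -> R) (c : R) :
  (0 <= c)%R -> f x = 1%R -> (forall y, 0 <= f y <= 1)%R ->
  (2 * c * m x)%:E <= energy q m lam f +
    (c ^+ 2 * m x * green_test n x)%:E + (2 * c * m x)%:E * jump_mass n.
Proof.
move=> c0 fx f01; have f0 y : (0 <= f y)%R by have /andP[] := f01 y.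
have f1 y : (f y <= 1)%R by have /andP[] := f01 y.
set g := green_test n; have g0 y : (0 <= g y)%R by exact: green_test_ge0.
have := green_test_pairing n f0; rewrite -/g fx mulr1.
set B := \esum_(yz in offdiag) _; set N := \esum_(y in [set: I]) _.
set H := (\esum_(y in [set: I]) ((f y * (lam - q y y))%:E * _)) => NB.
have B0 : 0 <= B.
  by apply: esum_ge0 => -[y z] /= yz; rewrite lee_fin mulr_ge0 ?c_ge0// mulr_ge0.
have N0 : 0 <= N.
  apply: esum_ge0 => y _; rewrite lee_fin.
  by apply: mulr_ge0; apply: mulr_ge0 => //; exact: ltW.
have Nfin : N \is a fin_num.
  by rewrite ge0_fin_numE// (le_lt_trans (@green_test_pairing_le n f 1 f01)) ?ltry.
have H0 : 0 <= H.
  apply: esum_ge0 => y _.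
  by apply: mule_ge0; [rewrite lee_fin mulr_ge0|exact: jump_green_ge0].
have HT : H <= jump_mass n.
  apply: le_esum => y _; rewrite lee_wpmul2r ?jump_green_ge0// lee_fin.
  by rewrite ler_piMl.
have Tfin : jump_mass n \is a fin_num.
  by rewrite ge0_fin_numE ?jump_mass_ge0// (le_lt_trans (jump_mass_le1 n)) ?ltry.
have Hfin : H \is a fin_num.
  by rewrite ge0_fin_numE// (le_lt_trans HT)// ltey_eq Tfin.
have Bfin : B \is a fin_num.
  rewrite ge0_fin_numE// (@le_lt_trans _ _ ((m x)%:E + B))//.
    by rewrite leeDr// lee_fin ltW.
  by rewrite -NB ltey_eq fin_numD Nfin fin_numM.
have Dlam (u : I -> R) : (forall y, 0 <= u y)%R ->
    forall y, [set: I] y -> (0 <= lam * m y * u y)%R.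
  by move=> u0 y _; rewrite mulr_ge0// mulr_ge0// ltW.
have Dpair (u : I -> I -> R) : (forall y z, 0 <= u y z)%R ->
    forall yz, offdiag yz -> (0 <= 2^-1 * (m yz.1 * q yz.1 yz.2 * u yz.1 yz.2))%R.
  by move=> u0 [y z] /= yz; rewrite mulr_ge0// mulr_ge0// c_ge0.
(* Both sides are sums over pairs and over vertices; term by term their difference is a multiple of
   the square of an increment, respectively a value, of f - c g. *)
have key : (2 * c)%:E * N <=
    energy q m lam f + (c ^+ 2)%:E * energy q m lam g + (2 * c)%:E * B.
  rewrite /N (@esum_degree_split (fun y => f y * g y)%R); last first.
    by move=> y; rewrite mulr_ge0.
  have -> : B = \esum_(yz in offdiag) (2^-1 * (m yz.1 * q yz.1 yz.2 *
      (g yz.1 * f yz.2 + g yz.2 * f yz.1)))%:E.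
    by rewrite /B (@esum_offdiag_sym (fun y z => g y * f z)%R)// => y z; rewrite mulr_ge0.
  rewrite !energyE.
  have c20 : (0 <= c ^+ 2)%R by rewrite sqr_ge0.
  have cc0 : (0 <= 2 * c)%R by rewrite mulr_ge0.
  have p1 := Dpair (fun y z => (f y - f z) ^+ 2)%R (fun y z => sqr_ge0 _).
  have p2 := Dpair (fun y z => (g y - g z) ^+ 2)%R (fun y z => sqr_ge0 _).
  have p3 := Dpair (fun y z => g y * f z + g z * f y)%R
    (fun y z => addr_ge0 (mulr_ge0 (g0 _) (f0 _)) (mulr_ge0 (g0 _) (f0 _))).
  have p4 := Dpair (fun y z => f y * g y + f z * g z)%R
    (fun y z => addr_ge0 (mulr_ge0 (f0 _) (g0 _)) (mulr_ge0 (f0 _) (g0 _))).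
  have d1 := Dlam (fun y => f y ^+ 2)%R (fun y => sqr_ge0 _).
  have d2 := Dlam (fun y => g y ^+ 2)%R (fun y => sqr_ge0 _).
  have d3 := Dlam (fun y => f y * g y)%R (fun y => mulr_ge0 (f0 _) (g0 _)).
  rewrite ge0_muleDr ?esum_ge0//.
  rewrite ge0_muleDr ?esum_ge0//.
  rewrite !esumZl_EFin//.
  have addeC5 (a b a' b' e : \bar R) : a + b + (a' + b') + e = (a + a' + e) + (b + b').
    by rewrite [X in X + e]addeACA [LHS]addeAC.
  rewrite addeC5 esumD_EFin//; last by move=> yz /p2 ?; rewrite mulr_ge0.
  rewrite esumD_EFin//; last 2 first.
  - move=> yz oyz; apply: addr_ge0; first exact: p1.
    by apply: mulr_ge0 => //; exact: p2.
  - by move=> yz /p3 ?; rewrite mulr_ge0.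
  rewrite esumD_EFin//; last by move=> yz /d2 ?; rewrite mulr_ge0.
  apply: leeD; apply: le_esum.
    move=> [y z] /= yz; rewrite lee_fin -subr_ge0.
    have -> : (2^-1 * (m y * q y z * (f y - f z) ^+ 2) +
       c ^+ 2 * (2^-1 * (m y * q y z * (g y - g z) ^+ 2)) +
       2 * c * (2^-1 * (m y * q y z * (g y * f z + g z * f y))) -
       2 * c * (2^-1 * (m y * q y z * (f y * g y + f z * g z))) =
       2^-1 * (m y * q y z * (f y - f z - c * (g y - g z)) ^+ 2))%R by ring.
    by rewrite mulr_ge0// mulr_ge0 ?sqr_ge0// c_ge0.
  move=> y _; rewrite lee_fin -subr_ge0.
  have -> : (lam * m y * f y ^+ 2 + c ^+ 2 * (lam * m y * g y ^+ 2) -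
      2 * c * (lam * m y * (f y * g y)) = lam * m y * (f y - c * g y) ^+ 2)%R.
    by ring.
  apply: mulr_ge0; last exact: sqr_ge0.
  by apply: mulr_ge0; exact: ltW.
have := energy_ge0 f; case ef : (energy q m lam f) => [e||]// _; last first.
  rewrite addye ?leey// gt_eqF// (lt_le_trans (ltNyr 0%R))//.
  apply: mule_ge0; last exact: jump_mass_ge0.
  by rewrite lee_fin; apply: mulr_ge0; [exact: mulr_ge0|exact: ltW].
have egx := energy_green_test n.
have egfin : energy q m lam g \is a fin_num.
  by rewrite ge0_fin_numE// (le_lt_trans egx) ?ltry.
move: key egx; rewrite ef -/g.
rewrite -[energy q m lam g]fineK// -[N]fineK// -[B]fineK// -[jump_mass n]fineK//.
rewrite -!(EFinM,EFinD) !lee_fin => key egx.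
move: NB HT; rewrite -[N]fineK// -[B]fineK// -[H]fineK// -[jump_mass n]fineK//.
rewrite -!(EFinM,EFinD) lee_fin => -[NB] HT.
have h1 : (m x * fine H <= m x * fine (jump_mass n))%R by rewrite ler_pM2l.
have h2 := ler_wpM2l (sqr_ge0 c) egx.
have h3 : (2 * c * (m x + fine B) = 2 * c * (fine N + m x * fine H))%R by rewrite NB.
have h4 : (2 * c * (m x * fine H) <= 2 * c * (m x * fine (jump_mass n)))%R.
  by rewrite ler_wpM2l// mulr_ge0.
move: key h2 h3 h4; rewrite !mulrDr !mulrA => *; lra.
Qed.

Lemma energyZ (f : I -> R) (c : R) : (0 <= c)%R ->
  energy q m lam (fun y => c * f y)%R = (c ^+ 2)%:E * energy q m lam f.
Proof.
move=> c0; have c20 : (0 <= c ^+ 2)%R by exact: sqr_ge0.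
have p yz : offdiag yz ->
    (0 <= 2^-1 * (m yz.1 * q yz.1 yz.2 * (f yz.1 - f yz.2) ^+ 2))%R.
  case: yz => y z /= yz.
  by apply: mulr_ge0 => //; apply: mulr_ge0; [exact: c_ge0|exact: sqr_ge0].
have p' y : [set: I] y -> (0 <= lam * m y * f y ^+ 2)%R.
  move=> _; apply: mulr_ge0; last exact: sqr_ge0.
  by apply: mulr_ge0; exact: ltW.
rewrite !energyE ge0_muleDr ?esum_ge0//.
rewrite !esumZl_EFin//.
by congr (_ + _); apply: eq_esum => y _; congr EFin; ring.
Qed.

Lemma energy_le (f g : I -> R) :
  (forall y z, `|f y - f z| <= `|g y - g z|)%R -> (forall y, `|f y| <= `|g y|)%R ->
  energy q m lam f <= energy q m lam g.
Proof.
move=> fg2 fg; have sqr_le (a b : R) : (`|a| <= `|b|)%R -> (a ^+ 2 <= b ^+ 2)%R.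
  by move=> ab; rewrite -(real_normK (num_real a)) -(real_normK (num_real b)) lerXn2r ?nnegrE.
rewrite !energyE; apply: leeD; apply: le_esum.
  move=> [y z] /= yz.
  by rewrite lee_fin ler_wpM2l// ler_wpM2l ?c_ge0// sqr_le.
move=> y _; rewrite lee_fin.
by rewrite ler_wpM2l ?sqr_le//; apply: mulr_ge0; exact: ltW.
Qed.

(** Truncation to [0, 1] fixes the value 1 at [x] and is a contraction, so it does not raise the
    energy: the infimum may be tested on functions with values in [0, 1], as [energy_green_test_ge]
    requires. *)
Let clamp (a : R) : R := Num.max 0%R (Num.min a 1%R).

Let clamp01 a : (0 <= clamp a <= 1)%R.
Proof. by rewrite /clamp le_max lexx/= ge_max ler01 ge_min lexx orbT. Qed.

Let clamp_lip a b : (`|clamp a - clamp b| <= `|a - b|)%R.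
Proof.
have clampE u : clamp u =
    (if u <= 0 then 0 else if u <= 1 then u else 1)%R.
  rewrite /clamp; case: (leP u 0%R) => u0.
    by rewrite min_l ?max_l// (le_trans u0).
  by case: (leP u 1%R) => u1; rewrite max_r// ltW.
have h1 : (a - b <= `|a - b|)%R by exact: ler_norm.
have h2 : (b - a <= `|a - b|)%R by rewrite distrC ler_norm.
rewrite !clampE ler_norml; case: (leP a 0%R) => ?; case: (leP b 0%R) => ?;
  case: (leP a 1%R) => ?; case: (leP b 1%R) => ?; apply/andP; split; lra.
Qed.

(** The hypotheses say that [gam] is the limit of the increasing [green_sum n x] and that the defect
    gets arbitrarily small. The upper bound uses the normalized test function g / g(x), of energy at
    most m_x / g(x); the lower bound is [energy_green_test_ge]. *)
Lemma effective_conductanceE (gam : R) :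
  (forall n, green_sum n x <= gam%:E) ->
  (forall e : R, (0 < e)%R -> exists n, (gam - e)%:E <= green_sum n x) ->
  (forall e : R, (0 < e)%R -> exists n, jump_mass n <= e%:E) ->
  effective_conductance q m lam x = (m x / gam)%:E.
Proof.
move=> hle hge hT.
have gxE n : green_test n x = fine (green_sum n x).
  by rewrite /green_test divff ?mul1r// gt_eqF.
have gxle n : (green_test n x <= gam)%R.
  by rewrite gxE -lee_fin fineK ?green_sum_fin_num.
have gam0 : (0 < gam)%R.
  rewrite -lte_fin (lt_le_trans _ (hle 1%N))// /green_sum big_ord_recl big_ord0.
  by rewrite adde0/= eqxx lte_fin divr_gt0.
apply/eqP; rewrite eq_le; apply/andP; split.
  apply/lee_addgt0Pr => e e0.
  (* The first bound keeps g(x) >= gam / 2; the second makes m_x e' / gam <= e gam / 2 <= e g(x),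
     which is what m_x / g(x) <= m_x / gam + e amounts to. *)
  pose e' := (Num.min (gam / 2) (gam ^+ 2 * e / (2 * m x)))%R.
  have e'0 : (0 < e')%R.
    by rewrite lt_min !divr_gt0 ?mulr_gt0 ?exprn_gt0.
  have [n hn] := hge _ e'0.
  have gn : (gam - e' <= green_test n x)%R.
    by rewrite gxE -lee_fin fineK ?green_sum_fin_num.
  have e'1 : (e' <= gam / 2)%R by rewrite /e' ge_min lexx.
  have e'2 : (e' <= gam ^+ 2 * e / (2 * m x))%R by rewrite /e' ge_min lexx orbT.
  have gn0 : (0 < green_test n x)%R by apply: lt_le_trans gn; lra.
  apply: (@le_trans _ _ (m x / green_test n x)%:E).
    apply: (@le_trans _ _ (energy q m lam
        (fun y => (green_test n x)^-1 * green_test n y)%R)).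
      by apply: ereal_inf_lbound => /=; eexists; [|reflexivity]; rewrite /= mulVf ?gt_eqF.
    rewrite energyZ; last by rewrite invr_ge0 ltW.
    apply: (@le_trans _ _ (((green_test n x)^-1 ^+ 2)%:E * (m x * green_test n x)%:E)).
      by rewrite lee_wpmul2l ?energy_green_test// lee_fin sqr_ge0.
    rewrite -EFinM lee_fin le_eqVlt; apply/orP; left; apply/eqP.
    by field; rewrite gt_eqF.
  rewrite -EFinD lee_fin ler_pdivrMr// mulrDl -lerBlDl.
  apply: (@le_trans _ _ (m x / gam * e')%R).
    have hm : (m x = m x / gam * gam)%R by rewrite divfK ?gt_eqF.
    rewrite {1}hm -mulrBr.
    apply: ler_wpM2l; last by lra.
    by rewrite divr_ge0// ltW.
  apply: (@le_trans _ _ (m x / gam * (gam ^+ 2 * e / (2 * m x)))%R).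
    by rewrite ler_wpM2l// divr_ge0// ltW.
  have -> : (m x / gam * (gam ^+ 2 * e / (2 * m x)) = e * (gam / 2))%R.
    by field; rewrite !gt_eqF.
  by rewrite ler_wpM2l//; lra.
apply: le_ereal_inf_tmp => _ [f /= fx <-].
have fc : energy q m lam (clamp \o f) <= energy q m lam f.
  apply: energy_le => [y z|y] /=; first exact: clamp_lip.
  have := clamp_lip (f y) 0%R; rewrite subr0 (_ : clamp 0%R = 0%R) ?subr0//.
  by rewrite /clamp min_l// maxxx.
apply: (le_trans _ fc); apply/lee_addgt0Pr => e e0.
have cx : (clamp \o f) x = 1%R.
  by rewrite /= fx /clamp minxx max_r.
have eg0 : (0 < e * gam / (2 * m x))%R by rewrite divr_gt0 ?mulr_gt0.
have [n Tn] := hT (e * gam / (2 * m x))%R eg0.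
(* The choice c = 1 / gam maximizes 2 c m_x - c^2 m_x gam, with maximum m_x / gam; the threshold for
   [jump_mass] makes the remaining term 2 c m_x [jump_mass n] at most e. *)
have c0 : (0 <= gam^-1)%R by rewrite invr_ge0 ltW.
have := energy_green_test_ge n c0 cx (fun y => clamp01 (f y)).
have := energy_ge0 (clamp \o f).
case: (energy _ _ _ _) => [E||//] _; last by move=> _; rewrite addye ?leey.
have Tfin : jump_mass n \is a fin_num.
  by rewrite ge0_fin_numE ?jump_mass_ge0// (le_lt_trans (jump_mass_le1 n)) ?ltry.
move: Tn; rewrite -[jump_mass n]fineK// -!(EFinM,EFinD) !lee_fin => Tn.
have := ler_wpM2l (mulr_ge0 (sqr_ge0 gam^-1) (ltW (m_gt0 x))) (gxle n).
have -> : (gam^-1 ^+ 2 * m x * gam = m x / gam)%R by field; rewrite gt_eqF.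
have := ler_wpM2l (mulr_ge0 (mulr_ge0 (ler0n _ 2) c0) (ltW (m_gt0 x))) Tn.
have -> : (2 * gam^-1 * m x * (e * gam / (2 * m x)) = e)%R.
  by field; rewrite !gt_eqF.
have -> : (2 * gam^-1 * m x = m x / gam + m x / gam)%R by field; rewrite gt_eqF.
lra.
Qed.

End GroundedNetwork.

(** * Skeletons of the chain *)

Section CountableUnion.
Context {R : realType} {d : measure_display} {T : measurableType d}
  {J : countType}.
Variables (D : set J) (F : J -> set T).
Hypothesis mF : forall j, D j -> measurable (F j).

(** Reindexing by [pickle] turns the family into a sequence, to which sigma-additivity applies;
    numbers that code no element of [D] give the empty set. *)
Let G n : set T := \bigcup_(j in [set j | D j /\ choice.pickle j = n]) F j.

Let GE j : D j -> G (choice.pickle j) = F j.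
Proof.
move=> Dj; apply/seteqP; split => om; last by move=> Fj; exists j.
by move=> [j' [_ /(pcan_inj pickleK_inv) ->]].
Qed.

Let G0 n : ~ (choice.pickle @` D) n -> G n = set0.
Proof.
move=> Dn; apply/seteqP; split => // om [j [Dj jn] _].
by apply: Dn; exists j.
Qed.

Let mG n : measurable (G n).
Proof.
have [[j Dj <-]|/G0 ->] := pselect ((choice.pickle @` D) n); last exact: measurable0.
by rewrite GE//; exact: mF.
Qed.

Let bigcupG : \bigcup_(j in D) F j = \bigcup_n G n.
Proof.
apply/seteqP; split => om.
  by move=> [j Dj Fj]; exists (choice.pickle j) => //; rewrite GE.
by move=> [n _ [j [Dj _] Fj]]; exists j.
Qed.

Lemma bigcup_countable_measurable : measurable (\bigcup_(j in D) F j).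
Proof. by rewrite bigcupG; exact: bigcup_measurable. Qed.

Lemma measure_bigcup_countable (mu : {measure set T -> \bar R}) :
  trivIset D F -> mu (\bigcup_(j in D) F j) = (\esum_(j in D) mu (F j))%E.
Proof.
move=> tF; rewrite bigcupG measure_semi_bigcup//; last first.
- exact: bigcup_measurable.
- apply/trivIsetP => m n _ _ mn; apply/seteqP; split => // om [].
  move=> [j [Dj jm] Fj] [k [Dk kn] Fk].
  by move/eqP: mn; apply; rewrite -jm -kn (tF j k)//; exists om.
rewrite nneseries_esumT//.
transitivity (\esum_(n in choice.pickle @` D) mu (G n))%E.
  rewrite [RHS]esum_mkcond; apply: eq_esum => n _.
  by case: ifPn => //; rewrite notin_setE => /G0 ->; rewrite measure0.
rewrite esum_image; last first.
  by move=> j k _ _ /(pcan_inj pickleK_inv).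
by apply: eq_esum => j Dj; rewrite GE.
Qed.

End CountableUnion.

Section Skeleton.
Context {R : realType} {I : countType} {d : measure_display}
  {T : measurableType d}.
Variables (P : R -> I -> I -> R) (Pr : I -> probability T R) (X : R -> T -> I).
Hypothesis hP : honest_standard_transition_function P.
Hypothesis hX : markov_chain P Pr X.
Variables (x : I) (delta : R).
Hypothesis delta_gt0 : 0 < delta.

Definition skeleton (om : T) (k : nat) : I := X (k%:R * delta) om.

(** Stands for measurability with respect to the coordinates 0, ..., k: as [I] is countable, such a
    set of sequences is a countable union of cylinders. *)
Definition adapted (k : nat) (A : set (nat -> I)) : Prop :=
  forall f g : nat -> I, (forall i, (i <= k)%N -> f i = g i) -> A f -> A g.

Let cylinder k (s : seq I) : set T :=
  \bigcap_(i in `I_k.+1) (X (i%:R * delta) @^-1` [set nth x s i]).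

Let cylinderP k s om : cylinder k s om <->
  (forall i, (i <= k)%N -> skeleton om i = nth x s i).
Proof. by split => [h i ik|h i ik]; have := h i ik. Qed.

Let history om k := [seq skeleton om i | i <- iota 0 k.+1].

Let nth_history om k i : (i <= k)%N -> nth x (history om k) i = skeleton om i.
Proof.
by move=> ik; rewrite /history (nth_map 0%N) ?size_iota// nth_iota.
Qed.

Let Xmeas (t : R) y : 0 <= t -> measurable (X t @^-1` [set y]).
Proof. exact: (chain_measurable hX). Qed.

Let cylinder_measurable k s : measurable (cylinder k s).
Proof.
apply: bigcap_measurable; first by exists 0%N.
by move=> i _; apply: Xmeas; rewrite mulr_ge0// ltW.
Qed.

(** The length is fixed to [k.+1] because longer sequences with the same beginning describe the same
    cylinder, which would spoil disjointness in [cylinder_triv]. *)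
Let adapted_cover k A : adapted k A ->
  [set om | A (skeleton om)] =
  \bigcup_(s in [set s | size s = k.+1 /\ A (nth x s)]) cylinder k s.
Proof.
move=> adA; apply/seteqP; split => om /=.
  move=> Aom; exists (history om k).
    split; first by rewrite size_map size_iota.
    by apply: adA Aom => i ik; rewrite nth_history.
  by apply/cylinderP => i ik; rewrite nth_history.
move=> [s [_ As] /cylinderP h]; apply: adA As => i ik.
by rewrite h.
Qed.

Let cylinder_triv k A :
  trivIset [set s | size s = k.+1 /\ A (nth x s)] (cylinder k).
Proof.
move=> s s' /= [ss _] [ss' _] [om [/cylinderP h /cylinderP h']].
apply: (@eq_from_nth _ x); first by rewrite ss ss'.
by move=> i; rewrite ss => ik; rewrite -h// -h'.
Qed.

Lemma adapted_measurable k A : adapted k A ->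
  measurable [set om | A (skeleton om)].
Proof.
move=> /adapted_cover ->; apply: bigcup_countable_measurable => s _.
exact: cylinder_measurable.
Qed.

Local Open Scope ereal_scope.

Let cylinder_markov k s (t : R) z : (0 < t)%R ->
  Pr x (cylinder k s `&` (X (k%:R * delta + t)%R @^-1` [set z])) =
  Pr x (cylinder k s) * (P t (nth x s k) z)%:E.
Proof.
move=> t0.
(* [chain_markov] asks for an infinite strictly increasing sequence of times: the grid up to k, then
   steps of length t, of which only the first is observed. *)
pose tt (i : nat) : R := (if (i <= k)%N then i%:R * delta else k%:R * delta + (i - k)%:R * t)%R.
pose yy (i : nat) := if (i <= k)%N then nth x s i else z.
have tthomo : {homo tt : i j / (i < j)%N >-> (i < j)%R}.
  move=> i j ij; rewrite /tt; case: (leqP i k) => ik; case: (leqP j k) => jk.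
  - by rewrite ltr_pM2r// ltr_nat.
  - rewrite (@le_lt_trans _ _ (k%:R * delta)%R)//.
      by rewrite ler_wpM2r ?ler_nat// ltW.
    by rewrite ltrDl mulr_gt0// ltr0n subn_gt0.
  - by have := leq_ltn_trans jk ik; rewrite ltnNge (ltnW ij).
  - by rewrite ltrD2l ltr_pM2r// ltr_nat ltn_sub2r// (ltn_trans ik ij).
have tt0 : (0 <= tt 0%N)%R by rewrite /tt leq0n mul0r.
have := @chain_markov _ _ _ _ _ _ _ hX x k tt yy tt0 tthomo.
have -> : \bigcap_(i in `I_k.+2) (X (tt i) @^-1` [set yy i]) =
    cylinder k s `&` (X (k%:R * delta + t)%R @^-1` [set z]).
  apply/seteqP; split => om.
    move=> h; split => [i ik|].
      by have := h i (leqW ik); rewrite /tt /yy; move: ik => /= ik; rewrite -ltnS ik.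
    by have := h k.+1 (ltnSn _); rewrite /tt /yy /= ltnn subSnn mul1r.
  move=> [h hz] i /=; rewrite ltnS leq_eqVlt => /orP[/eqP ->|ik].
    by rewrite /tt /yy ltnn subSnn mul1r.
  by have := h i ik; rewrite /tt /yy; rewrite ltnS in ik; rewrite ik.
have -> : \bigcap_(i in `I_k.+1) (X (tt i) @^-1` [set yy i]) = cylinder k s.
  by apply/seteqP; split => om h i ik; have := h i ik; rewrite /tt /yy;
    move: ik => /= ik; rewrite -ltnS ik.
by move=> ->; rewrite /tt /yy leqnn ltnn subSnn mul1r addrAC subrr add0r.
Qed.

Lemma adapted_markov k A (t : R) y z : adapted k A -> (0 < t)%R ->
  Pr x ([set om | A (skeleton om) /\ skeleton om k = y] `&`
        (X (k%:R * delta + t)%R @^-1` [set z])) =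
  Pr x [set om | A (skeleton om) /\ skeleton om k = y] * (P t y z)%:E.
Proof.
move=> adA t0; pose A' := A `&` [set f : nat -> I | f k = y].
have adA' : adapted k A'.
  by move=> f g fg [Af fk]; split; [exact: adA Af|rewrite /= -fg].
have mX : measurable (X (k%:R * delta + t)%R @^-1` [set z]).
  by apply: Xmeas; rewrite addr_ge0 ?mulr_ge0// ltW.
rewrite -[[set om | _]]/[set om | A' (skeleton om)] (adapted_cover adA').
have mcyl s : measurable (cylinder k s) by exact: cylinder_measurable.
have tcyl := @cylinder_triv k A'.
rewrite setI_bigcupl measure_bigcup_countable; last 2 first.
- by move=> s _; exact: measurableI.
- by move=> s s' Ds Ds' [om [[hs _] [hs' _]]]; apply: (tcyl _ _ Ds Ds'); exists om.
rewrite measure_bigcup_countable//.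
rewrite -ge0_esumZr//; last by rewrite lee_fin (transition_ge0 hP) ?ltW.
by apply: eq_esum => s [_ [_ <-]]; exact: cylinder_markov.
Qed.

(** Paths start at [x] only almost surely; path identities that need the exact starting point are
    used after this intersection. *)
Lemma measure_start A : measurable A ->
  Pr x A = Pr x (A `&` [set om | skeleton om 0 = x]).
Proof.
move=> mA; have m0 : measurable [set om | skeleton om 0 = x].
  by apply: Xmeas; rewrite mul0r.
rewrite [LHS](measureDI (Pr x) mA m0) -[RHS]adde0 addeC; congr (_ + _).
have mD : measurable (A `\` [set om | skeleton om 0 = x]) by exact: measurableD.
have mC : measurable (~` [set om | skeleton om 0 = x]) by exact: measurableC.
have PC : Pr x (~` [set om | skeleton om 0 = x]) = 0.
  rewrite probability_setC// /skeleton.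
  by have := chain_start hX x; rewrite mul0r => ->; rewrite subee.
by apply: (subset_measure0 mD mC _ PC) => om [].
Qed.

Let delta_ge0 : (0 <= delta)%R. Proof. exact: ltW. Qed.

Lemma transition_le1 (t : R) y z : (0 <= t)%R -> (P t y z <= 1)%R.
Proof.
move=> t0; rewrite -lee_fin -(transition_honest hP y t0).
apply: (@le_esum1 _ _ _ (fun z => (P t y z)%:E)) => // z' _.
by rewrite lee_fin (transition_ge0 hP).
Qed.

Let P_ge0 y z : (0 <= P delta y z)%R. Proof. exact: (transition_ge0 hP). Qed.

Lemma skeleton_step k A y z : adapted k A ->
  Pr x [set om | (A (skeleton om) /\ skeleton om k = y) /\ skeleton om k.+1 = z] =
  Pr x [set om | A (skeleton om) /\ skeleton om k = y] * (P delta y z)%:E.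
Proof.
move=> adA; rewrite -(adapted_markov _ _ adA delta_gt0); congr (Pr x _).
by apply/seteqP; split => om /= [h <-]; split => //;
  rewrite /skeleton/= -natr1 mulrDl mul1r.
Qed.

Lemma adaptedW k l A : (k <= l)%N -> adapted k A -> adapted l A.
Proof.
by move=> kl adA f g fg; apply: adA => i ik; apply: fg; exact: leq_trans kl.
Qed.

Lemma adaptedI k A B : adapted k A -> adapted k B -> adapted k (A `&` B).
Proof. by move=> hA hB f g fg [Af Bf]; split; [exact: hA Af|exact: hB Bf]. Qed.

Lemma adapted_at k i (D : set I) : (i <= k)%N -> adapted k [set f | D (f i)].
Proof. by move=> ik f g fg /=; rewrite fg. Qed.

Lemma measure_skeleton_at k A (D : set I) : adapted k A ->
  Pr x [set om | A (skeleton om) /\ D (skeleton om k)] =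
  \esum_(y in D) Pr x [set om | A (skeleton om) /\ skeleton om k = y].
Proof.
move=> adA.
transitivity (Pr x (\bigcup_(y in D)
    [set om | A (skeleton om) /\ skeleton om k = y])).
  congr (Pr x _); apply/seteqP; split => om /=.
    by move=> [Aom Dom]; exists (skeleton om k).
  by move=> [y Dy [Aom ->]].
rewrite measure_bigcup_countable//.
- move=> y _; apply: (@adapted_measurable k (A `&` [set f | f k = y])).
  by apply: adaptedI => //; exact: (@adapted_at _ _ [set y]).
- by move=> y y' _ _ [om [[_ e1] [_ e2]]]; rewrite -e1 -e2.
Qed.

Lemma skeleton_step_sum k A (D : set I) z : adapted k A ->
  Pr x [set om | (A (skeleton om) /\ D (skeleton om k)) /\ skeleton om k.+1 = z] =
  \esum_(y in D) (Pr x [set om | A (skeleton om) /\ skeleton om k = y] *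
                  (P delta y z)%:E).
Proof.
move=> adA.
transitivity (Pr x (\bigcup_(y in D)
    [set om | (A (skeleton om) /\ skeleton om k = y) /\ skeleton om k.+1 = z])).
  congr (Pr x _); apply/seteqP; split => om /=.
    by move=> [[Aom Dom] <-]; exists (skeleton om k).
  by move=> [y Dy [[Aom ->] ->]].
rewrite measure_bigcup_countable//.
- by apply: eq_esum => y _; exact: skeleton_step.
- move=> y _; apply: (@adapted_measurable k.+1
    ((A `&` [set f | f k = y]) `&` [set f | f k.+1 = z])).
  apply: adaptedI; last exact: (@adapted_at _ _ [set z]).
  apply: adaptedI; first exact: adaptedW adA.
  exact: (@adapted_at _ _ [set y]).
- by move=> y y' _ _ [om [[[_ e1] _] [[_ e2] _]]]; rewrite -e1 -e2.
Qed.

(** Only changes visible on the grid are counted. Moves undone between two grid times are missed, so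
    the count can fall short of the number of jumps but cannot exceed it. *)
Definition changes (f : nat -> I) (k : nat) : nat :=
  (\sum_(i < k) (f i != f i.+1))%N.

Lemma changesS f k : changes f k.+1 = (changes f k + (f k != f k.+1))%N.
Proof. by rewrite /changes big_ord_recr. Qed.

Lemma adapted_changes k n : adapted k [set f | changes f k = n].
Proof.
move=> f g fg /= <-; apply: eq_bigr => i _.
by rewrite !fg// ltnW.
Qed.

Definition change_prob k n z : \bar R :=
  Pr x [set om | changes (skeleton om) k = n /\ skeleton om k = z].

(* The probability that the step from [k] to [k.+1] is the (n+1)-st change of
   the skeleton and leads to [z]. *)
Definition arrival_prob k n z : \bar R :=
  \esum_(y in [set y | y != z]) (change_prob k n y * (P delta y z)%:E).

Lemma change_prob0 n z : change_prob 0 n z = ((n == 0%N) && (x == z))%:R%:E.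
Proof.
have mA : measurable [set om | changes (skeleton om) 0 = n /\ skeleton om 0 = z].
  apply: (@adapted_measurable 0 ([set f | changes f 0 = n] `&` [set f | f 0%N = z])).
  apply: adaptedI; first exact: adapted_changes.
  exact: (@adapted_at _ _ [set z]).
rewrite /change_prob measure_start//.
case: andP => [[/eqP -> /eqP <-]|nz] /=.
  rewrite -(chain_start hX x); congr (Pr x _); apply/seteqP; split => om /=.
    by move=> [_]; rewrite /skeleton mul0r.
  by rewrite /skeleton mul0r => ->; rewrite /changes big_ord0.
rewrite (_ : _ `&` _ = set0) ?measure0//; apply/seteqP; split => // om /=.
move=> [[n0 xz] x0]; apply: nz; split; apply/eqP; last by rewrite -xz -x0.
by rewrite -n0 /changes big_ord0.
Qed.

Lemma change_probS0 k z :
  change_prob k.+1 0 z = change_prob k 0 z * (P delta z z)%:E.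
Proof.
rewrite /change_prob -(@skeleton_step k [set f | changes f k = 0%N]);
  last exact: adapted_changes.
congr (Pr x _); apply/seteqP; split => om /=; rewrite changesS.
  move=> [/eqP + zE]; rewrite addn_eq0 eqb0 negbK => /andP[/eqP -> /eqP kE].
  by rewrite kE.
by move=> [[-> ->] ->]; rewrite eqxx.
Qed.

Lemma change_probS k n z : change_prob k.+1 n.+1 z =
  arrival_prob k n z + change_prob k n.+1 z * (P delta z z)%:E.
Proof.
have adn m := @adapted_changes k m.
rewrite /arrival_prob.
rewrite -(@skeleton_step_sum k [set f | changes f k = n] [set y | y != z])//.
rewrite /change_prob -(@skeleton_step k [set f | changes f k = n.+1])// -measureU.
- congr (Pr x _); apply/seteqP; split => om /=; rewrite changesS.
    move=> [+ zE]; case: (eqVneq (skeleton om k) (skeleton om k.+1)) => [kE|kN];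
      rewrite /= ?addn0 ?addn1.
      by move=> ->; right; rewrite kE zE.
    by move=> [->]; left; rewrite zE in kN; rewrite kN zE.
  move=> [[[-> kz] ->]|[[-> ->] ->]]; first by rewrite kz addn1.
  by rewrite eqxx addn0.
- apply: (@adapted_measurable k.+1
    (([set f | changes f k = n] `&` [set f | f k != z]) `&` [set f | f k.+1 = z])).
  apply: adaptedI; last exact: (@adapted_at _ _ [set z]).
  apply: adaptedI; first exact: adaptedW (adn _).
  exact: (@adapted_at _ _ [set y | y != z]).
- apply: (@adapted_measurable k.+1
    (([set f | changes f k = n.+1] `&` [set f | f k = z]) `&` [set f | f k.+1 = z])).
  apply: adaptedI; last exact: (@adapted_at _ _ [set z]).
  apply: adaptedI; first exact: adaptedW (adn _).
  exact: (@adapted_at _ _ [set z]).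
- by apply/seteqP; split => // om /= [[[-> _] _] [[/n_Sn]]].
Qed.

Lemma change_prob_ge0 k n z : 0 <= change_prob k n z.
Proof. exact: measure_ge0. Qed.

Lemma arrival_prob_ge0 k n z : 0 <= arrival_prob k n z.
Proof. by apply: esum_ge0 => y _; rewrite mule_ge0 ?change_prob_ge0// lee_fin. Qed.

Lemma change_prob_total k :
  \esum_(n in [set: nat]) \esum_(z in [set: I]) change_prob k n z = 1.
Proof.
transitivity (\esum_(n in [set: nat])
    Pr x [set om | changes (skeleton om) k = n]).
  apply: eq_esum => n _; rewrite -(@measure_skeleton_at k [set f | changes f k = n] setT).
    by congr (Pr x _); apply/seteqP; split => om //= [].
  exact: adapted_changes.
rewrite -measure_bigcup_countable; last 2 first.
- move=> n _; apply: (@adapted_measurable k [set f | changes f k = n]).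
  exact: adapted_changes.
- by move=> m n _ _ [om [/= <- <-]].
rewrite -[RHS](probability_setT (Pr x)); congr (Pr x _).
by apply/seteqP; split => // om _; exists (changes (skeleton om) k).
Qed.

(** * Generating functions of the skeleton: changes of state, first return, renewal *)

Section GeneratingFunctions.
Variable r : R.
Hypothesis r01 : (0 < r < 1)%R.

Let r_ge0 : (0 <= r)%R. Proof. by case/andP: r01 => /ltW. Qed.

Let rk_ge0 k : 0 <= (r ^+ k)%:E. Proof. by rewrite lee_fin exprn_ge0. Qed.

(** With r = exp(- lam delta), [delta * change_gen n z] is a Riemann sum for the discounted time
    spent at z between the n-th and the (n+1)-st change seen by the skeleton. *)
Definition change_gen n z : \bar R :=
  \esum_(k in [set: nat]) ((r ^+ k)%:E * change_prob k n z).

Definition arrival_gen n z : \bar R :=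
  \esum_(k in [set: nat]) ((r ^+ k.+1)%:E * arrival_prob k n z).

Lemma change_gen_ge0 n z : 0 <= change_gen n z.
Proof. by apply: esum_ge0 => k _; rewrite mule_ge0 ?change_prob_ge0. Qed.

Lemma arrival_gen_ge0 n z : 0 <= arrival_gen n z.
Proof. by apply: esum_ge0 => k _; rewrite mule_ge0 ?arrival_prob_ge0. Qed.

Let shuffle (a b : R) (u : \bar R) : a%:E * (u * b%:E) = (a * b)%:E * u.
Proof. by rewrite (muleC u) muleA -EFinM. Qed.

Lemma arrival_genE n z : arrival_gen n z =
  \esum_(y in [set y | y != z]) ((r * P delta y z)%:E * change_gen n y).
Proof.
pose a k y : \bar R := (r * P delta y z)%:E * ((r ^+ k)%:E * change_prob k n y).
have a0 k y : 0 <= a k y.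
  rewrite mule_ge0 ?lee_fin ?mulr_ge0// mule_ge0 ?change_prob_ge0//.
transitivity (\esum_(k in [set: nat]) \esum_(y in [set y | y != z]) a k y).
  apply: eq_esum => k _; rewrite /arrival_prob -ge0_esumZl; last 2 first.
  - by rewrite lee_fin exprn_ge0.
  - by move=> y _; rewrite mule_ge0 ?change_prob_ge0// lee_fin.
  apply: eq_esum => y _; rewrite shuffle /a muleA -EFinM exprS.
  by congr (_%:E * _); ring.
rewrite (@esum_exchange_in _ _ _ _ _ a)//; apply: eq_esum => y _.
by rewrite ge0_esumZl ?lee_fin ?mulr_ge0// => k _; rewrite mule_ge0 ?change_prob_ge0.
Qed.

Let change_genE n z : change_gen n z = change_prob 0 n z +
  \esum_(k in [set: nat]) ((r ^+ k.+1)%:E * change_prob k.+1 n z).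
Proof.
rewrite /change_gen esum_nat_recl ?expr0 ?mul1e// => k.
by rewrite mule_ge0 ?change_prob_ge0.
Qed.

Let shift_gen n z : \esum_(k in [set: nat])
    ((r ^+ k.+1)%:E * (change_prob k n z * (P delta z z)%:E)) =
  (r * P delta z z)%:E * change_gen n z.
Proof.
rewrite -ge0_esumZl ?lee_fin ?mulr_ge0//; last first.
  by move=> k _; rewrite mule_ge0 ?change_prob_ge0.
apply: eq_esum => k _.
by rewrite shuffle muleA -EFinM exprS; congr (_%:E * _); ring.
Qed.

Lemma change_gen0 z :
  change_gen 0 z = (x == z)%:R%:E + (r * P delta z z)%:E * change_gen 0 z.
Proof.
rewrite {1}change_genE change_prob0 eqxx -shift_gen; congr (_ + _).
by apply: eq_esum => k _; rewrite change_probS0.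
Qed.

Lemma change_genS n z : change_gen n.+1 z =
  arrival_gen n z + (r * P delta z z)%:E * change_gen n.+1 z.
Proof.
rewrite {1}change_genE change_prob0 add0e -shift_gen -esumD.
- apply: eq_esum => k _; rewrite change_probS ge0_muleDr ?arrival_prob_ge0//.
  by rewrite mule_ge0 ?change_prob_ge0// lee_fin.
- by move=> k _; rewrite mule_ge0 ?arrival_prob_ge0// lee_fin exprn_ge0.
- move=> k _; rewrite mule_ge0 ?lee_fin ?exprn_ge0//.
  by rewrite mule_ge0 ?change_prob_ge0// lee_fin.
Qed.

Lemma change_gen_total :
  \esum_(n in [set: nat]) \esum_(z in [set: I]) change_gen n z =
  ((1 - r)^-1)%:E.
Proof.
have a0 k n z : 0 <= (r ^+ k)%:E * change_prob k n z.
  by rewrite mule_ge0 ?change_prob_ge0.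
transitivity (\esum_(n in [set: nat]) \esum_(k in [set: nat])
    \esum_(z in [set: I]) ((r ^+ k)%:E * change_prob k n z)).
  by apply: eq_esum => n _; rewrite esum_exchange_in.
rewrite (@esum_exchange_in _ _ _ _ _ (fun n k => \esum_(z in [set: I])
  ((r ^+ k)%:E * change_prob k n z))); last first.
  by move=> n k; exact: esum_ge0.
rewrite -(esum_geometric r01); apply: eq_esum => k _.
transitivity (\esum_(n in [set: nat])
    ((r ^+ k)%:E * \esum_(z in [set: I]) change_prob k n z)).
  apply: eq_esum => n _; rewrite ge0_esumZl// => z _; exact: change_prob_ge0.
rewrite ge0_esumZl ?change_prob_total ?mule1// => n _.
by apply: esum_ge0 => z _; exact: change_prob_ge0.
Qed.

Lemma change_gen_fin_num n z : change_gen n z \is a fin_num.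
Proof.
rewrite ge0_fin_numE ?change_gen_ge0//.
apply: (@le_lt_trans _ _ ((1 - r)^-1)%:E); last exact: ltry.
rewrite -change_gen_total.
apply: (@le_trans _ _ (\esum_(z in [set: I]) change_gen n z)).
  apply: (@le_esum1 _ _ _ (change_gen n)) => // z' _; exact: change_gen_ge0.
apply: (@le_esum1 _ _ _ (fun n => \esum_(z in [set: I]) change_gen n z)) => // n' _.
by apply: esum_ge0 => z' _; exact: change_gen_ge0.
Qed.

(** Finiteness of [C] carries the argument: for a > 0 the value [+oo] would solve the equation as
    well. *)
Let fixpoint_solve (C A : \bar R) (a : R) : C \is a fin_num ->
  (0 <= a < 1)%R -> C = A + a%:E * C -> C = ((1 - a)^-1)%:E * A.
Proof.
case: C => // c _ /andP[a0 a1]; case: A => [b| |] //; rewrite -EFinM -EFinD.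
move=> [cE]; rewrite -EFinM; congr EFin.
have a10 : (1 - a != 0)%R by rewrite gt_eqF// subr_gt0.
by apply: (mulfI a10); rewrite mulrA divff// mul1r mulrBl mul1r {1}cE addrK.
Qed.

Let rP_lt1 z : (0 <= r * P delta z z < 1)%R.
Proof.
case/andP: r01 => _ r1; rewrite mulr_ge0//= (le_lt_trans _ r1)//.
by rewrite ler_piMr// transition_le1.
Qed.

Lemma change_gen0E z :
  change_gen 0 z = ((1 - r * P delta z z)^-1 * (x == z)%:R)%:E.
Proof.
by rewrite EFinM; apply: fixpoint_solve;
  [exact: change_gen_fin_num|exact: rP_lt1|exact: change_gen0].
Qed.

Lemma change_genSE n z :
  change_gen n.+1 z = ((1 - r * P delta z z)^-1)%:E * arrival_gen n z.
Proof.
by apply: fixpoint_solve;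
  [exact: change_gen_fin_num|exact: rP_lt1|exact: change_genS].
Qed.

(* Makes the discrete clock comparable to the jump times, so that non-explosion
   controls the mass of [jump_green n] for large [n]. *)
Lemma changes_jump_time om k n :
  (n <= changes (skeleton om) k)%N -> jump_time X n om <= (k%:R * delta)%:E.
Proof.
elim: k n => [|k IH] n.
  by rewrite /changes big_ord0 leqn0 => /eqP -> /=; rewrite mul0r.
have kk1 : (k%:R * delta <= k.+1%:R * delta)%R by rewrite ler_pM2r// ler_nat.
rewrite changesS; have [/IH h _|kn] := leqP n (changes (skeleton om) k).
  by apply: le_trans h _; rewrite lee_fin.
case: eqVneq => [_|kk']; rewrite /= ?addn0 ?addn1.
  by move=> /(leq_trans kn); rewrite ltnn.
case: n kn => [//|n] kn; rewrite ltnS => /IH.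
(* A time after the n-th jump is wanted at which the state differs from the one at that jump. If the
   jump came before the grid time k, either step k itself already differs, or it agrees and then
   step k + 1 differs. If the jump falls exactly on grid time k, step k + 1 serves. *)
have [e|e|e] := ltgtP (jump_time X n om) (k%:R * delta)%:E => // _ /=.
  have [kE|kN] := eqVneq (skeleton om k) (X (fine (jump_time X n om)) om).
    apply: ereal_inf_lbound => /=; exists (k.+1%:R * delta)%R => //.
    split; first by rewrite (lt_le_trans e)// lee_fin.
    by move=> h; move/eqP: kk'; apply; rewrite kE -h.
  apply: (@le_trans _ _ (k%:R * delta)%:E); last by rewrite lee_fin.
  by apply: ereal_inf_lbound => /=; exists (k%:R * delta)%R => //; split=> //; exact/eqP.
apply: ereal_inf_lbound => /=; exists (k.+1%:R * delta)%R => //.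
split; first by rewrite e lte_fin ltr_pM2r// ltr_nat.
by rewrite e /= => h; move/eqP: kk'; apply; rewrite /skeleton -h.
Qed.

(** The left side is the mean of r to the power of the step of the (n+1)-st change. The events [B k]
    that this is step k + 1 are disjoint; late steps have weight at most [b], and for early steps
    the event lies in [D]. *)
Lemma arrival_gen_bound n (D : set T) (b : R) : measurable D -> (0 <= b)%R ->
  (forall k, (r ^+ k.+1 <= b)%R \/
    [set om | (n < changes (skeleton om) k.+1)%N] `<=` D) ->
  \esum_(z in [set: I]) arrival_gen n z <= Pr x D + b%:E.
Proof.
move=> mD b0 hD.
pose B k : set T :=
  [set om | changes (skeleton om) k = n /\ changes (skeleton om) k.+1 = n.+1].
have mB k : measurable (B k).
  apply: (@adapted_measurable k.+1
    ([set f | changes f k = n] `&` [set f | changes f k.+1 = n.+1])).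
  apply: adaptedI; last exact: adapted_changes.
  by apply: (@adaptedW k) => //; exact: adapted_changes.
have tB : trivIset setT B.
  apply/ltn_trivIset => j i ij; apply/seteqP; split => // om [[iE iE'] [jE jE']].
  have mono l : (changes (skeleton om) i.+1 <= changes (skeleton om) (i.+1 + l))%N.
    elim: l => [|l IH]; first by rewrite addn0.
    by rewrite addnS (changesS _ (i.+1 + l)) (leq_trans IH)// leq_addr.
  have := mono (j - i.+1)%N; rewrite subnKC// iE'.
  by rewrite -jE ltnn.
have arrE k : \esum_(z in [set: I]) arrival_prob k n z = Pr x (B k).
  transitivity (\esum_(z in [set: I]) Pr x [set om |
      (changes (skeleton om) k = n /\ [set y | y != z] (skeleton om k)) /\
      skeleton om k.+1 = z]).
    apply: eq_esum => z _.
    rewrite (@skeleton_step_sum k [set f | changes f k = n] [set y | y != z])//.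
    exact: adapted_changes.
  rewrite -measure_bigcup_countable; last 2 first.
  - move=> z _; apply: (@adapted_measurable k.+1
      (([set f | changes f k = n] `&` [set f | f k != z]) `&` [set f | f k.+1 = z])).
    apply: adaptedI; last exact: (@adapted_at _ _ [set z]).
    apply: adaptedI; last exact: (@adapted_at _ _ [set y | y != z]).
    by apply: (@adaptedW k) => //; exact: adapted_changes.
  - by move=> z z' _ _ [om [[_ e1] [_ e2]]]; rewrite -e1 -e2.
  congr (Pr x _); apply/seteqP; split => om.
    by move=> [z _ [[kn kz] k1z]]; split => //; rewrite changesS kn k1z kz addn1.
  move=> [kn]; rewrite changesS kn => h; exists (skeleton om k.+1) => //=.
  by split => //; split => //; move: h; case: eqP => //=; rewrite addn0 => _ /n_Sn.
rewrite esum_exchange_in; last first.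
  by move=> z k; rewrite mule_ge0 ?arrival_prob_ge0// lee_fin exprn_ge0.
apply: (@le_trans _ _ (\esum_(k in [set: nat])
    (Pr x (B k `&` D) + b%:E * Pr x (B k)))).
  apply: le_esum => k _; rewrite ge0_esumZl; last 2 first.
  - by rewrite lee_fin exprn_ge0.
  - by move=> z _; exact: arrival_prob_ge0.
  rewrite arrE; case: (hD k) => [rb|BD].
    apply: (@le_trans _ _ (b%:E * Pr x (B k))); last exact: leeDr.
    by rewrite lee_wpmul2r// lee_fin.
  have -> : B k `&` D = B k by apply/setIidl => om [_ h]; apply: BD; rewrite /= h.
  rewrite -[leLHS]adde0 leeD//; last by rewrite mule_ge0.
  rewrite -[leRHS]mul1e lee_wpmul2r// lee_fin.
  by case/andP: r01 => _ /ltW r1; rewrite exprn_ile1.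
rewrite esumD//; last by move=> k _; rewrite mule_ge0.
rewrite leeD//.
  rewrite -measure_bigcup_countable; last 2 first.
  - by move=> k _; exact: measurableI.
  - by move=> i j _ _ [om [[iB _] [jB _]]]; apply: tB => //; exists om.
  rewrite le_measure ?inE//; last by move=> om [k _ []].
  by apply: bigcup_countable_measurable => k _; exact: measurableI.
rewrite ge0_esumZl// -measure_bigcup_countable//.
rewrite -[leRHS]mule1 lee_wpmul2l// probability_le1//.
exact: bigcup_countable_measurable.
Qed.

(** Mirrors the restriction t > eta_1 in the return time: a departure must have been seen first. It
    is measured from [f 0] and not from [x], so that [return_at_time] holds for every path and not
    just almost surely. *)
Definition return_at (f : nat -> I) j :=
  (exists2 i, (i < j)%N & f i <> f 0%N) /\ f j = x.

Definition first_return_at (f : nat -> I) j :=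
  return_at f j /\ (forall l, (l < j)%N -> ~ return_at f l).

Lemma return_at_first f j : return_at f j ->
  exists2 i, (i <= j)%N & first_return_at f i.
Proof.
elim/ltn_ind: j => j IH fj.
have [[l lj fl]|nl] := pselect (exists2 l, (l < j)%N & return_at f l).
  by have [i il fi] := IH l lj fl; exists i => //; rewrite (leq_trans il)// ltnW.
by exists j => //; split => // l lj fl; apply: nl; exists l.
Qed.

Lemma first_return_at_inj f i j :
  first_return_at f i -> first_return_at f j -> i = j.
Proof.
move=> [fi hi] [fj hj]; case: (ltngtP i j) => // [ij|ji].
  by have := hj _ ij fi.
by have := hi _ ji fj.
Qed.

Lemma adapted_first_return j : adapted j [set f | first_return_at f j].
Proof.
have ret l f g : (forall i, (i <= l)%N -> f i = g i) -> return_at f l -> return_at g l.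
  move=> fg [[i il fi] fl]; split; last by rewrite -fg.
  by exists i => //; rewrite -!fg// ltnW.
move=> f g fg [fj hj]; split; first exact: ret fj.
move=> l lj gl; apply: (hj l lj); apply: ret gl => i il.
by rewrite fg// (leq_trans il)// ltnW.
Qed.

Lemma changes_eq0 f k : changes f k = 0%N <-> (forall i, (i <= k)%N -> f i = f 0%N).
Proof.
elim: k => [|k IH]; first by split => [_ i|_]; rewrite ?leqn0 ?/changes ?big_ord0// => /eqP ->.
rewrite changesS; split.
  move=> /eqP; rewrite addn_eq0 eqb0 negbK => /andP[/eqP/IH h /eqP fk] i.
  by rewrite leq_eqVlt => /orP[/eqP ->|/h//]; rewrite -fk h.
move=> h; have /IH -> : forall i, (i <= k)%N -> f i = f 0%N.
  by move=> i ik; apply: h; exact: leqW.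
by rewrite (h k)// (h k.+1)// eqxx.
Qed.

Definition return_prob j : \bar R :=
  Pr x [set om | first_return_at (skeleton om) j].

Let occ k : \bar R := Pr x [set om | skeleton om k = x].

Let measurable_first_return j : measurable [set om | first_return_at (skeleton om) j].
Proof.
by apply: (@adapted_measurable j [set f | first_return_at f j]); exact: adapted_first_return.
Qed.

Let measurable_at k y : measurable [set om | skeleton om k = y].
Proof.
by apply: (@adapted_measurable k [set f | f k = y]); exact: (@adapted_at _ _ [set y]).
Qed.

Let occE k : occ k = (P (k%:R * delta) x x)%:E.
Proof.
have start1 : Pr x [set om | skeleton om 0 = x] = 1.
  by rewrite -(chain_start hX x); congr (Pr x _); rewrite /skeleton mul0r.
case: k => [|k]; first by rewrite mul0r (transition0 hP) eqxx.
have k0 : (0 < k.+1%:R * delta)%R by rewrite mulr_gt0.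
have adT : adapted 0 [set: nat -> I] by [].
have := adapted_markov x x adT k0.
have -> : [set om | [set: nat -> I] (skeleton om) /\ skeleton om 0 = x] =
    [set om | skeleton om 0 = x] by apply/seteqP; split => om //= [].
by rewrite start1 mul1e mul0r add0r => <-; rewrite /occ measure_start// setIC.
Qed.

(** The strong Markov property at the first return, reduced to the Markov property at the fixed time
    j because the first return at j depends on the steps up to j only. The case j = k is separate,
    as [adapted_markov] needs a positive time. *)
Let first_return_occ j k : (j <= k)%N ->
  Pr x [set om | first_return_at (skeleton om) j /\ skeleton om k = x] =
  return_prob j * occ (k - j).
Proof.
move=> jk.
have -> : return_prob j =
    Pr x [set om | first_return_at (skeleton om) j /\ skeleton om j = x].
  by congr (Pr x _); apply/seteqP; split => om /=; [move=> h; split => //; case: h => -[]|case].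
move: jk; rewrite leq_eqVlt => /orP[/eqP ->|jk].
  by rewrite subnn occE mul0r (transition0 hP) eqxx mule1.
have t0 : (0 < (k - j)%:R * delta)%R by rewrite mulr_gt0// ltr0n subn_gt0.
rewrite occE -(adapted_markov _ _ (@adapted_first_return j) t0).
rewrite -mulrDl -natrD subnKC ?(ltnW jk)//; congr (Pr x _).
by apply/seteqP; split => om /= => [[h hk]|[[]]//]; split => //; split => //; case: h => -[].
Qed.

(** A path started at [x] and found there at step k has either shown no change up to then or made
    its first return at exactly one j <= k. *)
Lemma occ_decomposition k : occ k =
  change_prob k 0 x + \esum_(j in [set j | (j <= k)%N]) (return_prob j * occ (k - j)).
Proof.
pose A0 : set T := [set om | changes (skeleton om) k = 0%N /\ skeleton om k = x].
pose A1 : set T := \bigcup_(j in [set j | (j <= k)%N])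
  [set om | first_return_at (skeleton om) j /\ skeleton om k = x].
have mA0 : measurable A0.
  apply: (@adapted_measurable k ([set f | changes f k = 0%N] `&` [set f | f k = x])).
  by apply: adaptedI; [exact: adapted_changes|exact: (@adapted_at _ _ [set x])].
have mF j : measurable [set om | first_return_at (skeleton om) j /\ skeleton om k = x].
  exact: (measurableI _ _ (measurable_first_return j) (measurable_at k x)).
have mA1 : measurable A1 by exact: bigcup_countable_measurable.
transitivity (Pr x (A0 `|` A1)); last first.
  rewrite measureU//; last first.
    apply/seteqP; split => // om [[/changes_eq0 h _] [j jk [[[[i ij fi] _] _] _]]].
    by apply: fi; apply: h; rewrite (leq_trans (ltnW ij)).
  congr (_ + _); rewrite [LHS](_ : _ = Pr x A1)// /A1 measure_bigcup_countable//.
    by apply: eq_esum => j /first_return_occ.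
  by move=> i j _ _ [om [[fi _] [fj _]]]; exact: first_return_at_inj fi fj.
rewrite /occ measure_start// [RHS]measure_start//; last exact: measurableU.
congr (Pr x _); apply/seteqP; split => om [/= h h0]; split => //; last first.
  by case: h => [[]|[j _ []]].
have [k0|kn] := pselect (forall i, (i <= k)%N -> skeleton om i = skeleton om 0%N).
  by left; split => //; apply/changes_eq0.
right; suff /return_at_first[j jk fj] : return_at (skeleton om) k by exists j.
split => //; apply: contrapT => nex; apply: kn => i.
rewrite leq_eqVlt => /orP[/eqP ->|ik]; first by rewrite h h0.
by apply: contrapT => fi; apply: nex; exists i.
Qed.

Definition return_gen : \bar R :=
  \esum_(j in [set: nat]) ((r ^+ j)%:E * return_prob j).

(** Summing out the number of changes leaves the sum of r^k P_xx(k delta): the resolvent of the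
    skeleton at (x, x), see [occupation_genE]. *)
Definition occupation_gen : \bar R :=
  \esum_(n in [set: nat]) change_gen n x.

Lemma return_prob_ge0 j : 0 <= return_prob j. Proof. exact: measure_ge0. Qed.

Lemma return_gen_ge0 : 0 <= return_gen.
Proof. by apply: esum_ge0 => j _; rewrite mule_ge0 ?return_prob_ge0. Qed.

Lemma occupation_gen_ge0 : 0 <= occupation_gen.
Proof. by apply: esum_ge0 => j _; rewrite change_gen_ge0. Qed.

Lemma return_gen_le1 : return_gen <= 1.
Proof.
apply: (@le_trans _ _ (\esum_(j in [set: nat]) return_prob j)).
  apply: le_esum => j _; rewrite -[leRHS]mul1e lee_wpmul2r ?return_prob_ge0//.
  by rewrite lee_fin; case/andP: r01 => _ /ltW r1; rewrite exprn_ile1.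
rewrite -measure_bigcup_countable//; last first.
  by move=> i j _ _ [om [fi fj]]; exact: first_return_at_inj fi fj.
by rewrite probability_le1//; exact: bigcup_countable_measurable.
Qed.

Let occupation_genE : occupation_gen = \esum_(k in [set: nat]) ((r ^+ k)%:E * occ k).
Proof.
rewrite /occupation_gen /change_gen esum_exchange_in; last first.
  by move=> n k; rewrite mule_ge0 ?change_prob_ge0.
apply: eq_esum => k _; rewrite ge0_esumZl//.
congr (_ * _); rewrite /change_prob -measure_bigcup_countable.
- congr (Pr x _); apply/seteqP; split => om /=; first by move=> [n _ []].
  by move=> kx; exists (changes (skeleton om) k).
- move=> n _; apply: (@adapted_measurable k ([set f | changes f k = n] `&` [set f | f k = x])).
  by apply: adaptedI; [exact: adapted_changes|exact: (@adapted_at _ _ [set x])].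
- by move=> m n _ _ [om [[<- _] [<- _]]].
Qed.

(** The convolution in [occ_decomposition] becomes a product after exchanging the sums over j <= k
    and substituting k = j + i. *)
Lemma occupation_gen_renewal :
  occupation_gen = change_gen 0 x + return_gen * occupation_gen.
Proof.
rewrite {1}occupation_genE.
transitivity (\esum_(k in [set: nat]) ((r ^+ k)%:E * change_prob k 0 x +
   \esum_(j in [set j | (j <= k)%N])
     ((r ^+ k)%:E * (return_prob j * occ (k - j))))).
  apply: eq_esum => k _; rewrite occ_decomposition ge0_muleDr ?change_prob_ge0//.
    by rewrite ge0_esumZl// => j _; rewrite mule_ge0 ?return_prob_ge0.
  by apply: esum_ge0 => j _; rewrite mule_ge0 ?return_prob_ge0.
have t0 k j : 0 <= (r ^+ k)%:E * (return_prob j * occ (k - j)).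
  by rewrite !mule_ge0 ?return_prob_ge0.
rewrite esumD; last 2 first.
- by move=> k _; rewrite mule_ge0 ?change_prob_ge0.
- by move=> k _; exact: esum_ge0.
congr (_ + _).
rewrite (@esum_exchange _ _ _ (fun k j => (r ^+ k)%:E * (return_prob j * occ (k - j)))
  (fun k j => (j <= k)%N))//.
rewrite /return_gen -ge0_esumZr ?occupation_gen_ge0//; last first.
  by move=> j _; rewrite mule_ge0 ?return_prob_ge0.
apply: eq_esum => j _; rewrite occupation_genE -ge0_esumZl; last 2 first.
- by rewrite mule_ge0 ?return_prob_ge0.
- by move=> k _; rewrite mule_ge0.
rewrite (reindex_esum [set: nat] _ (addn j))//.
  by apply: eq_esum => i _; rewrite addKn exprD EFinM muleACA.
split => //=.
- by move=> i _ /=; rewrite leq_addr.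
- by move=> i1 i2 _ _ /addnI.
- by move=> k jk; exists (k - j)%N => //; rewrite subnKC.
Qed.

(** Exact discrete form of the resolvent identity of the overview. The renewal equation can be
    solved because the occupation is bounded by the total mass 1 / (1 - r). *)
Lemma occupation_genV : occupation_gen \is a fin_num /\
  ((1 - r * P delta x x) * (1 - fine return_gen) * fine occupation_gen = 1)%R.
Proof.
have Gfin : occupation_gen \is a fin_num.
  rewrite ge0_fin_numE ?occupation_gen_ge0//.
  apply: (@le_lt_trans _ _ ((1 - r)^-1)%:E); last exact: ltry.
  rewrite -change_gen_total; apply: le_esum => n _.
  by apply: (@le_esum1 _ _ _ (change_gen n)) => // z' _; exact: change_gen_ge0.
have Ffin : return_gen \is a fin_num.
  by rewrite ge0_fin_numE ?return_gen_ge0// (le_lt_trans return_gen_le1) ?ltry.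
split => //.
have := occupation_gen_renewal; rewrite change_gen0E eqxx mulr1.
rewrite -[return_gen]fineK// -[occupation_gen]fineK// -EFinM -EFinD => -[/= h].
have /andP[_ rP] := rP_lt1 x.
have FG : ((1 - fine return_gen) * fine occupation_gen =
    (1 - r * P delta x x)^-1)%R by rewrite mulrBl mul1r {1}h addrK.
by rewrite -mulrA FG divff// gt_eqF// subr_gt0.
Qed.

Lemma return_at_time om j :
  return_at (skeleton om) j -> return_time X x om <= (j%:R * delta)%:E.
Proof.
move=> [[i ij fi] fj].
have h1 : (1 <= changes (skeleton om) i)%N.
  rewrite lt0n; apply/negP => /eqP/changes_eq0 h; apply: fi; exact: h.
have h2 := changes_jump_time h1.
apply: ereal_inf_lbound => /=; exists (j%:R * delta)%R => //; split => //.
by apply: (le_lt_trans h2); rewrite lte_fin ltr_pM2r// ltr_nat.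
Qed.

End GeneratingFunctions.

End Skeleton.

(** * Vanishing mesh *)

Section EventualLowerBounds.
Context {R : realType}.
Local Open Scope ereal_scope.

(* Lower bounds for the inferior limit are enough: by [change_gen_total] the
   total mass converges, so no limit can be strictly larger. *)
Definition eventually_ge (u : nat -> \bar R) (a : R) : Prop :=
  forall e : R, (0 < e)%R -> \forall N \near \oo, (a - e)%:E <= u N.

Lemma eventually_ge_sum (J : Type) (s : seq J) (u : nat -> J -> \bar R) (a : J -> R) :
  (forall j, eventually_ge (u^~ j) (a j)) ->
  eventually_ge (fun N => \sum_(j <- s) u N j) (\sum_(j <- s) a j)%R.
Proof.
move=> h; elim: s => [|j s IH] e e0.
  by apply: nearW => N; rewrite !big_nil lee_fin; lra.
have e2 : (0 < e / 2)%R by rewrite divr_gt0.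
apply: filterS2 (h j _ e2) (IH _ e2) => N h1 h2; rewrite !big_cons.
have -> : (a j + \sum_(i <- s) a i - e =
    (a j - e / 2) + (\sum_(i <- s) a i - e / 2))%R by lra.
by rewrite EFinD leeD.
Qed.

Lemma eventually_ge_le (u v : nat -> \bar R) (a : R) :
  (forall N, u N <= v N) -> eventually_ge u a -> eventually_ge v a.
Proof. by move=> uv h e e0; apply: filterS (h e e0) => N /le_trans; exact. Qed.

Lemma eventually_ge_mul (v : nat -> R) (u : nat -> \bar R) (a b : R) :
  (0 <= a)%R -> (forall N, 0 <= v N)%R -> (forall N, 0 <= u N) ->
  v @ \oo --> b -> eventually_ge u a ->
  eventually_ge (fun N => (v N)%:E * u N) (b * a).
Proof.
move=> a0 v0 u0 vb ua.
(* [u N] may be infinite or far above [a]; its minimum with [a] is finite and converges to [a], so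
   the usual product rule for limits applies. *)
pose w N := fine (Order.min (u N) a%:E).
have wfin N : Order.min (u N) a%:E \is a fin_num.
  rewrite ge0_fin_numE; first by rewrite gt_min ltry orbT.
  by rewrite le_min u0 lee_fin.
have wa : w @ \oo --> a.
  apply/cvgrPdist_le => e e0; apply: filterS (ua e e0) => N h.
  have wle : (w N <= a)%R by rewrite -lee_fin fineK// ge_min lexx orbT.
  rewrite ger0_norm ?subr_ge0// lerBlDr -lerBlDl.
  by rewrite -lee_fin fineK// le_min h lee_fin; lra.
have vw : (fun N => v N * w N)%R @ \oo --> (b * a)%R by exact: cvgM.
move=> e e0; move/cvgrPdist_le : vw => /(_ e e0); apply: filterS => N.
rewrite ler_norml => /andP[_ h].
apply: (@le_trans _ _ (v N * w N)%:E); first by rewrite lee_fin; lra.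
rewrite EFinM lee_wpmul2l ?lee_fin//= fineK//.
by rewrite ge_min lexx.
Qed.

(** Fatou's lemma for sums: a finite part of the limiting sum exceeds s - e / 2, and on a finite set
    the lower bounds add up. Terms outside [D] are masked by 0 because nothing is known about
    them. *)
Lemma eventually_ge_esum (J : choiceType) (D : set J) (u : nat -> J -> \bar R)
    (a : J -> R) (s : R) :
  (forall N j, 0 <= u N j) -> (forall j, D j -> eventually_ge (u^~ j) (a j)) ->
  s%:E <= \esum_(j in D) (a j)%:E ->
  eventually_ge (fun N => \esum_(j in D) u N j) s.
Proof.
move=> u0 h hs e e0; have e2 : (0 < e / 2)%R by rewrite divr_gt0.
have /ereal_sup_gt[_ [X [finX XD] <-]] :
    (s - e / 2)%:E < \esum_(j in D) (a j)%:E.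
  by apply: lt_le_trans hs; rewrite lte_fin; lra.
rewrite fsbig_finite//= => hX.
pose a' j := if j \in D then a j else 0%R.
pose u' N j := if j \in D then u N j else 0.
have h' j : eventually_ge (u'^~ j) (a' j).
  rewrite /u' /a'; case: ifPn => [/set_mem/h//|_] e' e'0.
  by apply: nearW => N; rewrite lee_fin; lra.
have := @eventually_ge_sum _ (fset_set X) u' a' h' _ e2; apply: filterS => N hN.
apply: (@le_trans _ _ (\sum_(j <- fset_set X) u' N j)).
  apply: le_trans hN; rewrite lee_fin.
  have -> : (\sum_(j <- fset_set X) a' j = \sum_(j <- fset_set X) a j)%R.
    rewrite big_seq [RHS]big_seq; apply: eq_bigr => j.
    by rewrite in_fset_set// => /set_mem/XD Dj; rewrite /a' mem_set.
  move: hX; rewrite sumEFin lte_fin => ?; lra.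
rewrite (esum_mkcond D); apply: lee_sum_esum => //.
Qed.

Lemma eventually_ge_lim (u : nat -> \bar R) (v : nat -> R) (a b : R) :
  eventually_ge u a -> (forall N, u N <= (v N)%:E) -> v @ \oo --> b -> (a <= b)%R.
Proof.
move=> ua uv vb; apply/ler_addgt0Pr => e e0.
have e2 : (0 < e / 2)%R by rewrite divr_gt0.
move/cvgrPdist_le : vb => /(_ _ e2) vb.
have [N [h1 h2]] := @filter_ex _ \oo _ _ (filterI (ua _ e2) vb).
have := le_trans h1 (uv N); rewrite lee_fin => h3.
by move: h2 => /=; rewrite ler_norml => /andP[h4 _]; lra.
Qed.

End EventualLowerBounds.

(** * Fine grids detect the returns of a right-continuous path *)

Section PathwiseReturn.
Context {R : realType} {I : countType} {d : measure_display}
  {T : measurableType d}.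
Variables (P : R -> I -> I -> R) (Pr : I -> probability T R) (X : R -> T -> I).
Hypothesis hX : markov_chain P Pr X.

Let right_constant om (t : R) : 0 <= t ->
  exists2 e, 0 < e & forall u, t < u -> u < t + e -> X u om = X t om.
Proof.
move=> t0; have [e /= e0 he] := chain_right_continuous hX om t0.
exists e => // u tu ute; apply: he => //=.
by rewrite distrC ger0_norm ?subr_ge0 1?ltW// ltrBlDl.
Qed.

Let grid_point (s delta : R) : 0 <= s -> 0 < delta ->
  exists2 i, s < i%:R * delta & i%:R * delta <= s + delta.
Proof.
move=> s0 d0; have sd : 0 <= s / delta by rewrite divr_ge0// ltW.
have /andP[h1 h2] := truncn_itv sd.
exists (Num.truncn (s / delta)).+1; first by rewrite -ltr_pdivrMr.
by rewrite -natr1 mulrDl mul1r lerD2r -ler_pdivlMr.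
Qed.

(** Take a departure time s and a return time t with s < t < a. By right continuity the path is
    constant just after s and just after t; a mesh below these two lengths and below t - s and a - t
    puts a grid point into each interval, in the right order and before a. *)
Lemma return_at_exists x om (a : R) (dl : nat -> R) :
  (forall N, 0 < dl N) -> dl @ \oo --> 0 ->
  (return_time X x om < a%:E)%E ->
  \forall N \near \oo, exists2 j, j%:R * dl N < a &
    return_at x (skeleton X (dl N) om) j.
Proof.
move=> dl0 dlc /ereal_inf_lt[_ [t [jt Xt] <-]]; rewrite lte_fin => ta.
have /ereal_inf_lt[_ [s [/= s0 Xs] <-]] := jt; rewrite lte_fin => st.
rewrite lte_fin in s0.
have [e1 e10 h1] := right_constant om (ltW s0).
have [e2 e20 h2] := right_constant om (ltW (lt_trans s0 st)).
pose e := Num.min (Num.min e1 (t - s)) (Num.min e2 (a - t)).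
have e0 : 0 < e by rewrite /e !lt_min e10 e20 !subr_gt0 st ta.
move/cvgrPdist_lt : dlc => /(_ e e0); apply: filterS => N.
rewrite sub0r normrN gtr0_norm// /e !lt_min => /andP[/andP[d1 d2] /andP[d3 d4]].
have [i si is_] := grid_point (ltW s0) (dl0 N).
have [j tj jt_] := grid_point (ltW (lt_trans s0 st)) (dl0 N).
exists j; first by rewrite (le_lt_trans jt_)//; lra.
split; last by rewrite /skeleton h2//; lra.
exists i; last by rewrite /skeleton mul0r h1//; lra.
by rewrite -(ltr_nat R) -(ltr_pM2r (dl0 N)); lra.
Qed.

End PathwiseReturn.

(** * Limit of the skeletons and identification of the resolvent *)

Section SkeletonLimit.
Context {R : realType} {I : countType} {d : measure_display}
  {T : measurableType d}.
Variables (P : R -> I -> I -> R) (q : I -> I -> R) (Pr : I -> probability T R)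
  (X : R -> T -> I).
Hypothesis hP : honest_standard_transition_function P.
Hypothesis hq : is_Qmatrix P q.
Hypothesis hreg : regular_Qmatrix q.
Hypothesis hX : markov_chain P Pr X.
Hypothesis hne : non_explosive Pr X.
Variables (x : I) (lam : R).
Hypothesis lam_gt0 : 0 < lam.

Definition mesh (N : nat) : R := 2^-1 ^+ N.

Let dl := mesh.
Let r N := expR (- (lam * dl N)).

Lemma mesh_gt0 N : 0 < mesh N.
Proof. by rewrite exprn_gt0// invr_gt0. Qed.

Lemma mesh_cvg0 : mesh @ \oo --> 0.
Proof. by apply: cvg_expr; rewrite ger0_norm ?invr_ge0// invf_lt1// ltr1n. Qed.

Let dl0 := mesh_gt0.

Let mesh_right (f : R -> R) (l : R) : f t @[t --> 0^'+] --> l ->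
  (f \o dl) @ \oo --> l.
Proof. by move/cvg_at_rightP; apply; split => //; exact: mesh_cvg0. Qed.

Let r01 N : 0 < r N < 1.
Proof. by rewrite expR_gt0 expR_lt1 oppr_lt0 mulr_gt0. Qed.

Let cvg_killing : (fun N => (1 - r N) / dl N) @ \oo --> lam.
Proof.
(* Both bounds come from exp(u) >= 1 + u, taken at u = - lam [dl N] and at u = lam [dl N]. *)
apply: (@squeeze_cvgr _ _ _ _ (fun N => lam / (1 + lam * dl N)) (cst lam)).
- apply: nearW => N; apply/andP; split; last first.
    rewrite ler_pdivrMr//; have := expR_ge1Dx (- (lam * dl N)).
    rewrite -/(r N); move: (r N) (lam * dl N) => ? ? ?; lra.
  have u0 : 0 < lam * dl N by rewrite mulr_gt0.
  rewrite ler_pdivlMr// mulrAC ler_pdivrMr ?addr_gt0// [leRHS]mulrC /r expRN.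
  have h := expR_ge1Dx (lam * dl N).
  have e0 : 0 < 1 + lam * dl N by rewrite addr_gt0.
  have : (expR (lam * dl N))^-1 <= (1 + lam * dl N)^-1.
    by rewrite lef_pV2// posrE// expR_gt0.
  rewrite -(ler_pM2l e0) divff ?gt_eqF// => h2.
  rewrite mulrBr mulr1 lerBrDr -lerBrDl addrK.
  exact: h2.
- suff : (fun N => lam / (1 + lam * dl N)) @ \oo --> lam / (1 + lam * 0).
    by rewrite mulr0 addr0 divr1.
  apply: cvgM; first exact: cvg_cst.
  apply: cvgV; first by rewrite mulr0 addr0 oner_neq0.
  by apply: cvgD; [exact: cvg_cst|apply: cvgM; [exact: cvg_cst|exact: mesh_cvg0]].
- exact: cvg_cst.
Qed.

Let cvg_r : r @ \oo --> (1 : R).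
Proof.
have -> : r = (fun N => 1 - (1 - r N) / dl N * dl N).
  by apply/funext => N; rewrite divfK ?gt_eqF// opprB addrC subrK.
suff : (fun N => 1 - (1 - r N) / dl N * dl N) @ \oo --> 1 - lam * 0.
  by rewrite mulr0 subr0.
apply: cvgB; first exact: cvg_cst.
by apply: cvgM; [exact: cvg_killing|exact: mesh_cvg0].
Qed.

Let cvg_offdiag y z : y != z -> (fun N => r N * P (dl N) y z / dl N) @ \oo --> q y z.
Proof.
move=> yz; have := mesh_right (@hq y z); rewrite (negbTE yz) => h.
rewrite -[q y z]mul1r; under eq_fun do rewrite -mulrA.
apply: cvgM; first exact: cvg_r.
by apply: cvg_trans h; apply: near_eq_cvg; apply: nearW => N /=; rewrite subr0.
Qed.

Let cvg_diag z : (fun N => (1 - r N * P (dl N) z z) / dl N) @ \oo --> lam - q z z.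
Proof.
have -> : (fun N => (1 - r N * P (dl N) z z) / dl N) =
   (fun N => (1 - r N) / dl N - r N * ((P (dl N) z z - 1) / dl N)).
  by apply/funext => N; field; rewrite gt_eqF.
apply: cvgB; first exact: cvg_killing.
rewrite -[q z z]mul1r; apply: cvgM; first exact: cvg_r.
by have := mesh_right (@hq z z); rewrite eqxx.
Qed.

Let k_gt0 z : 0 < lam - q z z.
Proof. by rewrite addr_gt0// Qmatrix_diag_lt0. Qed.

Let rP_lt1 N z : 0 < 1 - r N * P (dl N) z z.
Proof.
rewrite subr_gt0; case/andP: (r01 N) => r0 r1; apply: le_lt_trans r1.
by apply: ler_piMr; [exact: ltW|apply: (transition_le1 hP); exact: ltW].
Qed.

Let cvg_diagV z :
  (fun N => dl N / (1 - r N * P (dl N) z z)) @ \oo --> (lam - q z z)^-1.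
Proof.
have -> : (fun N => dl N / (1 - r N * P (dl N) z z)) =
    (fun N => ((1 - r N * P (dl N) z z) / dl N)^-1).
  by apply/funext => N; rewrite invf_div.
by apply: cvgV; [rewrite gt_eqF|exact: cvg_diag].
Qed.

Local Open Scope ereal_scope.

Let H := jump_green q x lam.
Let H_ge0 n z : 0 <= H n z. Proof. exact: jump_green_ge0. Qed.
Let H_fin n z : H n z \is a fin_num. Proof. exact: jump_green_fin_num. Qed.
Let G N n z : \bar R := (dl N)%:E * change_gen Pr X x (dl N) (r N) n z.
Let A N n z : \bar R := arrival_gen P Pr X x (dl N) (r N) n z.

Let G_ge0 N n z : 0 <= G N n z.
Proof. by rewrite mule_ge0 ?change_gen_ge0// lee_fin ltW. Qed.

(** For each y the coefficient r P_yz / delta tends to q_yz. No uniformity in y is available, so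
    only the lower bound survives the infinite sum. *)
Let eventually_ge_arrival n :
  (forall y, eventually_ge (fun N => G N n y) (fine (H n y))) ->
  forall z, eventually_ge (fun N => A N n z) (fine ((lam - q z z)%:E * H n.+1 z)).
Proof.
move=> IH z.
have AE N : A N n z = \esum_(y in [set y | y != z])
    ((r N * P (dl N) y z / dl N)%:E * G N n y).
  rewrite /A arrival_genE//; apply: eq_esum => y _.
  by rewrite /G muleA -EFinM divfK ?gt_eqF.
apply: (@eventually_ge_le _ (fun N => \esum_(y in [set y | y != z])
    ((r N * P (dl N) y z / dl N)%:E * G N n y))); first by move=> N; rewrite AE.
have v0 N y : (0 <= r N * P (dl N) y z / dl N)%R.
  rewrite divr_ge0 ?mulr_ge0//; last exact: ltW.
    by case/andP: (r01 N) => /ltW.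
  by rewrite (transition_ge0 hP)// ltW.
apply: (@eventually_ge_esum _ _ _ _ (fun y => q y z * fine (H n y))%R).
- by move=> N y; rewrite mule_ge0// lee_fin.
- move=> y yz; apply: eventually_ge_mul => //; last exact: cvg_offdiag.
  exact: fine_ge0.
- have kfin : (lam - q z z)%:E * H n.+1 z \is a fin_num.
    by apply: fin_numM; [|exact: H_fin].
  rewrite fineK// (@jump_greenS _ _ q x lam hreg lam_gt0 n z).
  apply: le_esum => y _.
  by rewrite muleC EFinM fineK.
Qed.

(** The discrete recursion [change_genSE], [arrival_genE] has coefficients converging to those of
    [jump_green]; the induction carries lower bounds along. *)
Lemma eventually_ge_change_gen n z : eventually_ge (fun N => G N n z) (fine (H n z)).
Proof.
elim: n z => [|n IH] z.
  move=> e e0; have h : (fun N => (dl N / (1 - r N * P (dl N) z z)) * (x == z)%:R)%R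
      @ \oo --> ((lam - q z z)^-1 * (x == z)%:R)%R.
    by apply: cvgM; [exact: cvg_diagV|exact: cvg_cst].
  move/cvgrPdist_le : h => /(_ e e0); apply: filterS => N.
  rewrite ler_norml => /andP[_ h].
  rewrite /G (change_gen0E hP hX)// -EFinM lee_fin /H /=.
  by rewrite mulrA (mulrC (x == z)%:R); lra.
have GE N : G N n.+1 z = (dl N / (1 - r N * P (dl N) z z))%:E * A N n z.
  by rewrite /G (change_genSE hP hX)// muleA -EFinM.
apply: (@eventually_ge_le _ (fun N =>
    (dl N / (1 - r N * P (dl N) z z))%:E * A N n z)); first by move=> N; rewrite GE.
have -> : fine (H n.+1 z) =
    ((lam - q z z)^-1 * fine ((lam - q z z)%:E * H n.+1 z))%R.
  have := H_fin n.+1 z; case: (H n.+1 z) => [h| |]// _ /=.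
  by rewrite mulrA mulVf ?mul1r// gt_eqF.
apply: eventually_ge_mul.
- by apply: fine_ge0; rewrite mule_ge0// lee_fin ltW.
- by move=> N; rewrite divr_ge0// ltW.
- by move=> N; exact: (arrival_gen_ge0 Pr X hP).
- exact: cvg_diagV.
- exact: eventually_ge_arrival.
Qed.

(** A measurable stand-in for the event that the n-th jump occurs by time [a]: a countable union of
    skeleton events contained in that event, and usable for all meshes at once. *)
Let fast (n : nat) (a : R) : set T := \bigcup_N
  \bigcup_(k in [set k | (k%:R * dl N <= a)%R])
    [set om | (n <= changes (skeleton X (dl N) om) k)%N].

Let fast_measurable n a : measurable (fast n a).
Proof.
apply: bigcup_measurable => N _; apply: bigcup_measurable => k _.
have adA : adapted k [set f : nat -> I | (n <= changes f k)%N].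
  by move=> f g fg /=; rewrite (adapted_changes fg (erefl (changes f k))).
exact: (adapted_measurable hX x (dl0 N) adA).
Qed.

Let fast_jump n a om : fast n a om -> jump_time X n om <= a%:E.
Proof.
move=> [N _ [k ka h]]; apply: (le_trans (changes_jump_time (dl0 N) h)).
by rewrite lee_fin.
Qed.

(** The events decrease in n. On their intersection all jump times stay below [a], which is a null
    event by non-explosion; continuity from above concludes. *)
Let fast_cvg0 a (e : R) : (0 < e)%R -> exists n, Pr x (fast n.+1 a) <= e%:E.
Proof.
move=> e0; have mI : measurable (\bigcap_n fast n.+1 a).
  by apply: bigcap_measurable => // n _.
have I0 : Pr x (\bigcap_n fast n.+1 a) = 0.
  have [B [mB B0 hB]] := hne x; apply: (subset_measure0 mI mB _ B0) => om hom.
  apply: hB => /= /cvgeyPge/(_ (a + 1)%R) [n _ /(_ n.+1 (leqnSn n))] /= h.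
  have := le_trans h (fast_jump (hom n Logic.I)).
  by rewrite lee_fin; lra.
have fast_fin : Pr x (fast 1 a) < +oo.
  by rewrite (le_lt_trans (probability_le1 _ _)) ?ltry.
have ni : nonincreasing_seq (fun n => fast n.+1 a).
  move=> m n mn; apply/subsetPset => om [N _ [k ka h]]; exists N => //.
  by exists k => //=; apply: leq_trans h; rewrite ltnS.
have : Pr x \o (fun n => fast n.+1 a) @ \oo --> Pr x (\bigcap_n fast n.+1 a).
  exact: (nonincreasing_cvg_mu fast_fin (fun n => fast_measurable n.+1 a) mI ni).
rewrite I0 => /fine_cvgP[_ /cvgrPdist_le/(_ e e0)] hc.
have [n] := @filter_ex _ \oo _ _ hc.
rewrite /= sub0r normrN ger0_norm ?fine_ge0// => h; exists n.
rewrite -[Pr x _]fineK ?lee_fin//.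
by rewrite ge0_fin_numE// (le_lt_trans (probability_le1 _ _)) ?ltry.
Qed.

(** Either the (n+1)-st change comes before [a], or it is discounted by at least exp(- lam a). The
    bound holds for every skeleton, and each finite part of [jump_mass] is asymptotically below the
    corresponding skeleton sum. *)
Lemma jump_mass_le n a :
  jump_mass q x lam n.+1 <= Pr x (fast n.+1 a) + (expR (- (lam * a)))%:E.
Proof.
have Afin : Pr x (fast n.+1 a) \is a fin_num.
  by rewrite ge0_fin_numE// (le_lt_trans (probability_le1 _ _)) ?ltry.
have bound N : \esum_(z in [set: I]) A N n z <=
    Pr x (fast n.+1 a) + (expR (- (lam * a)))%:E.
  apply: (@arrival_gen_bound _ _ _ _ P Pr X hP hX x _ (dl0 N) _ (r01 N) n _ _
    (fast_measurable n.+1 a) (expR_ge0 _)) => k; have [ka|ak] := leP (k.+1%:R * dl N)%R a.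
    by right => om h; exists N => //; exists k.+1.
  left; rewrite /r -expRM_natl ler_expR mulrN lerN2 mulrCA.
  by rewrite ler_pM2l// ltW.
apply: lee_esum_lim => Z _; rewrite -[Pr x _]fineK//.
have -> : \sum_(z <- Z) (lam - q z z)%:E * jump_green q x lam n.+1 z =
    (\sum_(z <- Z) fine ((lam - q z z)%:E * H n.+1 z))%:E.
  rewrite -sumEFin; apply: eq_bigr => z _; rewrite fineK//.
  by apply: fin_numM; [|exact: H_fin].
rewrite -EFinD lee_fin.
apply: (@eventually_ge_lim _ (fun N => \sum_(z <- Z) A N n z)
  (cst (fine (Pr x (fast n.+1 a)) + expR (- (lam * a))))%R).
- apply: eventually_ge_sum => z; apply: eventually_ge_arrival => y.
  exact: eventually_ge_change_gen.
- move=> N /=; rewrite EFinD fineK//; apply: le_trans (bound N).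
  apply: lee_sum_esum => //.
- exact: cvg_cst.
Qed.

Lemma jump_mass_cvg0 (e : R) : (0 < e)%R -> exists n, jump_mass q x lam n <= e%:E.
Proof.
move=> e0; have e2 : (0 < e / 2)%R by rewrite divr_gt0.
(* Solves exp(- lam a) = e / 2. *)
pose a := (- ln (e / 2) / lam)%R.
have [n hn] := fast_cvg0 a e2.
exists n.+1; apply: (le_trans (jump_mass_le n a)).
rewrite [e]splitr EFinD leeD// lee_fin.
by rewrite /a mulrCA divff ?gt_eqF// mulr1 opprK lnK ?posrE.
Qed.

Let occ N : R := (dl N * fine (occupation_gen Pr X x (dl N) (r N)))%R.

Let occE N : (occ N)%:E = \esum_(n in [set: nat]) G N n x.
Proof.
have [ofin _] := occupation_genV hP hX x (dl0 N) (r01 N).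
rewrite /occ EFinM fineK// /occupation_gen -ge0_esumZl//.
  by rewrite lee_fin ltW.
by move=> n _; exact: change_gen_ge0.
Qed.

(** Conservation of mass: the total discounted time, which tends to 1 / lam, is the time at [x] plus
    the time elsewhere. It turns lower bounds elsewhere into an upper bound at [x]. *)
Let occ_total N : (dl N / (1 - r N))%:E =
  (occ N)%:E + \esum_(n in [set: nat]) \esum_(z in [set z | z != x]) G N n z.
Proof.
have d0 : 0 <= (dl N)%:E by rewrite lee_fin ltW.
rewrite occE -esumD//; last by move=> n _; exact: esum_ge0.
rewrite EFinM -(change_gen_total hX x (dl0 N) (r01 N)) -ge0_esumZl//; last first.
  by move=> n _; apply: esum_ge0 => z _; exact: change_gen_ge0.
apply: eq_esum => n _; rewrite -ge0_esumZl//; last first.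
  by move=> z _; exact: change_gen_ge0.
by rewrite (esum_splitD1 x) => // z; exact: G_ge0.
Qed.

Let cvg_total : (fun N => dl N / (1 - r N))%R @ \oo --> lam^-1%R.
Proof.
have -> : (fun N => dl N / (1 - r N))%R = (fun N => ((1 - r N) / dl N)^-1)%R.
  by apply/funext => N; rewrite invf_div.
by apply: cvgV; [rewrite gt_eqF|exact: cvg_killing].
Qed.

Lemma green_sum_le_occ (gam : R) n : occ @ \oo --> gam ->
  green_sum q x lam n x <= gam%:E.
Proof.
move=> hgam.
have -> : green_sum q x lam n x = (\sum_(i < n) fine (H i x))%:E.
  by rewrite -sumEFin; apply: eq_bigr => i _; rewrite fineK.
rewrite lee_fin -(big_mkord predT (fun i => fine (H i x))).
apply: (@eventually_ge_lim _ (fun N => \sum_(0 <= i < n) G N i x) occ) => //.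
- by apply: eventually_ge_sum => i; exact: eventually_ge_change_gen.
- move=> N; rewrite occE -nneseries_esumT//.
  exact: nneseries_lim_ge.
Qed.

(** Otherwise the Green function has mass at most gam - e at [x]. The lower bounds away from [x],
    subtracted from the total, leave at most 1 / lam - gam for the other states. Its total mass
    would then be below 1 / lam, against the telescoped [jump_mass_killed] and the vanishing of
    [jump_mass]. *)
Lemma green_sum_ge_occ (gam : R) : occ @ \oo --> gam ->
  forall e : R, (0 < e)%R -> exists n, (gam - e)%:E <= green_sum q x lam n x.
Proof.
move=> hgam e e0; apply: contrapT => hn.
have g_le : \esum_(n in [set: nat]) H n x <= (gam - e)%:E.
  rewrite -nneseries_esumT//; apply: lime_le.
    by apply: is_cvg_nneseries => n _ _.
  apply: nearW => n; rewrite big_mkord leNgt; apply/negP => h.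
  by apply: hn; exists n; exact: ltW.
have rest_le : \esum_(n in [set: nat]) \esum_(z in [set z | z != x]) H n z <=
    (lam^-1 - gam)%:E.
  rewrite esum_esum//; apply: lee_esum_lim => Z Zx.
  have -> : \sum_(nz <- Z) H nz.1 nz.2 = (\sum_(nz <- Z) fine (H nz.1 nz.2))%:E.
    by rewrite -sumEFin; apply: eq_bigr => i _; rewrite fineK.
  rewrite lee_fin.
  apply: (@eventually_ge_lim _ (fun N => \sum_(nz <- Z) G N nz.1 nz.2)
    (fun N => dl N / (1 - r N) - occ N)%R).
  - by apply: eventually_ge_sum => nz; exact: eventually_ge_change_gen.
  - move=> N; rewrite EFinB occ_total addeAC subee// add0e esum_esum//.
    exact: lee_sum_esum.
  - by apply: cvgB.
have total : (lam^-1)%:E <= \esum_(n in [set: nat]) \esum_(z in [set: I]) H n z.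
  apply/lee_addgt0Pr => e' e'0.
  have [n hT] := jump_mass_cvg0 (mulr_gt0 lam_gt0 e'0).
  (* The unit mass at the start is either still alive after M jumps or was killed, at rate lam,
     before. *)
  have tele M : jump_mass q x lam M +
      lam%:E * (\sum_(i < M) \esum_(z in [set: I]) H i z) = 1.
    elim: M => [|M IH]; first by rewrite big_ord0 mule0 adde0 jump_mass0.
    rewrite big_ord_recr/= ge0_muleDr; last 2 first.
    - by apply: sume_ge0 => i _; exact: esum_ge0.
    - exact: esum_ge0.
    by rewrite (addeC (_ * \sum_(i < M) _)) addeA -jump_mass_killed.
  have h1 : 1 <= (lam * e')%:E + lam%:E * (\sum_(i < n) \esum_(z in [set: I]) H i z).
    by rewrite -[leLHS](tele n) leeD.
  apply: (@le_trans _ _ ((\sum_(i < n) \esum_(z in [set: I]) H i z) + e'%:E)).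
    rewrite -(@lee_pmul2l _ lam%:E)// ge0_muleDr//.
    - by rewrite -EFinM divff ?gt_eqF// addeC -EFinM.
    - by apply: sume_ge0 => i _; exact: esum_ge0.
    - by rewrite lee_fin ltW.
  rewrite leeD2r// -(big_mkord predT (fun i => \esum_(z in [set: I]) H i z)).
  rewrite -nneseries_esumT; last by move=> *; exact: esum_ge0.
  by apply: nneseries_lim_ge => i _ _; exact: esum_ge0.
have := total; rewrite leNgt => /negP; apply.
apply: (@le_lt_trans _ _ ((gam - e)%:E + (lam^-1 - gam)%:E)); last first.
  by rewrite -EFinD lte_fin; lra.
apply: le_trans (leeD g_le rest_le).
rewrite -esumD//; last by move=> *; exact: esum_ge0.
by apply: le_esum => n _; rewrite (esum_splitD1 x).
Qed.

Let tau : T -> \bar R := return_time X x.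

Lemma return_time_ge0 om : 0 <= tau om.
Proof.
apply: le_ereal_inf_tmp => _ [t [jt _] <-]; apply: le_trans (ltW jt).
by apply: le_ereal_inf_tmp => _ [s [/= s0 _] <-]; exact: (ltW s0).
Qed.

Let return_event N j : set T := [set om | first_return_at x (skeleton X (dl N) om) j].

Let return_event_measurable N j : measurable (return_event N j).
Proof. exact: (adapted_measurable hX x (dl0 N) (adapted_first_return (x:=x) (j:=j))). Qed.

(** The return time is below [a] exactly when some skeleton shows a return before [a]:
    [return_at_exists] gives one direction and [return_at_time] the other. *)
Lemma measurable_return_time : measurable_fun [set: T] tau.
Proof.
move=> mT; apply: (measurability _ (ErealGenInftyO.measurableE R)) => // _ [_ [a ->] <-].
rewrite setTI.
have -> : tau @^-1` `]-oo, a%:E[%classic = \bigcup_N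
    \bigcup_(j in [set j | (j%:R * dl N < a)%R]) return_event N j.
  apply/seteqP; split => om /=.
    rewrite in_itv/= => /(return_at_exists hX dl0 mesh_cvg0) h.
    have [N [j ja /return_at_first[i ij hi]]] := @filter_ex _ \oo _ _ h.
    exists N => //; exists i => //=; apply: le_lt_trans ja.
    by rewrite ler_pM2r// ler_nat.
  move=> [N _ [j /= ja [hj _]]]; rewrite in_itv/=.
  by rewrite (le_lt_trans (return_at_time (dl0 N) hj))// lte_fin.
apply: bigcup_measurable => N _; apply: bigcup_measurable => j _.
exact: return_event_measurable.
Qed.

Definition return_laplace (om : T) : \bar R := expeR (- (lam%:E * tau om)).

(** At most one term is nonzero, so this is exp(- lam s) with s the first return time seen on the
    grid, and 0 if none is seen. *)
Let weight N om : \bar R := \sum_(j <oo) ((r N ^+ j)%:E * (\1_(return_event N j) om)%:E).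

Let term_ge0 N j om : 0 <= (r N ^+ j)%:E * (\1_(return_event N j) om)%:E.
Proof. by rewrite mule_ge0// lee_fin exprn_ge0// expR_ge0. Qed.

Let weight_ge0 N om : 0 <= weight N om.
Proof. exact: nneseries_ge0. Qed.

Let rX N j : (r N ^+ j)%R = expR (- (lam * (j%:R * dl N)))%R.
Proof. by rewrite /r -expRM_natl mulrN mulrCA. Qed.

Let weightE N j om : return_event N j om ->
  weight N om = (expR (- (lam * (j%:R * dl N))))%:E.
Proof.
move=> Ej; rewrite /weight nneseries_esumT// (@esum_delta _ _ _ j)//.
  by rewrite indicE mem_set// mule1 rX.
move=> i ij; rewrite indicE memNset ?mule0// => Ei.
by move/eqP: ij; apply; exact: first_return_at_inj Ei Ej.
Qed.

Let weight0 N om : (forall j, ~ return_event N j om) -> weight N om = 0.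
Proof.
move=> nE; rewrite /weight nneseries_esumT// esum1// => j _.
by rewrite indicE memNset ?mule0.
Qed.

Let laplace_ge (a : R) om : tau om <= a%:E -> (expR (- (lam * a)))%:E <= return_laplace om.
Proof.
move=> h; have -> : (expR (- (lam * a)))%:E = expeR (- (lam * a)%:E) :> \bar R by [].
by rewrite lee_expeR leeN2 EFinM lee_pmul2l.
Qed.

Let weight_le N om : weight N om <= return_laplace om.
Proof.
have [[j Ej]|nE] := pselect (exists j, return_event N j om); last first.
  by rewrite weight0 ?expeR_ge0// => j Ej; apply: nE; exists j.
rewrite (weightE Ej); apply: laplace_ge.
by apply: (return_at_time (dl0 N)); case: Ej.
Qed.

Let laplace_le1 om : return_laplace om <= 1.
Proof.
rewrite -expeR0 lee_expeR leeNl oppe0 mule_ge0 ?return_time_ge0//.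
by rewrite lee_fin ltW.
Qed.

Let laplace_fin om : return_laplace om \is a fin_num.
Proof.
by rewrite ge0_fin_numE ?expeR_ge0// (le_lt_trans (laplace_le1 om)) ?ltry.
Qed.

Let weight_fin N om : weight N om \is a fin_num.
Proof.
rewrite ge0_fin_numE//; apply: (le_lt_trans (weight_le N om)).
by rewrite (le_lt_trans (laplace_le1 om)) ?ltry.
Qed.

Let weight_cvg om : weight ^~ om @ \oo --> return_laplace om.
Proof.
rewrite -[return_laplace om]fineK//; apply/fine_cvgP; split; first exact: nearW.
apply/cvgrPdist_le => e e0.
have near_ge : \forall N \near \oo, (return_laplace om - e%:E <= weight N om).
  rewrite /return_laplace; case tE : (tau om) => [s| |].
  (* A delay by e / lam multiplies the transform by exp(- e) >= 1 - e, which costs at most e. *)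
  - have ea : tau om < (s + e / lam)%:E by rewrite tE lte_fin ltrDl divr_gt0.
    apply: filterS (return_at_exists hX dl0 mesh_cvg0 ea) => N.
    move=> [j ja /return_at_first[i ij hi]]; rewrite (weightE (hi : return_event N i om)).
    rewrite -EFinM/= -EFinB lee_fin.
    apply: (@le_trans _ _ (expR (- (lam * s)) * (1 - e))%R).
      rewrite mulrBr mulr1 lerB//; apply: ler_piMl; first exact: ltW.
      rewrite expR_le1 oppr_le0; apply: mulr_ge0; first exact: ltW.
      by have := return_time_ge0 om; rewrite tE lee_fin.
    apply: (@le_trans _ _ (expR (- (lam * s)) * expR (- e))%R).
      by rewrite ler_wpM2l ?expR_ge0// expR_ge1Dx.
    rewrite -expRD ler_expR -opprD lerN2.
    apply: (@le_trans _ _ (lam * (s + e / lam))%R); last first.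
      by rewrite mulrDr mulrCA divff ?gt_eqF// mulr1.
    rewrite ler_pM2l// ltW//; apply: le_lt_trans ja.
    by rewrite ler_pM2r// ler_nat.
  - have -> : expeR (- (lam%:E * +oo)) = 0 :> \bar R by rewrite gt0_muley ?lte_fin.
    apply: nearW => N; apply: le_trans (weight_ge0 N om).
    by rewrite sub0e lee_fin oppr_le0 ltW.
  - by have := return_time_ge0 om; rewrite tE.
apply: filterS near_ge => N hN.
have h1 := weight_le N om.
have h2 : (fine (weight N om) <= fine (return_laplace om))%R by rewrite fine_le.
rewrite ger0_norm ?subr_ge0//=.
move: hN; rewrite -[weight N om]fineK// -[return_laplace om]fineK//.
by rewrite -EFinB lee_fin/=; lra.
Qed.

Let weight_measurable N : measurable_fun setT (weight N).
Proof.
apply: ge0_emeasurable_sum => [j om _ _|j _]; first exact: term_ge0.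
by apply: measurable_funeM; apply/measurable_EFinP => //; exact: measurable_indic.
Qed.

Lemma measurable_return_laplace : measurable_fun setT return_laplace.
Proof.
by apply: (emeasurable_fun_cvg weight) => // om _; exact: weight_cvg.
Qed.

Let phi : \bar R := \int[Pr x]_om return_laplace om.

Lemma return_laplace_bounds om : 0 <= return_laplace om <= 1.
Proof. by rewrite expeR_ge0 laplace_le1. Qed.

Let return_gen_integral N :
  return_gen Pr X x (dl N) (r N) = \int[Pr x]_om weight N om.
Proof.
rewrite integral_nneseries//; last first.
  by move=> j; apply: measurable_funeM; apply/measurable_EFinP => //; exact: measurable_indic.
rewrite /return_gen -nneseries_esumT; last first.
  by move=> j; rewrite mule_ge0// lee_fin exprn_ge0// expR_ge0.
apply: eq_eseriesr => j _; rewrite ge0_integralZl_EFin//.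
- by rewrite integral_indic// setIT.
- by apply/measurable_EFinP => //; exact: measurable_indic.
- by rewrite exprn_ge0// expR_ge0.
Qed.

Let weight_bound N om : `|weight N om| <= cst 1 om.
Proof.
by rewrite gee0_abs// (le_trans (weight_le N om))// laplace_le1.
Qed.

Lemma return_gen_cvg :
  (fun N => return_gen Pr X x (dl N) (r N)) @ \oo --> phi.
Proof.
have int1 : (Pr x).-integrable setT (cst (1 : \bar R)).
  exact: finite_measure_integrable_cst.
have h1 : {ae Pr x, forall om, setT om -> weight ^~ om @ \oo --> return_laplace om}.
  by apply: aeW => om _; exact: weight_cvg.
have h2 : {ae Pr x, forall om N, setT om -> `|weight N om| <= cst 1 om}.
  by apply: aeW => om N _; exact: weight_bound.
have [_ _] := @dominated_convergence _ _ _ (Pr x) setT measurableT weight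
  return_laplace (cst 1) weight_measurable measurable_return_laplace h1 int1 h2.
by apply: cvg_trans; apply: near_eq_cvg; apply: nearW => N; rewrite /= return_gen_integral.
Qed.

Let phi_bounds : 0 <= phi <= 1.
Proof.
apply/andP; split.
  by apply: integral_ge0 => om _; have /andP[] := return_laplace_bounds om.
rewrite -[leRHS](probability_setT (Pr x)) -[Pr x setT]mul1e -integral_cst//.
apply: ge0_le_integral => //; try exact: measurable_return_laplace.
all: by move=> om _; have /andP[] := return_laplace_bounds om.
Qed.

Let phi_fin : phi \is a fin_num.
Proof.
have /andP[p0 p1] := phi_bounds.
by rewrite ge0_fin_numE// (le_lt_trans p1)// ltry.
Qed.

(** [occupation_genV] makes [occ N] the inverse of [t N], whose limit is explicit. Hence [occ]
    converges, and its limit is the [gam] required by [effective_conductanceE]. *)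
Lemma effective_conductance_return (m : I -> R) : (forall y, 0 < m y)%R ->
  (forall y z, m y * q y z = m z * q z y)%R ->
  effective_conductance q m lam x =
  (m x * ((lam - q x x) * (1 - fine phi)))%:E.
Proof.
move=> m0 mq.
pose t N := ((1 - r N * P (dl N) x x) / dl N * (1 - fine (return_gen Pr X x (dl N) (r N))))%R.
pose tlim := ((lam - q x x) * (1 - fine phi))%R.
have tcvg : t @ \oo --> tlim.
  apply: cvgM; first exact: cvg_diag.
  apply: cvgB; first exact: cvg_cst.
  have := return_gen_cvg; rewrite -[phi]fineK// => /fine_cvgP[_].
  exact.
have occt N : (occ N * t N = 1)%R.
  have [_ <-] := occupation_genV hP hX x (dl0 N) (r01 N).
  by rewrite /occ /t; field; rewrite gt_eqF.
have occ0 N : (0 <= occ N)%R.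
  by rewrite mulr_ge0 ?fine_ge0 ?occupation_gen_ge0// ltW.
have tE N : (occ N = (t N)^-1)%R.
  have tn0 : (t N != 0)%R.
    by apply/eqP => t0; have := occt N; rewrite t0 mulr0 => /eqP; rewrite eq_sym oner_eq0.
  by apply: (mulIf tn0); rewrite occt mulVf.
(* Bounding [occ N] by the total mass bounds [t N] below by a sequence tending to lam; so [tlim > 0]
   and the limit may be inverted. *)
have occ_le N : (occ N <= dl N / (1 - r N))%R.
  rewrite -lee_fin occ_total leeDl// esum_ge0// => n _.
  by apply: esum_ge0 => z _.
have occ_gt0 N : (0 < occ N)%R.
  rewrite lt_neqAle occ0 andbT eq_sym; apply/eqP => o0.
  by have := occt N; rewrite o0 mul0r => /eqP; rewrite eq_sym oner_eq0.
have t_ge N : ((1 - r N) / dl N <= t N)%R.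
  rewrite -[t N]invrK -tE -[leLHS]invrK lef_pV2 ?posrE//.
    by rewrite invf_div.
  by rewrite invr_gt0 divr_gt0// subr_gt0; case/andP: (r01 N).
have tlim0 : (0 < tlim)%R.
  apply: lt_le_trans lam_gt0 _.
  by apply: (ler_cvg_to cvg_killing tcvg); exact: nearW.
have occ_cvg : occ @ \oo --> tlim^-1%R.
  have -> : occ = (fun N => (t N)^-1)%R by apply/funext => N; rewrite tE.
  by apply: cvgV => //; rewrite gt_eqF.
rewrite (effective_conductanceE hreg m0 mq lam_gt0 (gam := tlim^-1)%R).
- by rewrite invrK.
- by move=> n; exact: green_sum_le_occ.
- exact: green_sum_ge_occ.
- exact: jump_mass_cvg0.
Qed.

End SkeletonLimit.

(** * Integrals of nonnegative derivatives *)

Section IncrementIntegral.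
Context {R : realType}.
Local Notation mu := (@lebesgue_measure R).

Lemma right_increment (F : R -> R) (x c : R) :
  derivable F x 1 -> (F^`())%classic x < c ->
  exists2 e, 0 < e & forall h, 0 < h -> h < e -> F (x + h) - F x <= c * h.
Proof.
move=> dF; rewrite derive1E => Fc.
have e0 : 0 < c - 'D_1 F x by rewrite subr_gt0.
have /cvgrPdist_lt/(_ _ e0) := dF.
move=> [e /= e1 he]; exists e => // h h0 h1.
have h0' : h != 0 by rewrite gt_eqF.
have := he h; rewrite /ball_/= sub0r normrN gtr0_norm// => /(_ h1 h0').
rewrite ltr_norml => /andP[+ _]; rewrite /shift /= ltrBrDl [_ *: 1]mulr1.
rewrite ltrBlDr -/(derive F x 1) [ltRHS]addrC subrK /GRing.scale/= => /ltW h2.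
by rewrite -(ler_pM2l (_ : 0 < h^-1)) ?invr_gt0// (addrC x) [leRHS]mulrCA mulVf// mulr1.
Qed.

Local Open Scope ereal_scope.

(* [v] need not be locally bounded or integrable. As in the Vitali-Caratheodory
   theorem, cover each level set [k e <= v < (k+1) e] by an open set of almost
   the same measure; the weighted measures of these open sets below [x] form a
   function [G] growing at least as fast as [F] to the right of every point, and
   the supremum of the points where [F x - F a <= G x] must be [b]. *)
Lemma increment_le_integral (F v : R -> R) (a b : R) : (a <= b)%R ->
  (forall x, (a <= x <= b)%R -> {for x, continuous F}) ->
  (forall x, (a <= x < b)%R -> derivable F x 1 /\ ((F^`())%classic x <= v x)%R) ->
  (forall x, (a <= x <= b)%R -> (0 <= v x)%R) ->
  measurable_fun `[a, b]%classic v ->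
  (F b - F a)%:E <= \int[mu]_(x in `[a, b]) (v x)%:E.
Proof.
move=> ab Fc dF v0 mv; apply/lee_addgt0Pr => eta eta0.
(* The total error is e (b - a) from rounding [v] up to the next level plus 2 e from the open
   covers, that is [eta]. *)
pose e : R := (eta / (b - a + 2))%R.
have ba2 : (0 < b - a + 2)%R by rewrite ltr_pwDr// subr_ge0.
have e0 : (0 < e)%R by rewrite divr_gt0.
have eg0 := ltW e0.
have mab : measurable (`[a, b]%classic : set R) by exact: measurable_itv.
pose A k : set R := `[a, b] `&` (v @^-1` `[k%:R * e, k.+1%:R * e[%classic)%R.
have mA k : measurable (A k) by apply: mv => //; exact: measurable_itv.
have muab : mu `[a, b]%classic = (b - a)%:E.
  rewrite lebesgue_measure_itv/= lte_fin; case: ltP => // ba.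
  have -> : b = a by apply/eqP; rewrite eq_le ab ba.
  by rewrite subrr.
have mule (B C : set R) : measurable B -> measurable C -> B `<=` C -> mu B <= mu C.
  by move=> mB mC BC; rewrite le_measure// inE.
have muAfin k : mu (A k) < +oo.
  apply: (@le_lt_trans _ _ (mu `[a, b]%classic)); last by rewrite muab ltry.
  by apply: mule => //; exact: subIsetl.
pose d (k : nat) : R := (2^-1 ^+ k / k.+1%:R)%R.
have d0 k : (0 < d k)%R by rewrite divr_gt0// exprn_gt0// invr_gt0.
have exU k : exists U, [/\ open U, A k `<=` U & mu (U `\` A k) < (d k)%:E].
  exact: (lebesgue_regularity_outer (mA k) (muAfin k) (d0 k)).
have [U hU] := choice exU.
have openU k : open (U k) by have [] := hU k.
have mU k : measurable (U k) by exact: open_measurable.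
pose G x := \esum_(k in [set: nat]) ((k.+1%:R * e)%:E * mu (U k `&` `[a, x]%classic)).
have c0 k : 0 <= (k.+1%:R * e)%:E by rewrite lee_fin mulr_ge0// ltW.
have mUI k x : measurable (U k `&` `[a, x]%classic).
  by apply: measurableI => //; exact: measurable_itv.
have Ghomo x y : (x <= y)%R -> G x <= G y.
  move=> xy; apply: le_esum => k _; rewrite lee_wpmul2l//.
  apply: mule => //; apply: setIS => z /=; rewrite !in_itv/= => /andP[-> /=].
  by move=> /le_trans; apply.
have cover x : (a <= x <= b)%R -> exists k, A k x.
  move=> xab; have ve : (0 <= v x / e)%R by rewrite divr_ge0 ?v0// ltW.
  have /andP[h1 h2] := truncn_itv ve.
  exists (Num.truncn (v x / e)); split; first by rewrite /= in_itv.
  by rewrite /= in_itv/= -ler_pdivlMr// h1 -ltr_pdivrMr.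
(* If x has level k, take h so small that the increment of [F] is at most (k + 1) e h, that ]x, x +
   h] lies in [U k], and that x + h <= b. The k-th term of [G] alone then gains (k + 1) e h. *)
have extend x : (a <= x < b)%R -> exists2 h : R, (0 < h /\ x + h <= b)%R &
    (F (x + h) - F x)%:E + G x <= G (x + h)%R.
  move=> /andP[ax xb]; have xab : (a <= x <= b)%R by rewrite ax ltW.
  have [k Akx] := cover x xab.
  have vk : (v x < k.+1%:R * e)%R by case: Akx => _; rewrite /= in_itv/= => /andP[].
  
  have [dFx vx] := dF x (introT andP (conj ax xb)).
  have [e1 e10 he1] := right_increment dFx (le_lt_trans vx vk).
  have Ux : U k x.
    by have [_ AU _] := hU k; exact: AU.
  have /nbhs_ballP[e2 /= e20 he2] : nbhs x (U k) by exact: open_nbhs_nbhs.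
  pose h := (Num.min (Num.min e1 e2) (b - x) / 2)%R.
  have min0 : (0 < Num.min (Num.min e1 e2) (b - x))%R.
    by rewrite !lt_min e10 e20 subr_gt0.
  have h0 : (0 < h)%R by rewrite divr_gt0.
  have hg0 := ltW h0.
  have hlt : (h < Num.min (Num.min e1 e2) (b - x))%R.
    by rewrite /h ltr_pdivrMr// ltr_pMr// ltr1n.
  move: hlt; rewrite !lt_min => /andP[/andP[he1' he2'] hb].
  exists h; first by split => //; rewrite -lerBrDl ltW.
  have Fh := he1 h h0 he1'.
  have keh0 : (0 <= k.+1%:R * e * h)%R.
    by apply: mulr_ge0 => //; exact: mulr_ge0.
  apply: (@le_trans _ _ (\esum_(j in [set: nat]) ((k == j)%:R * (k.+1%:R * e * h))%:E + G x)).
    rewrite leeD2r// (@esum_delta _ _ _ k).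
    - by rewrite eqxx mul1r lee_fin.
    - by move=> j jk; rewrite eq_sym (negbTE jk) mul0r.
    - by rewrite eqxx mul1r lee_fin.
  rewrite /G -esumD; last 2 first.
  - by move=> j _; rewrite lee_fin; exact: mulr_ge0.
  - by move=> j _; rewrite mule_ge0.
  apply: le_esum => j _; case: eqVneq => [<-|_]; last first.
    rewrite mul0r add0e lee_wpmul2l//; apply: mule => //.
    apply: setIS => z /=; rewrite !in_itv/= => /andP[-> /= zx].
    by rewrite (le_trans zx)// lerDl ltW.
  rewrite mul1r EFinM -ge0_muleDr//.
  rewrite lee_wpmul2l//.
  have <- : mu `]x, (x + h)%R]%classic = h%:E.
    rewrite lebesgue_measure_itv/= lte_fin ltrDl h0.
    by rewrite -EFinB addrAC subrr add0r.
  have mxh : measurable (`]x, (x + h)%R]%classic : set R) by exact: measurable_itv.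
  have -> : mu `]x, (x + h)%R]%classic + mu (U k `&` `[a, x]%classic) =
      mu (`]x, (x + h)%R]%classic `|` (U k `&` `[a, x]%classic)).
    rewrite measureU//; first exact: mUI.
    apply/seteqP; split => // z [] /=; rewrite !in_itv/= => /andP[xz _] [_ /andP[_ zx]].
    by have := lt_le_trans xz zx; rewrite ltxx.
  apply: mule => //; first exact: measurableU.
  move=> z [|[Uz]] /=; rewrite !in_itv/= => /andP[z1 z2].
    split; last by rewrite (le_trans ax (ltW z1)).
    apply: he2; rewrite /ball/= distrC gtr0_norm ?subr_gt0// ltrBlDl.
    by rewrite (le_lt_trans z2)// ltrD2l.
  by split => //; rewrite z1 (le_trans z2)// lerDl ltW.
have Gb : G b <= \int[mu]_(x in `[a, b]) (v x)%:E + eta%:E.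
  apply: (@le_trans _ _ (\esum_(k in [set: nat])
    ((k%:R * e)%:E * mu (A k) + e%:E * mu (A k) + e%:E * (2^-1 ^+ k)%:E))).
    apply: le_esum => k _.
    have -> : (k%:R * e)%:E * mu (A k) + e%:E * mu (A k) = (k.+1%:R * e)%:E * mu (A k).
      by rewrite -natr1 mulrDl mul1r EFinD ge0_muleDl// lee_fin mulr_ge0.
    have -> : e%:E * (2^-1 ^+ k)%:E = (k.+1%:R * e)%:E * (d k)%:E.
      rewrite -!EFinM /d; congr EFin.
      by rewrite (mulrC _ e) mulrACA divff ?mulr1// pnatr_eq0.
    have dk0 : 0 <= (d k)%:E by rewrite lee_fin ltW.
    rewrite -ge0_muleDr//.
    rewrite lee_wpmul2l//.
    have [_ AU /ltW UA] := hU k.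
    apply: (@le_trans _ _ (mu (U k))); first by apply: mule => //; exact: subIsetl.
    have -> : mu (U k) = mu (U k `\` A k) + mu (U k `&` A k).
      by apply: measureDI; [exact: mU|exact: mA].
    rewrite addeC; apply: leeD; last exact: UA.
    by apply: mule; [exact: measurableI|exact: mA|exact: subIsetr].
  have tA : trivIset setT A.
    move=> i j _ _ [z [[_ /=]]]; rewrite !in_itv/= => /andP[i1 i2] [_ /=].
    rewrite in_itv/= => /andP[j1 j2].
    have := le_lt_trans i1 j2; have := le_lt_trans j1 i2.
    by rewrite !ltr_pM2r// !ltr_nat !ltnS => h1 h2; apply/eqP; rewrite eqn_leq h1 h2.
  have bigA : \bigcup_k A k = `[a, b]%classic.
    apply/seteqP; split => z; first by move=> [k _ []].
    by rewrite /= in_itv/= => /cover[j Aj]; exists j.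
  have s1 k : 0 <= (k%:R * e)%:E * mu (A k).
    by apply: mule_ge0 => //; rewrite lee_fin mulr_ge0.
  have s2 k : 0 <= e%:E * mu (A k) by apply: mule_ge0 => //; rewrite lee_fin.
  have s3 k : 0 <= (2^-1 ^+ k)%:E :> \bar R by rewrite lee_fin exprn_ge0// invr_ge0.
  have s4 k : 0 <= e%:E * (2^-1 ^+ k)%:E by apply: mule_ge0 => //; rewrite lee_fin.
  rewrite esumD//; last by move=> k _; exact: adde_ge0.
  rewrite esumD//.
  have -> : eta%:E = (e * (b - a))%:E + (2 * e)%:E.
    by rewrite -EFinD; congr EFin; rewrite /e; field; rewrite gt_eqF.
  rewrite -addeA; apply: leeD; last apply: leeD.
  - rewrite -[in leRHS]bigA ge0_integral_bigcup//; last 2 first.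
    + by rewrite bigA; exact/measurable_EFinP.
    + by move=> z; rewrite bigA /= in_itv/= lee_fin => /v0.
    rewrite nneseries_esumT; last first.
      by move=> k; apply: integral_ge0 => z [/=]; rewrite in_itv/= lee_fin => /v0.
    apply: le_esum => k _; rewrite -integral_cst; last exact: mA.
    have kv z : A k z -> (k%:R * e)%:E <= (v z)%:E.
      by move=> [_ /=]; rewrite in_itv/= lee_fin => /andP[].
    have mvk : measurable_fun (A k) (EFin \o v).
      by apply/measurable_EFinP; apply: measurable_funS mv => //; exact: subIsetl.
    apply: ge0_le_integral; try exact: mvk; try exact: kv; try exact: mA.
      by move=> z _; rewrite /cst lee_fin mulr_ge0.
    exact: measurable_cst.
  - have muA : \esum_(k in [set: nat]) mu (A k) = mu (\bigcup_k A k).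
      by apply/esym; apply: measure_bigcup_countable => // k _; exact: mA.
    by rewrite ge0_esumZl ?lee_fin// muA bigA muab EFinM.
  - rewrite ge0_esumZl ?lee_fin//.
    rewrite esum_geometric; last by rewrite invr_gt0 ltr0n invf_lt1// ltr1n.
    have -> : (1 - 2^-1 = 2^-1 :> R)%R by lra.
    by rewrite invrK -EFinM lee_fin mulrC.
apply: le_trans Gb.
have Ga0 x : 0 <= G x by apply: esum_ge0 => k _; rewrite mule_ge0.
pose S : set R := [set x | (a <= x <= b)%R /\ (F x - F a)%:E <= G x].
have Sa : S a by split; [rewrite lexx|rewrite subrr].
have supS : has_sup S.
  by split; [exists a|exists b => x [/andP[]]].
pose s := sup S.
have sab : (a <= s <= b)%R.
  apply/andP; split; first exact: (ub_le_sup supS.2).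
  by apply: ge_sup => [|x [/andP[]]//]; exists a.
(* The supremum belongs to [S]: [F] is continuous at s, and [G] is monotone, so [G s] dominates [G]
   at the points of [S] approaching s from the left. *)
have Ss : S s.
  split => //; apply/lee_addgt0Pr => d' d'0.
  have /cvgrPdist_lt/(_ d' d'0) := Fc s sab.
  move=> /nbhs_ballP[r /= r0 hr].
  have [x [xab Sx] xs] := sup_adherent r0 supS.
  have xs' : (x <= s)%R by apply: (ub_le_sup supS.2).
  have := hr x; rewrite /ball/= ger0_norm ?subr_ge0// => /(_ _).
  rewrite ltrBlDr -ltrBlDl -/s => /(_ _) h.
  have {}h : (`|F s - F x| < d')%R by apply: h; move: xs; rewrite -/s; lra.
  have h2 : (F s - F a <= (F x - F a) + d')%R.
    by move: h; rewrite ltr_norml => /andP[_]; lra.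
  apply: (@le_trans _ _ ((F x - F a) + d')%:E); first by rewrite lee_fin.
  by rewrite EFinD leeD2r// (le_trans Sx)// Ghomo.
have [sb|bs] := ltP s b; last first.
  have -> : b = s by apply/eqP; rewrite eq_le bs; case/andP: sab.
  by case: Ss.
have sa : (a <= s)%R by case/andP: sab.
have [h [h0 hb] hG] := extend s (introT andP (conj sa sb)).
suff Ssh : S (s + h)%R.
  by have := ub_le_sup supS.2 Ssh; rewrite -/s leNgt ltrDl h0.
split; first by rewrite hb andbT (le_trans sa)// lerDl ltW.
apply: le_trans hG; have [_ Fs] := Ss.
have -> : (F (s + h) - F a = (F (s + h) - F s) + (F s - F a))%R by lra.
by rewrite EFinD leeD2l.
Qed.

End IncrementIntegral.

Section DerivativeIntegral.
Context {R : realType}.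
Local Notation mu := (@lebesgue_measure R).
Local Open Scope ereal_scope.

(** Fundamental theorem of calculus for a derivative that is nonnegative but possibly neither
    continuous nor bounded, as is the case of |w''|. *)
Lemma ge0_derive_integral (F f : R -> R) (a b : R) : (a <= b)%R ->
  (forall x, (a <= x <= b)%R -> {for x, continuous F}) ->
  (forall x, (a <= x < b)%R -> derivable F x 1 /\ (F^`())%classic x = f x) ->
  (forall x, (a <= x <= b)%R -> (0 <= f x)%R) ->
  measurable_fun `[a, b]%classic f ->
  \int[mu]_(x in `[a, b]) (f x)%:E = (F b - F a)%:E.
Proof.
move=> ab Fc dF f0 mf; apply/eqP; rewrite eq_le; apply/andP; split; last first.
  by apply: increment_le_integral => // x /dF[dFx ->].
(* Conversely, apply the same inequality to [n x - F x], whose derivative is at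
   most [max (n - f) 0 = n - min f n], and let [n] tend to infinity. *)
pose D : set R := `[a, b]%classic.
have mD : measurable D by exact: measurable_itv.
have fD x : D x -> (0 <= f x)%R by rewrite /D/= in_itv/=; exact: f0.
pose g (n : nat) x := (Num.min (f x) n%:R)%:E.
have mg n : measurable_fun D (g n).
  by apply/measurable_EFinP; apply: measurable_minr.
have g0 n x : D x -> 0 <= g n x by move=> /fD fx; rewrite lee_fin le_min fx /=.
have ndg x : D x -> {homo g^~ x : n m / (n <= m)%N >-> n <= m}.
  move=> _ n p np; rewrite lee_fin le_min ge_min lexx /= ge_min; apply/orP; right.
  by rewrite ler_nat.
have -> : \int[mu]_(x in D) (f x)%:E = \int[mu]_(x in D) limn (g^~ x).
  apply: eq_integral => x _; apply/esym/cvg_lim => //.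
  apply: cvg_near_cst; have [n fn] : exists n : nat, (f x <= n%:R)%R.
    by exists (Num.truncn (f x)).+1; rewrite ltW// truncnS_gt.
  exists n => // p /= np; rewrite /g; congr EFin; apply/min_idPl.
  by rewrite (le_trans fn)// ler_nat.
rewrite monotone_convergence//; apply: lime_le.
  apply: ereal_nondecreasing_is_cvgn => n p np.
  apply: ge0_le_integral; [exact: mD|exact: g0|exact: mg|exact: mg|].
  by move=> x Dx; exact: ndg.
exists 0%N => // n _ /=.
pose h x := Num.max (n%:R - f x)%R 0%R.
have mh : measurable_fun D h.
  by apply: measurable_maxr => //; apply: measurable_funB.
have h0 x : 0 <= (h x)%:E by rewrite lee_fin le_max lexx orbT.
have sumE : (\int[mu]_(x in D) g n x) + (\int[mu]_(x in D) (h x)%:E) = (n%:R * (b - a))%:E.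
  have mhe : measurable_fun D (EFin \o h) by exact/measurable_EFinP.
  rewrite -ge0_integralD//; [|exact: g0|exact: mg].
  rewrite (eq_integral (cst n%:R%:E)); last first.
    move=> x _; rewrite /g /h -EFinD; congr EFin.
    by rewrite minElt maxElt; case: ifPn; case: ifPn; rewrite -?leNgt; lra.
  transitivity (n%:R%:E * mu D); first exact: integral_cst.
  rewrite EFinM; congr (_ * _).
  rewrite lebesgue_measure_itv/= lte_fin; case: ltP => // ba.
  have -> : b = a by apply/eqP; rewrite eq_le ab ba.
  by rewrite subrr.
have hE : (n%:R * b - F b - (n%:R * a - F a))%:E <= \int[mu]_(x in D) (h x)%:E.
  apply: (@increment_le_integral _ (fun x => n%:R * x - F x)%R) => //.
  - move=> x /Fc cF; apply: (@cvgB _ R^o) => //.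
    by apply: (@cvgM _ _ _ _ (cst n%:R) id); [exact: cvg_cst|exact: cvg_id].
  - move=> x /dF[dFx Fx].
    have dF1 : is_derive x 1%R F (f x) by apply: DeriveDef => //; rewrite -derive1E.
    have dG : is_derive x 1%R (n%:R *: (@idfun R) - F)%R (n%:R *: 1 - f x)%R.
      exact: is_deriveB.
    split; first by case: dG.
    rewrite derive1E; have -> := @derive_val _ _ _ _ _ _ _ dG.
    by rewrite /GRing.scale/= mulr1 le_max lexx.
  - by move=> x _; rewrite -lee_fin.
move: sumE hE; have : 0 <= \int[mu]_(x in D) (h x)%:E by exact: integral_ge0.
have : 0 <= \int[mu]_(x in D) g n x by apply: integral_ge0; exact: g0.
case: (\int[mu]_(x in D) g n x) => [u||]//; case: (\int[mu]_(x in D) (h x)%:E) => [v||]//.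
by rewrite -EFinD !lee_fin => _ _ [] e; lra.
Qed.

End DerivativeIntegral.

(** * Weights and truncated moments *)

Section Weights.
Context {R : realType}.
Variables (w : R -> R) (t0 : R).
Hypothesis hw : condition_C w t0.
Local Notation mu := (@lebesgue_measure R).
Local Notation w1 := (w^`())%classic.
Local Notation f t := `|(w^`(2))%classic t|.

Let w2E t : t0 < t -> (w1^`())%classic t = - f t.
Proof.
move=> /(weight_derive2_lt0 hw); rewrite derive1nS derive1n1 => w20.
by rewrite ltr0_norm// opprK.
Qed.

Lemma weight_is_derive t : t0 < t -> is_derive t (1 : R) w (w1 t).
Proof. by move=> /(weight_derivable hw) dw; apply: DeriveDef => //; rewrite derive1E. Qed.

Lemma weight_is_derive1 t : t0 < t -> is_derive t (1 : R) w1 (- f t).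
Proof.
move=> t0t; have dw := weight_derivable2 hw t0t.
by apply: DeriveDef => //; rewrite -derive1E w2E.
Qed.

Let continuous_derivable (g : R -> R) (t : R) : derivable g t 1 -> {for t, continuous g}.
Proof. by move=> /derivable1_diffP; exact: differentiable_continuous. Qed.

(* [w''] is a pointwise limit of difference quotients of the continuous [w']. *)
Lemma measurable_weight_derive2 : measurable_fun `]t0, +oo[%classic (fun t : R => f t).
Proof.
have mD : measurable (`]t0, +oo[%classic : set R) by exact: measurable_itv.
have -> : (w^`(2))%classic = (w1^`())%classic by rewrite derive1nS derive1n1.
apply: (measurableT_comp (@normr_measurable R setT)).
pose h n (t : R) := n.+1%:R * (w1 (t + n.+1%:R^-1) - w1 t).
apply: (@measurable_fun_cvg _ _ _ _ h).
  move=> n; apply: open_continuous_measurable_fun.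
    exact: interval_open.
  move=> t; rewrite inE/= in_itv/= andbT => t0t.
  apply: cvgM; first exact: cvg_cst.
  apply: (@cvgB _ R^o); last exact/continuous_derivable/(weight_derivable2 hw).
  apply: (@cvg_comp _ _ _ (fun t : R => t + n.+1%:R^-1) w1).
    by apply: (@cvgD _ R^o); [exact: cvg_id|exact: cvg_cst].
  apply/continuous_derivable/(weight_derivable2 hw).
  by rewrite (lt_trans t0t)// ltrDl invr_gt0.
move=> t; rewrite /= in_itv/= andbT => t0t.
have hn : (n.+1%:R^-1 : R) @[n --> \oo] --> (0 : R) by exact: cvg_harmonic.
have h0 n : n.+1%:R^-1 != 0 :> R by rewrite invr_neq0.
have /cvgr_dnbhsP/(_ _ (conj h0 hn)) := weight_derivable2 hw t0t.
rewrite -/(derive w1 t 1) -derive1E; apply: cvg_trans.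
apply: near_eq_cvg; near=> n; rewrite /h /shift /= /GRing.scale /=.
by rewrite invrK mulr1 (addrC t).
Unshelve. all: by end_near. Qed.

Local Open Scope ereal_scope.

Lemma measurable_weight_derive2S (D : set R) : measurable D -> D `<=` `]t0, +oo[%classic ->
  measurable_fun D (fun t : R => f t).
Proof.
move=> mD DS; apply: measurable_funS measurable_weight_derive2 => //.
Qed.

Let itvS (k s : R) : (t0 < k)%R -> `[k, s]%classic `<=` `]t0, +oo[%classic.
Proof.
move=> tk y; rewrite /= !in_itv/= andbT => /andP[ky _]; exact: lt_le_trans ky.
Qed.

Let itvSy (k : R) : (t0 < k)%R -> `[k, +oo[%classic `<=` `]t0, +oo[%classic.
Proof.
move=> tk y; rewrite /= !in_itv/= !andbT => ky; exact: lt_le_trans ky.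
Qed.

Lemma integral_weight_derive2 (k s : R) : (t0 < k)%R -> (k <= s)%R ->
  \int[mu]_(t in `[k, s]) (f t)%:E = (w1 k - w1 s)%:E.
Proof.
move=> tk ks; rewrite (@ge0_derive_integral _ (- w1)%R)//.
- by congr EFin; rewrite -[((- w1) s)%R]/(- w1 s)%R -[((- w1) k)%R]/(- w1 k)%R; lra.
- move=> y /andP[ky _]; apply: continuous_derivable; apply: (@derivableN _ R^o).
  by apply: (weight_derivable2 hw); exact: lt_le_trans ky.
- move=> y /andP[ky _]; have /weight_is_derive1 dy := lt_le_trans tk ky.
  have dN : is_derive y 1%R (- w1)%R (- - f y)%R by exact: is_deriveN.
  split; first by case: dN.
  by rewrite derive1E; have -> := @derive_val _ _ _ _ _ _ _ dN; rewrite opprK.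
- by apply: measurable_weight_derive2S; [exact: measurable_itv|exact: itvS].
Qed.

(** Since w'' < 0, the function w - t w' is a primitive of t |w''|. *)
Lemma integral_id_weight_derive2 (k s : R) : (t0 < k)%R -> (k <= s)%R ->
  \int[mu]_(t in `[k, s]) (t * f t)%:E = (w s - s * w1 s - (w k - k * w1 k))%:E.
Proof.
move=> tk ks; have t00 := weight_t0_gt0 hw.
pose F := (w - (@idfun R) * w1)%R.
have dF y : (k <= y)%R -> is_derive y 1%R F (y * f y)%R.
  move=> ky; have ty := lt_le_trans tk ky.
  have dw1 := weight_is_derive1 ty; have dw := weight_is_derive ty.
  have d1 : is_derive y 1%R ((@idfun R) * w1)%R (y *: (- f y) + w1 y *: 1)%R.
    exact: is_deriveM.
  have -> : (y * f y = w1 y - (y *: (- f y) + w1 y *: 1))%R.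
    by rewrite /GRing.scale/=; lra.
  exact: is_deriveB.
rewrite (@ge0_derive_integral _ F)//.
- by move=> y /andP[/dF dy _]; apply: continuous_derivable; case: dy.
- move=> y /andP[/dF dy _]; split; first by case: dy.
  by rewrite derive1E; exact: derive_val.
- move=> y /andP[ky _]; apply: mulr_ge0 => //.
  by rewrite (le_trans _ ky)// ltW// (lt_trans t00).
- apply: measurable_funM => //; apply: measurable_weight_derive2S; last exact: itvS.
  exact: measurable_itv.
Qed.

Lemma weight_derive1_nonincreasing (k s : R) : (t0 < k)%R -> (k <= s)%R -> (w1 s <= w1 k)%R.
Proof.
move=> tk ks; rewrite -subr_ge0 -lee_fin -integral_weight_derive2//.
by apply: integral_ge0 => t _; rewrite lee_fin.
Qed.

(** w' is nonincreasing beyond t0 and tends to 0. *)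
Lemma weight_derive1_ge0 (k : R) : (t0 < k)%R -> (0 <= w1 k)%R.
Proof.
move=> tk; have c := weight_derive_cvg0 hw.
rewrite -(cvg_lim _ c)//; apply: limr_le; first by apply/cvg_ex; exists 0%R.
near=> s; exact: weight_derive1_nonincreasing.
Unshelve. all: by end_near. Qed.

Let cvg_integral_itv (g : R -> \bar R) (k : R) :
  measurable_fun `[k, +oo[%classic g -> (forall t, (k <= t)%R -> 0 <= g t) ->
  (\int[mu]_(t in `[k, (k + n%:R)%R]) g t) @[n --> \oo] --> \int[mu]_(t in `[k, +oo[) g t.
Proof.
move=> mg g0; rewrite itv_bndy_bigcup_BRight.
have sub n : `[k, (k + n%:R)%R]%classic `<=` `[k, +oo[%classic.
  by move=> y; rewrite /= !in_itv/= andbT => /andP[].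
apply: ge0_nondecreasing_set_cvg_integral.
- move=> n p np; apply/subsetPset => y; rewrite /= !in_itv/= => /andP[-> /= yn].
  by rewrite (le_trans yn)// lerD2l ler_nat.
- by move=> n; exact: measurable_itv.
- by move=> n; apply: measurable_funS mg => //; exact: measurable_itv.
- by move=> n y; rewrite /= in_itv/= => /andP[/g0].
Qed.

Lemma integral_weight_derive2_infty (k : R) : (t0 < k)%R ->
  \int[mu]_(t in `[k, +oo[) (f t)%:E = (w1 k)%:E.
Proof.
move=> tk; have mg : measurable_fun `[k, +oo[%classic (fun t : R => (f t)%:E).
  apply/measurable_EFinP; apply: measurable_weight_derive2S; last exact: itvSy.
  exact: measurable_itv.
have f0 t : (k <= t)%R -> 0 <= (f t)%:E by rewrite lee_fin.
rewrite -(cvg_lim _ (cvg_integral_itv mg f0))//; apply/cvg_lim => //.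
have -> : (fun n => \int[mu]_(t in `[k, (k + n%:R)%R]) (f t)%:E) =
    (fun n => (w1 k - w1 (k + n%:R))%:E).
  by apply/funext => n; rewrite integral_weight_derive2// lerDl.
apply/cvg_EFin; first by near=> n.
rewrite -[X in _ --> X]subr0; apply: (@cvgB _ R^o); first exact: cvg_cst.
have /cvg_pinftyP := weight_derive_cvg0 hw; apply.
apply/cvgryPge => A; near=> n.
rewrite -lerBlDl; near: n; exact: nbhs_infty_ger.
Unshelve. all: by end_near. Qed.

(** As a function of [s] this is linear below [k] and equals w(s) plus a constant above [k]; it
    represents w as a mixture of the functions min(s, t). *)
Definition truncated_moment (k : R) (s : \bar R) : \bar R :=
  \int[mu]_(t in `[k, +oo[) ((f t)%:E * mine s t%:E).

Lemma measurable_truncated_moment (k : R) (s : \bar R) : (t0 < k)%R ->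
  measurable_fun `[k, +oo[%classic (fun t : R => (f t)%:E * mine s t%:E).
Proof.
move=> tk; apply: emeasurable_funM.
  apply/measurable_EFinP; apply: measurable_weight_derive2S; last exact: itvSy.
  exact: measurable_itv.
by apply: measurable_mine => //; apply/measurable_EFinP; exact: measurable_id.
Qed.

Let truncated_ge0 (k : R) (s : \bar R) (t : R) :
  (t0 < k)%R -> 0 <= s -> (k <= t)%R -> 0 <= (f t)%:E * mine s t%:E.
Proof.
move=> tk s0 kt; apply: mule_ge0; first by rewrite lee_fin.
rewrite le_min s0 lee_fin (le_trans _ kt)// ltW// (lt_trans _ tk)//.
exact: weight_t0_gt0 hw.
Qed.

Lemma truncated_moment_ge0 (k : R) (s : \bar R) : (t0 < k)%R -> 0 <= s ->
  0 <= truncated_moment k s.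
Proof.
move=> tk s0; apply: integral_ge0 => t; rewrite /= in_itv/= andbT.
exact: truncated_ge0.
Qed.

Lemma truncated_moment_small (k s : R) : (t0 < k)%R -> (0 <= s <= k)%R ->
  truncated_moment k s%:E = (s * w1 k)%:E.
Proof.
move=> tk /andP[s0 sk]; rewrite /truncated_moment.
transitivity (\int[mu]_(t in `[k, +oo[) (s%:E * (f t)%:E)).
  apply: eq_integral => t; rewrite inE/= in_itv/= andbT => kt; rewrite muleC; congr (_ * _).
  by apply/min_idPl; rewrite lee_fin (le_trans sk).
rewrite ge0_integralZl//.
- by rewrite integral_weight_derive2_infty.
- apply/measurable_EFinP; apply: measurable_weight_derive2S; last exact: itvSy.
  exact: measurable_itv.
Qed.

(** Split at [s]: below it the minimum is t and the primitive w - t w' applies, above it the minimum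
    is s and the tail gives s w'(s). The two terms s w'(s) cancel. *)
Lemma truncated_moment_large (k s : R) : (t0 < k)%R -> (k <= s)%R ->
  truncated_moment k s%:E = (w s - w k + k * w1 k)%:E.
Proof.
move=> tk ks; rewrite /truncated_moment; have t00 := weight_t0_gt0 hw.
have s0 : (0 <= s)%R by rewrite (le_trans _ ks)// ltW// (lt_trans t00).
have ts := lt_le_trans tk ks.
have U : `[k, +oo[%classic = `[k, s[%classic `|` `[s, +oo[%classic.
  apply/seteqP; split => y; rewrite /= !in_itv/= ?andbT.
    by move=> ->; case: (ltP y s) => _; [left|right].
  by move=> [/andP[//]|]; exact: le_trans.
have m1 := measurable_truncated_moment s%:E tk.
rewrite U ge0_integral_setU//; last 3 first.
- by rewrite -U.
- move=> y; rewrite -U /= in_itv/= andbT.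
  by apply: truncated_ge0 => //; rewrite lee_fin.
- apply/disj_setPS => y [] /=; rewrite !in_itv/= andbT => /andP[_ ys] sy.
  by have := lt_le_trans ys sy; rewrite ltxx.
rewrite integral_itv_bndo_bndc; last first.
  apply: measurable_funS m1 => //.
  by rewrite U; exact: subsetUl.
have -> : \int[mu]_(t in `[k, s]) ((f t)%:E * mine s%:E t%:E) =
    \int[mu]_(t in `[k, s]) (t * f t)%:E.
  apply: eq_integral => t; rewrite inE/= in_itv/= => /andP[_ st]; rewrite EFinM muleC.
  by congr (_ * _); apply/min_idPr; rewrite lee_fin.
rewrite integral_id_weight_derive2//.
have -> : \int[mu]_(t in `[s, +oo[) ((f t)%:E * mine s%:E t%:E) = truncated_moment s s%:E by [].
rewrite truncated_moment_small ?s0 ?lexx// -EFinD; congr EFin; lra.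
Qed.

(** [C] plays the role of the limit of w, possibly [+oo]. On [k, k + n] the primitive is evaluated
    and its nonpositive boundary term - (k + n) w'(k + n) is dropped. *)
Lemma truncated_moment_infty_le (k : R) (C : \bar R) : (t0 < k)%R ->
  (forall s, (k <= s)%R -> (w s)%:E <= C) ->
  truncated_moment k +oo <= C + (k * w1 k)%:E.
Proof.
move=> tk wC; have t00 := weight_t0_gt0 hw.
have k0 : (0 <= k)%R by rewrite ltW// (lt_trans t00).
have m1 := measurable_truncated_moment +oo tk.
have g0 t : (k <= t)%R -> 0 <= (f t)%:E * mine +oo t%:E by exact: truncated_ge0.
have c := cvg_integral_itv m1 g0.
rewrite /truncated_moment -(cvg_lim _ c)//; apply: lime_le.
  by apply/cvg_ex; eexists; exact: c.
exists 0%N => // n _ /=.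
have kn : (k <= k + n%:R)%R by rewrite lerDl.
have -> : \int[mu]_(t in `[k, (k + n%:R)%R]) ((f t)%:E * mine +oo t%:E) =
    \int[mu]_(t in `[k, (k + n%:R)%R]) (t * f t)%:E.
  by apply: eq_integral => t _; rewrite EFinM muleC; congr (_ * _); apply/min_idPr; rewrite leey.
rewrite integral_id_weight_derive2//; apply: le_trans (leeD2r _ (wC _ kn)).
rewrite -EFinD lee_fin.
have h1 : (0 <= (k + n%:R) * w1 (k + n%:R))%R.
  by apply: mulr_ge0; [rewrite addr_ge0|apply: weight_derive1_ge0; exact: lt_le_trans kn].
have h2 : (0 <= w k)%R by exact: (weight_ge0 hw).
by move: h1 h2; lra.
Qed.

Lemma truncated_moment_nondecreasing (k : R) (s u : \bar R) : (t0 < k)%R ->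
  0 <= s -> s <= u -> truncated_moment k s <= truncated_moment k u.
Proof.
move=> tk s0 su; apply: ge0_le_integral => //.
- by move=> t; rewrite /= in_itv/= andbT; exact: truncated_ge0.
- exact: measurable_truncated_moment.
- exact: measurable_truncated_moment.
- move=> t _; apply: lee_wpmul2l; first by rewrite lee_fin.
  by rewrite le_min ge_min su /= ge_min lexx orbT.
Qed.

(** w is monotone on [0, +oo[ only; freezing it at w(0) on the negative axis gives a function
    monotone on the whole line, hence measurable and with a limit at infinity. *)
Let wmax (r : R) := w (Num.max r 0%R).

Let wmax_nondecreasing : {homo wmax : r s / (r <= s)%R}.
Proof.
move=> r s rs; apply: (weight_nondecreasing hw); first by rewrite le_max lexx orbT.
by rewrite ge_max !le_max rs lexx orbT.
Qed.

Let wmaxE (r : R) : (0 <= r)%R -> wmax r = w r.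
Proof. by move=> r0; rewrite /wmax; congr w; apply/max_idPl. Qed.

Lemma is_cvg_weight : cvg ((w t)%:E @[t --> +oo%R]).
Proof.
have c : cvg ((wmax t)%:E @[t --> +oo%R]).
  by apply: nondecreasing_is_cvge => r s rs; rewrite lee_fin; exact: wmax_nondecreasing.
apply/cvg_ex; exists (lim ((wmax t)%:E @[t --> +oo%R])).
apply: cvg_trans c; apply: near_eq_cvg; near=> t.
by rewrite wmaxE.
Unshelve. all: by end_near. Qed.

Lemma weight_le_extend (s : R) (u : \bar R) : (0 <= s)%R -> s%:E <= u ->
  (w s)%:E <= extend_weight w u.
Proof.
move=> s0; case: u => [r||//].
  by rewrite !lee_fin; exact: (weight_nondecreasing hw).
move=> _ /=; apply: lime_ge; first exact: is_cvg_weight.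
by near=> t; rewrite lee_fin; apply: (weight_nondecreasing hw).
Unshelve. all: by end_near. Qed.

Lemma extend_weight_ge0 (u : \bar R) : 0 <= u -> 0 <= extend_weight w u.
Proof.
move=> u0; apply: le_trans (weight_le_extend (lexx 0%R) u0).
by rewrite lee_fin (weight_ge0 hw).
Qed.

Lemma truncated_moment_le (k : R) (s : \bar R) : (t0 < k)%R -> 0 <= s ->
  truncated_moment k s <= extend_weight w s + (k * w1 k)%:E.
Proof.
move=> tk; have k0 : (0 <= k)%R by rewrite ltW// (lt_trans (weight_t0_gt0 hw)).
have w10 := weight_derive1_ge0 tk.
case: s => [s||//]; last first.
  move=> _; apply: truncated_moment_infty_le => // s ks.
  by apply: weight_le_extend; rewrite ?leey// (le_trans k0).
rewrite lee_fin /= => s0; have ws0 : (0 <= w s)%R by exact: (weight_ge0 hw).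
have wk0 : (0 <= w k)%R by exact: (weight_ge0 hw).
have [sk|ks] := leP s k.
  rewrite truncated_moment_small ?s0// lee_fin -[leLHS]add0r lerD// ler_wpM2r//.
by rewrite truncated_moment_large ?(ltW ks)// lee_fin lerD2r gerBl.
Qed.

Lemma extend_weight_le (k : R) (s : \bar R) : (t0 < k)%R -> 0 <= s ->
  extend_weight w s <= truncated_moment k s + (w k)%:E.
Proof.
move=> tk; have k0 : (0 <= k)%R by rewrite ltW// (lt_trans (weight_t0_gt0 hw)).
have w10 := weight_derive1_ge0 tk.
have fin (r : R) : (0 <= r)%R -> (w r)%:E <= truncated_moment k r%:E + (w k)%:E.
  move=> r0; have [rk|kr] := leP r k.
    rewrite -[leLHS]add0e leeD// ?truncated_moment_ge0 ?lee_fin//.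
    exact: (weight_nondecreasing hw).
  rewrite truncated_moment_large ?(ltW kr)// -EFinD lee_fin.
  by have := mulr_ge0 k0 w10; lra.
case: s => [s||//]; first by rewrite lee_fin => /fin.
move=> _ /=; apply: lime_le; first exact: is_cvg_weight.
near=> t; have t0' : (0 <= t)%R by near: t; exact: nbhs_pinfty_ge.
apply: le_trans (fin t t0') _; rewrite leeD2r//.
by apply: truncated_moment_nondecreasing => //; rewrite ?lee_fin ?leey.
Unshelve. all: by end_near. Qed.

Lemma measurable_extend_weight d (T : measurableType d) (tau : T -> \bar R) :
  measurable_fun [set: T] tau -> (forall om, 0 <= tau om) ->
  measurable_fun [set: T] (fun om => extend_weight w (tau om)).
Proof.
move=> mtau tau0.
have -> : (fun om => extend_weight w (tau om)) =
  (fun om => if tau om == +oo then extend_weight w +oo else (wmax (fine (tau om)))%:E).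
  apply/funext => om; have := tau0 om; case: (tau om) => [r||]//=.
  by rewrite lee_fin => /wmaxE ->.
apply: measurable_fun_ifT => //.
- apply: (measurable_fun_bool true).
  rewrite setTI (_ : _ @^-1` _ = tau @^-1` [set +oo]); last first.
    by apply/seteqP; split => om /= /eqP.
  by rewrite -[X in measurable X]setTI; exact: mtau.
- apply/measurable_EFinP; apply: (measurableT_comp (f := wmax)).
    exact: nondecreasing_measurable.
  by apply: (measurableT_comp (f := fine)) mtau.
Qed.

End Weights.

(** * Exchange of the integral against |w''| with the expectation *)

Section TruncatedMean.
Context {R : realType} {d : measure_display} {T : measurableType d}.
Variables (w : R -> R) (t0 k : R) (Pr : probability T R) (tau : T -> \bar R).
Hypothesis hw : condition_C w t0.
Hypothesis t0k : t0 < k.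
Local Notation f t := `|(w^`(2))%classic t|.
Local Open Scope ereal_scope.
Hypothesis mtau : measurable_fun [set: T] tau.
Hypothesis tau_ge0 : forall om, 0 <= tau om.
Local Notation mu := (@lebesgue_measure R).

Definition truncated_mean (t : R) : \bar R := \int[Pr]_om mine (tau om) t%:E.

Let k_gt0 : (0 < k)%R.
Proof. exact: lt_trans (weight_t0_gt0 hw) t0k. Qed.

Let mK : measurable (`[k, +oo[%classic : set R).
Proof. exact: measurable_itv. Qed.

Let mine_ge0 (t : R) om : (0 <= t)%R -> 0 <= mine (tau om) t%:E.
Proof. by move=> t_ge0; rewrite le_min tau_ge0 lee_fin. Qed.

Let mmine (t : R) : measurable_fun [set: T] (fun om => mine (tau om) t%:E).
Proof. exact: measurable_mine. Qed.

Lemma truncated_mean_ge0 (t : R) : (0 <= t)%R -> 0 <= truncated_mean t.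
Proof. by move=> t_ge0; apply: integral_ge0 => om _; exact: mine_ge0. Qed.

Lemma truncated_mean_fin (t : R) : (0 <= t)%R -> truncated_mean t \is a fin_num.
Proof.
move=> t_ge0; rewrite ge0_fin_numE ?truncated_mean_ge0//.
apply: (@le_lt_trans _ _ (\int[Pr]_om t%:E)).
  apply: ge0_le_integral => //; first by move=> om _; exact: mine_ge0.
  by move=> om _; rewrite ge_min lexx orbT.
have -> : \int[Pr]_om t%:E = t%:E * Pr setT by exact: integral_cst.
by rewrite probability_setT mule1 ltry.
Qed.

(** The restriction to [k, +oo[ is built into the integrand, so that Tonelli applies on the full
    product space. *)
Let h (p : R * T) : \bar R :=
  ((fun t : R => (f t)%:E) \_ `[k, +oo[%classic) p.1 * mine (tau p.2) p.1%:E.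

Let h_ge0 p : 0 <= h p.
Proof.
rewrite /h patchE; case: ifPn => [|_]; last by rewrite mul0e.
rewrite inE/= in_itv/= andbT => kt; apply: mule_ge0; first by rewrite lee_fin.
by apply: mine_ge0; rewrite (le_trans _ kt)// ltW.
Qed.

Let mh : measurable_fun [set: R * T] h.
Proof.
apply: emeasurable_funM.
  apply: (measurableT_comp (f := (fun t : R => (f t)%:E) \_ `[k, +oo[%classic)) => //.
  apply/measurable_restrict => //; rewrite setTI; apply/measurable_EFinP.
  apply: (measurable_weight_derive2S hw) => // y.
  by rewrite /= !in_itv/= !andbT; exact: lt_le_trans.
apply: measurable_mine; first exact: (measurableT_comp mtau).
by apply/measurable_EFinP; exact: measurable_fst.
Qed.

Let h_in t om : `[k, +oo[%classic t -> h (t, om) = (f t)%:E * mine (tau om) t%:E.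
Proof. by move=> kt; rewrite /h patchE/= mem_set. Qed.

Let mean_in t : `[k, +oo[%classic t ->
  \int[Pr]_om h (t, om) = (f t)%:E * truncated_mean t.
Proof.
move=> kt; under eq_integral do rewrite h_in//.
rewrite ge0_integralZl// ?lee_fin// => om _; apply: mine_ge0.
by move: kt; rewrite /= in_itv/= andbT; apply: le_trans; exact: ltW.
Qed.

Lemma measurable_truncated_mean :
  measurable_fun `[k, +oo[%classic (fun t : R => (f t)%:E * truncated_mean t).
Proof.
apply: (eq_measurable_fun (fubini_F Pr h)).
  by move=> t; rewrite inE => kt; rewrite /fubini_F mean_in.
apply: measurable_funTS; exact: measurable_fun_fubini_tonelli_F.
Qed.

Let moment_h om : \int[mu]_t h (t, om) = truncated_moment w k (tau om).
Proof.
rewrite /truncated_moment [RHS]integral_mkcond; apply: eq_integral => t _.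
rewrite /h !patchE/=; case: ifP => // _; exact: mul0e.
Qed.

Lemma measurable_truncated_moment_comp :
  measurable_fun [set: T] (fun om => truncated_moment w k (tau om)).
Proof.
apply: (eq_measurable_fun (fubini_G mu h)); first by move=> om _; exact: moment_h.
exact: measurable_fun_fubini_tonelli_G.
Qed.

Lemma integral_truncated_mean :
  \int[mu]_(t in `[k, +oo[) ((f t)%:E * truncated_mean t) =
  \int[Pr]_om truncated_moment w k (tau om).
Proof.
under [RHS]eq_integral do rewrite -moment_h.
rewrite -fubini_tonelli// [LHS]integral_mkcond; apply: eq_integral => t _.
rewrite patchE; case: ifPn => [|kt]; first by rewrite inE => /mean_in.
apply/esym; apply: integral0_eq => om _; rewrite /h patchE/= (negbTE kt).
exact: mul0e.
Qed.

(** [extend_weight_le] and [truncated_moment_le] bound each of the two integrands by the other plus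
    a constant, and constants have finite expectation. *)
Lemma truncated_mean_integrable_iff :
  \int[mu]_(t in `[k, +oo[) ((f t)%:E * truncated_mean t) < +oo <->
  \int[Pr]_om extend_weight w (tau om) < +oo.
Proof.
rewrite integral_truncated_mean.
have prob (c : R) : \int[Pr]_om c%:E = c%:E.
  have -> : \int[Pr]_om c%:E = c%:E * Pr setT by exact: integral_cst.
  by rewrite probability_setT mule1.
have m1 := measurable_truncated_moment_comp.
have m2 := measurable_extend_weight hw mtau tau_ge0.
have m0 om : 0 <= truncated_moment w k (tau om) by exact: (truncated_moment_ge0 hw).
have e0 om : 0 <= extend_weight w (tau om) by exact: (extend_weight_ge0 hw).
have wk0 : (0 <= w k)%R by apply: (weight_ge0 hw); exact: ltW.
have kw0 : (0 <= k * (w^`())%classic k)%R.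
  by apply: mulr_ge0; [exact: ltW|exact: (weight_derive1_ge0 hw)].
split=> fin.
- apply: (@le_lt_trans _ _ (\int[Pr]_om (truncated_moment w k (tau om) + (w k)%:E))).
    apply: ge0_le_integral => //; first exact: emeasurable_funD.
    by move=> om _; exact: (extend_weight_le hw).
  by rewrite ge0_integralD// prob lte_add_pinfty// ltry.
- apply: (@le_lt_trans _ _ (\int[Pr]_om (extend_weight w (tau om) + (k * (w^`())%classic k)%:E))).
    apply: ge0_le_integral => //; first exact: emeasurable_funD.
    by move=> om _; exact: (truncated_moment_le hw).
  by rewrite ge0_integralD// prob lte_add_pinfty// ltry.
Qed.

End TruncatedMean.

Section Reversible.
Context {R : realType} {I : countType}.
Variables (P : R -> I -> I -> R) (q : I -> I -> R) (m : I -> R).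
Hypothesis hrev : reversible_wrt P m.

Lemma reversible_measure_gt0 : irreducible_transition P -> forall y, 0 < m y.
Proof.
move=> hirr y; have [z mz] := reversible_measure_neq0 hrev.
have {}mz : 0 < m z by rewrite lt_neqAle eq_sym mz (reversible_measure_ge0 hrev).
have [t t0 Pt] := hirr z y.
have := mulr_gt0 mz Pt; rewrite (detailed_balance hrev) ?(ltW t0)// => h.
rewrite lt_neqAle (reversible_measure_ge0 hrev) andbT eq_sym.
by apply: contraTneq h => ->; rewrite mul0r ltxx.
Qed.

Lemma reversible_Qmatrix : is_Qmatrix P q -> forall y z, m y * q y z = m z * q z y.
Proof.
move=> hq y z; have [->//|yz] := eqVneq y z.
have c u v : m u * ((P t u v - (u == v)%:R) / t) @[t --> 0^'+] --> m u * q u v.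
  by apply: (@cvgM _ _ _ _ (cst (m u))); [exact: cvg_cst|exact: hq].
rewrite -(cvg_lim _ (c y z))//; apply/cvg_lim => //.
apply: cvg_trans (c z y); apply: near_eq_cvg; near=> t.
have t0 : 0 <= t by apply: ltW; near: t; exact: nbhs_right_gt.
by rewrite (eq_sym z y) (negbTE yz) !subr0 !mulrA (detailed_balance hrev).
Unshelve. all: by end_near. Qed.

End Reversible.

Section LaplaceTruncation.
Context {R : realType}.
Local Open Scope ereal_scope.

(** With u = s / t this is 1 - exp(- u) <= min(u, 1), in additive form so that it can be integrated
    in the extended reals. *)
Lemma le_mine_laplace (t : R) (s : \bar R) : (0 < t)%R -> 0 <= s ->
  t%:E <= mine s t%:E + t%:E * expeR (- (t^-1%:E * s)).
Proof.
move=> t0; case: s => [s||//]; last first.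
  move=> _; rewrite gt0_muley ?lte_fin ?invr_gt0//= mule0 adde0.
  by rewrite le_min lexx leey.
rewrite lee_fin -EFin_min -EFinM -EFinD lee_fin => s0.
have e1 : (1 + - (t^-1 * s) <= expR (- (t^-1 * s)))%R by exact: expR_ge1Dx.
have e0 : (0 <= expR (- (t^-1 * s)))%R by exact: expR_ge0.
have [st|ts] := ltP s t; last by rewrite lerDl mulr_ge0// ltW.
have := ler_wpM2l (ltW t0) e1.
by rewrite mulrDr mulr1 mulrN mulrA mulfV ?gt_eqF// mul1r; lra.
Qed.

(** With u = s / t this is min(u, 1) <= 2 (1 - exp(- u)), which follows from exp(- u) <= 1 / (1 + u)
    since 2 u / (1 + u) is at least u for u <= 1 and at least 1 for u >= 1. *)
Lemma mine_laplace_le (t : R) (s : \bar R) : (0 < t)%R -> 0 <= s ->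
  mine s t%:E + (2 * t)%:E * expeR (- (t^-1%:E * s)) <= (2 * t)%:E.
Proof.
move=> t0; case: s => [s||//]; last first.
  move=> _; rewrite gt0_muley ?lte_fin ?invr_gt0//= mule0 adde0.
  by rewrite ge_min lee_fin orbC ler_peMl ?ler1n// ltW.
rewrite lee_fin -EFin_min -EFinM -EFinD lee_fin => s0.
have u0 : (0 <= t^-1 * s)%R by rewrite mulr_ge0// invr_ge0 ltW.
set u := (t^-1 * s)%R in u0 *.
have su : s = (t * u)%R by rewrite /u mulrA mulfV ?gt_eqF// mul1r.
have e1 : (expR (- u) * (1 + u) <= 1)%R.
  rewrite expRN mulrC ler_pdivrMr ?expR_gt0// mul1r; exact: expR_ge1Dx.
have -> : Num.min s t = (t * Num.min u 1)%R.
  by rewrite su minr_pMr ?ltW// mulr1.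
have : (Num.min u 1 + 2 * expR (- u) <= 2)%R; last first.
  by move=> /(ler_wpM2l (ltW t0)); rewrite mulrDr; lra.
have e0 : (0 < expR (- u))%R by exact: expR_gt0.
move: (expR (- u)) e1 e0 => e e1 e0.
have u1 : (0 < 1 + u)%R by lra.
have e2 : (e <= (1 + u)^-1)%R by rewrite -[leRHS]mul1r ler_pdivlMr.
have [|u_ge1] := ltP u 1%R => [u_lt1|]; last by nra.
nra.
Qed.

End LaplaceTruncation.

(** * Comparison of the conductance integral with the truncated mean *)

Section ConductanceIntegral.
Context {R : realType} {I : countType} {d : measure_display}
  {T : measurableType d}.
Variables (P : R -> I -> I -> R) (q : I -> I -> R) (m : I -> R)
  (Pr : I -> probability T R) (X : R -> T -> I) (w : R -> R) (t0 k : R) (x : I).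
Hypothesis hP : honest_standard_transition_function P.
Hypothesis hq : is_Qmatrix P q.
Hypothesis hreg : regular_Qmatrix q.
Hypothesis hX : markov_chain P Pr X.
Hypothesis hne : non_explosive Pr X.
Hypothesis m_gt0 : forall y, 0 < m y.
Hypothesis m_sym : forall y z, m y * q y z = m z * q z y.
Hypothesis hw : condition_C w t0.
Hypothesis t0k : t0 < k.
Local Notation mu := (@lebesgue_measure R).
Local Notation f t := `|(w^`(2))%classic t|.
Local Open Scope ereal_scope.

Let tau := return_time X x.
Let mtau : measurable_fun [set: T] tau := measurable_return_time hX x.
Let tau_ge0 om : 0 <= tau om := return_time_ge0 X x om.
Let phi (t : R) : R := fine (\int[Pr x]_om return_laplace X x t^-1 om).
Local Notation psi := (truncated_mean (Pr x) tau).

Let k_gt0 : (0 < k)%R.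
Proof. exact: lt_trans (weight_t0_gt0 hw) t0k. Qed.

Let invt_gt0 (t : R) : (0 < t)%R -> (0 < t^-1)%R.
Proof. by rewrite invr_gt0. Qed.

Let mL (t : R) : (0 < t)%R -> measurable_fun [set: T] (return_laplace X x t^-1).
Proof. by move=> /invt_gt0 t'; exact: (measurable_return_laplace hX). Qed.

Let L0 (t : R) om : (0 < t)%R -> 0 <= return_laplace X x t^-1 om.
Proof. by move=> /invt_gt0 t'; have /andP[] := return_laplace_bounds X x t' om. Qed.

Let phiE (t : R) : (0 < t)%R -> \int[Pr x]_om return_laplace X x t^-1 om = (phi t)%:E.
Proof.
move=> t_gt0; rewrite /phi fineK// ge0_fin_numE; last first.
  by apply: integral_ge0 => om _; exact: L0.
apply: (@le_lt_trans _ _ (\int[Pr x]_om 1%:E)).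
  apply: ge0_le_integral => //.
  - by move=> om _; exact: L0.
  - exact: mL.
  - by move=> om _; have /andP[] := return_laplace_bounds X x (invt_gt0 t_gt0) om.
have -> : \int[Pr x]_om 1%:E = 1%:E * Pr x setT by exact: integral_cst.
by rewrite probability_setT mule1 ltry.
Qed.

Let prob (c : R) : \int[Pr x]_om c%:E = c%:E.
Proof.
have -> : \int[Pr x]_om c%:E = c%:E * Pr x setT by exact: integral_cst.
by rewrite probability_setT mule1.
Qed.

Let mmine (t : R) : measurable_fun [set: T] (fun om => mine (tau om) t%:E).
Proof. exact: measurable_mine. Qed.

Let mine_ge0 (t : R) om : (0 <= t)%R -> 0 <= mine (tau om) t%:E.
Proof. by move=> t_ge0; rewrite le_min tau_ge0 lee_fin. Qed.

Let integral_mineL (t c : R) : (0 < t)%R -> (0 <= c)%R ->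
  \int[Pr x]_om (mine (tau om) t%:E + c%:E * return_laplace X x t^-1 om) =
  psi t + (c * phi t)%:E.
Proof.
move=> t_gt0 c0; have mLt := mL t_gt0.
have Lt0 om : 0 <= return_laplace X x t^-1 om by exact: L0.
rewrite ge0_integralD//; last 3 first.
- by move=> om _; apply: mine_ge0; exact: ltW.
- by move=> om _; apply: mule_ge0.
- exact: measurable_funeM.
by rewrite ge0_integralZl// phiE.
Qed.

Let mean_laplace_le (t : R) : (0 < t)%R -> (t * (1 - phi t))%:E <= psi t.
Proof.
move=> t_gt0; have pf := truncated_mean_fin (Pr x) mtau tau_ge0 (ltW t_gt0).
have : \int[Pr x]_om t%:E <= \int[Pr x]_om (mine (tau om) t%:E + t%:E * return_laplace X x t^-1 om).
  apply: ge0_le_integral => //.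
  - by move=> om _; rewrite lee_fin ltW.
  - by apply: emeasurable_funD => //; apply: measurable_funeM; exact: mL.
  - by move=> om _; exact: le_mine_laplace.
rewrite prob integral_mineL ?(ltW t_gt0)// -(fineK pf) -EFinD !lee_fin; lra.
Qed.

Let mean_le_laplace (t : R) : (0 < t)%R -> psi t <= (2 * (t * (1 - phi t)))%:E.
Proof.
move=> t_gt0; have pf := truncated_mean_fin (Pr x) mtau tau_ge0 (ltW t_gt0).
have t2 : (0 <= 2 * t)%R by rewrite mulr_ge0// ltW.
have : \int[Pr x]_om (mine (tau om) t%:E + (2 * t)%:E * return_laplace X x t^-1 om) <=
    \int[Pr x]_om (2 * t)%:E.
  apply: ge0_le_integral => //.
  - move=> om _; apply: adde_ge0; first by apply: mine_ge0; exact: ltW.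
    by apply: mule_ge0; [rewrite lee_fin|exact: L0].
  - by apply: emeasurable_funD => //; apply: measurable_funeM; exact: mL.
  - by move=> om _; exact: mine_laplace_le.
rewrite prob integral_mineL// -(fineK pf) -EFinD !lee_fin; lra.
Qed.

(** Monotonicity yields the measurability of [phi], and through [conductanceE] that of the
    conductance as a function of t. *)
Let phi_nondecreasing (s t : R) : (0 < s)%R -> (s <= t)%R -> (phi s <= phi t)%R.
Proof.
move=> s_gt0 st; have t_gt0 := lt_le_trans s_gt0 st.
rewrite -lee_fin -!phiE//; apply: ge0_le_integral => //.
- by move=> om _; exact: L0.
- exact: mL.
- exact: mL.
move=> om _; rewrite /return_laplace; have := return_time_ge0 X x om.
case: (return_time X x om) => [r||//].
  rewrite lee_fin => r0; rewrite -!EFinM lee_fin ler_expR lerN2 ler_wpM2r//.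
  by rewrite lef_pV2.
by rewrite !gt0_muley ?lte_fin ?invt_gt0.
Qed.

Let measurable_phi : measurable_fun `]t0, +oo[%classic phi.
Proof.
have mK : measurable (`]t0, +oo[%classic : set R) by exact: measurable_itv.
apply: (eq_measurable_fun (fun t : R => phi (Num.max t t0))).
  by move=> t; rewrite inE/= in_itv/= andbT => /ltW kt; congr phi; apply/max_idPl.
apply: nondecreasing_measurable => // s t st; apply: phi_nondecreasing.
  by rewrite lt_max (weight_t0_gt0 hw) orbT.
by rewrite ge_max !le_max st lexx orbT.
Qed.

Let conductanceE (t : R) : (0 < t)%R ->
  effective_conductance q m t^-1 x = (m x * ((t^-1 - q x x) * (1 - phi t)))%:E.
Proof. by move=> /invt_gt0 t'; exact: (effective_conductance_return hP hq hreg hX hne). Qed.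

Let q_gt0 : (0 < - q x x)%R := Qmatrix_diag_lt0 hreg x.

Let phi_compl_ge0 (t : R) : (0 < t)%R -> (0 <= t * (1 - phi t))%R.
Proof.
move=> t_gt0; have := truncated_mean_ge0 (Pr x) tau_ge0 (ltW t_gt0).
by move=> /le_trans/(_ (mean_le_laplace t_gt0)); rewrite lee_fin pmulr_rge0.
Qed.

Lemma conductance_integrand_ge0 (t : R) : (0 < t)%R ->
  0 <= (t * f t)%:E * effective_conductance q m t^-1 x.
Proof.
move=> t_gt0; have := phi_compl_ge0 t_gt0; rewrite pmulr_rge0// => a0.
rewrite conductanceE// -EFinM lee_fin.
apply: mulr_ge0; first by apply: mulr_ge0 => //; exact: ltW.
apply: mulr_ge0; first exact: ltW.
apply: mulr_ge0 => //; have := invt_gt0 t_gt0; have := q_gt0; lra.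
Qed.

Lemma measurable_conductance_integrand : measurable_fun `]t0, +oo[%classic
  (fun t : R => (t * f t)%:E * effective_conductance q m t^-1 x).
Proof.
have t0_gt0 := weight_t0_gt0 hw.
have mK : measurable (`]t0, +oo[%classic : set R) by exact: measurable_itv.
apply: (eq_measurable_fun
  (fun t : R => (t * f t * (m x * ((t^-1 - q x x) * (1 - phi t))))%:E)).
  move=> t; rewrite inE/= in_itv/= andbT => kt.
  by rewrite conductanceE ?(lt_trans t0_gt0)// EFinM.
apply/measurable_EFinP; apply: measurable_funM.
  by apply: measurable_funM => //; exact: (measurable_weight_derive2S hw).
apply: measurable_funM => //; apply: measurable_funM; last first.
  exact: measurable_funB.
apply: measurable_funB => //.
apply: open_continuous_measurable_fun; first exact: interval_open.
move=> y; rewrite inE/= in_itv/= andbT => ty.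
apply: (@cvgV _ _ _ _ id); last exact: cvg_id.
by rewrite gt_eqF// (lt_trans t0_gt0).
Qed.

Let mJ : measurable_fun `[k, +oo[%classic
  (fun t : R => (t * f t)%:E * effective_conductance q m t^-1 x).
Proof.
apply: measurable_funS measurable_conductance_integrand.
  exact: measurable_itv.
by move=> y; rewrite /= !in_itv/= !andbT; exact: lt_le_trans.
Qed.

Let J0 (t : R) : `[k, +oo[%classic t ->
  0 <= (t * f t)%:E * effective_conductance q m t^-1 x.
Proof.
rewrite /= in_itv/= andbT => kt; apply: conductance_integrand_ge0.
exact: lt_le_trans kt.
Qed.

(** By [conductanceE], t C(1 / t) is m_x (1 / t + q_x) times t (1 - phi t); on [k, +oo[ the first
    factor is at most its value at k. *)
Lemma conductance_integral_le :
  \int[mu]_(t in `[k, +oo[) ((t * f t)%:E * effective_conductance q m t^-1 x) <=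
  (m x * (k^-1 - q x x))%:E * \int[mu]_(t in `[k, +oo[) ((f t)%:E * psi t).
Proof.
have mK : measurable (`[k, +oo[%classic : set R) by exact: measurable_itv.
have c0 : (0 <= m x * (k^-1 - q x x))%R.
  by apply: mulr_ge0; [exact: ltW|have := invt_gt0 k_gt0; have := q_gt0; lra].
have mpsi := measurable_truncated_mean (Pr x) hw t0k mtau tau_ge0.
have psi0 t : `[k, +oo[%classic t -> 0 <= (f t)%:E * psi t.
  rewrite /= in_itv/= andbT => kt; apply: mule_ge0; first by rewrite lee_fin.
  by apply: truncated_mean_ge0 => //; rewrite (le_trans _ kt)// ltW.
rewrite -ge0_integralZl//.
apply: ge0_le_integral => //; first exact: measurable_funeM.
move=> t; rewrite /= in_itv/= andbT => kt; have t_gt0 := lt_le_trans k_gt0 kt.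
have -> : (t * f t)%:E * effective_conductance q m t^-1 x =
    (m x * (t^-1 - q x x))%:E * ((f t)%:E * (t * (1 - phi t))%:E).
  by rewrite conductanceE// -!EFinM; congr EFin; ring.
have a0 := phi_compl_ge0 t_gt0.
apply: lee_pmul.
- rewrite lee_fin; apply: mulr_ge0; first exact: ltW.
  by have := invt_gt0 t_gt0; have := q_gt0; lra.
- by apply: mule_ge0; rewrite lee_fin.
- by rewrite lee_fin ler_pM2l// lerD2r lef_pV2.
- by apply: lee_wpmul2l; [rewrite lee_fin|exact: mean_laplace_le].
Qed.

(** Here 1 / t + q_x is bounded below by q_x; the factor 2 is that of [mine_laplace_le]. *)
Lemma conductance_integral_ge :
  (m x * (- q x x))%:E * \int[mu]_(t in `[k, +oo[) ((f t)%:E * psi t) <=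
  2%:E * \int[mu]_(t in `[k, +oo[) ((t * f t)%:E * effective_conductance q m t^-1 x).
Proof.
have mK : measurable (`[k, +oo[%classic : set R) by exact: measurable_itv.
have c0 : (0 <= m x * - q x x)%R by apply: mulr_ge0; exact: ltW.
have mpsi := measurable_truncated_mean (Pr x) hw t0k mtau tau_ge0.
have psi0 t : `[k, +oo[%classic t -> 0 <= (f t)%:E * psi t.
  rewrite /= in_itv/= andbT => kt; apply: mule_ge0; first by rewrite lee_fin.
  by apply: truncated_mean_ge0 => //; rewrite (le_trans _ kt)// ltW.
rewrite -[leLHS]ge0_integralZl// -[leRHS]ge0_integralZl//.
apply: ge0_le_integral => //.
- by move=> t kt; apply: mule_ge0; [rewrite lee_fin|exact: psi0].
- exact: measurable_funeM.
- exact: measurable_funeM.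
move=> t; rewrite /= in_itv/= andbT => kt; have t_gt0 := lt_le_trans k_gt0 kt.
have -> : 2%:E * ((t * f t)%:E * effective_conductance q m t^-1 x) =
    (m x * (t^-1 - q x x))%:E * ((f t)%:E * (2 * (t * (1 - phi t)))%:E).
  by rewrite conductanceE// -!EFinM; congr EFin; ring.
apply: lee_pmul.
- by rewrite lee_fin.
- by apply: psi0; rewrite /= in_itv/= kt.
- by rewrite lee_fin ler_pM2l// lerDr ltW// invt_gt0.
- by apply: lee_wpmul2l; [rewrite lee_fin|exact: mean_le_laplace].
Qed.

Lemma conductance_integral_iff :
  \int[mu]_(t in `[k, +oo[) ((t * f t)%:E * effective_conductance q m t^-1 x) < +oo <->
  \int[Pr x]_om extend_weight w (return_time X x om) < +oo.
Proof.
rewrite -(truncated_mean_integrable_iff (Pr x) hw t0k mtau tau_ge0).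
have psi0 : 0 <= \int[mu]_(t in `[k, +oo[) ((f t)%:E * psi t).
  apply: integral_ge0 => t; rewrite /= in_itv/= andbT => kt.
  apply: mule_ge0; first by rewrite lee_fin.
  by apply: truncated_mean_ge0 => //; rewrite (le_trans _ kt)// ltW.
have mq : (0 < m x * - q x x)%R by exact: mulr_gt0.
split=> fin.
(* As m_x q_x > 0, an infinite integral of |w''| [psi] would make the left side of
   [conductance_integral_ge] infinite. *)
- have := le_lt_trans conductance_integral_ge (lte_mul_pinfty _ _ fin).
  rewrite lee_fin ler0n => /(_ isT isT); move: psi0.
  case: (\int[mu]_(t in _) (_ * psi _)) => [r||]//; rewrite ?ltry//.
  by rewrite gt0_muley ?lte_fin.
- apply: (le_lt_trans conductance_integral_le); apply: lte_mul_pinfty => //.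
  rewrite lee_fin; apply: mulr_ge0; first exact: ltW.
  by have := invt_gt0 k_gt0; have := q_gt0; lra.
Qed.

End ConductanceIntegral.

Theorem theorem4p4 (R : realType) (I : countType)
    (d : measure_display) (T : measurableType d)
    (P : R -> I -> I -> R) (q : I -> I -> R) (m : I -> R)
    (Pr : I -> probability T R) (X : R -> T -> I)
    (w : R -> R) (t0 : R) (x : I)
    (hP : honest_standard_transition_function P)
    (hirr : irreducible_transition P)
    (hq : is_Qmatrix P q)
    (hreg : regular_Qmatrix q)
    (hX : markov_chain P Pr X)
    (hne : non_explosive Pr X)
    (hrev : reversible_wrt P m)
    (hw : condition_C w t0) :
  (\int[Pr x]_om extend_weight w (return_time X x om) < +oo)%E <->
  (exists2 k : R, t0 <= k &
     (\int[lebesgue_measure]_(t in `[k, +oo[)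
        ((t * `|(w^`(2))%classic t|)%:E * effective_conductance q m t^-1 x) < +oo)%E).
Proof.
have m_gt0 := reversible_measure_gt0 hrev hirr.
have m_sym := reversible_Qmatrix hrev hq.
have iff k := @conductance_integral_iff _ _ _ _ P q m Pr X w t0 k x
  hP hq hreg hX hne m_gt0 m_sym hw.
split=> [fin|[k t0k fin]].
  (* The equivalence is available for k > t0 strictly, since w'' is controlled only in the open
     half-line. *)
  by exists (t0 + 1); rewrite ?lerDl//; apply/iff; rewrite ?ltrDl.
have t0_gt0 := weight_t0_gt0 hw.
(* The given [k] may equal [t0], so the equivalence is applied at k + 1. *)
apply/(iff (k + 1)); first by rewrite ltr_pwDr.
have mJ : measurable_fun `]k, +oo[%classic (fun t : R =>
    (t * `|(w^`(2))%classic t|)%:E * effective_conductance q m t^-1 x)%E.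
  apply: measurable_funS (measurable_conductance_integrand x hP hq hreg hX hne m_gt0 m_sym hw).
    exact: measurable_itv.
  by move=> t; rewrite /= !in_itv/= !andbT; exact: le_lt_trans.
(* When k = t0 the value of w'' at the endpoint is uncontrolled. Removing this single point does not
   change the integral and leaves a measurable, nonnegative integrand, of which the integral from k
   + 1 is a part. *)
apply: le_lt_trans fin; rewrite -[leRHS]integral_itv_obnd_cbnd//.
apply: ge0_subset_integral => //.
- move=> t; rewrite /= in_itv/= andbT => kt.
  apply: (conductance_integrand_ge0 w x hP hq hreg hX hne m_gt0 m_sym).
  exact: lt_trans (lt_le_trans t0_gt0 t0k) kt.
- by move=> t; rewrite /= !in_itv/= !andbT; apply: lt_le_trans; rewrite ltrDl.
Qed.
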